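(* Let $b\in2^{F^0}$ and let $u$ be the ($\mathcal H$-valued) solution to the SPDE $du=\dot u\,dt$, $d\dot u=-2\beta\dot u\,dt+\Delta_bu\,dt+dW$, $u(0)=\dot u(0)=0$, with $\beta=0$. (1) If $b\ne N$, then $t^{-1/2}u(t)$ has a non-trivial weak limit in $\mathcal H$ as $t\to\infty$. (2) If $b=N$, then $t^{-1/2}u(t)$ has no weak limit in $\mathcal H$ as $t\to\infty$. However, $u-Y^{N,\beta}_1\phi^N_1$ and $Y^{N,\beta}_1\phi^N_1$ are independent $\mathcal H$-valued processes and $t^{-1/2}\left(u(t)-Y^{N,\beta}_1(t)\phi^N_1\right)$ has a non-trivial weak limit in $\mathcal H$ as $t\to\infty$.
   Context: ''Weak limit'' is meant in the probabilistic sense (convergence in distribution of $\mathcal H$-valued random variables); non-trivial means the limit law is not a point mass. $b=N$ means $b=F^0$ (Neumann boundary conditions). Fractal setting. Let $M\ge2$, $I=\{1,\dots,M\}$, and let $F$ be a connected compact metric space with injective strict contractions $\psi_i:F\to F$ ($i\in I$), $F=\bigcup_i\psi_i(F)$. Put $\mathbb W_n=I^n$, $\mathbb W_*=\bigcup_{n\ge0}\mathbb W_n$, $\mathbb W=I^{\mathbb N}$, $\psi_w=\psi_{w_1}\circ\cdots\circ\psi_{w_n}$ and $F_w=\psi_w(F)$ for $w=w_1\cdots w_n\in\mathbb W_n$ (identity for the empty word). Let $\pi:\mathbb W\to F$ be the continuous surjection with $\{\pi(w)\}=\bigcap_n F_{w_1\cdots w_n}$. With $\sigma$ the left shift on $\mathbb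 W$ and $C=\pi^{-1}(\bigcup_{i\ne j}F_i\cap F_j)$, assume the post-critical set $P=\bigcup_{n\ge1}\sigma^n(C)$ is finite (so $(F,(\psi_i))$ is a p.c.f. self-similar set). Let $F^0=\pi(P)$, $F^n=\bigcup_{w\in\mathbb W_n}\psi_w(F^0)$. Let $(A_0,\mathbf r)$ be a regular irreducible harmonic structure: $A_0=(a_{xy})_{x,y\in F^0}$ is a real symmetric irreducible matrix with $a_{xy}\ge0$ for $x\ne y$ and zero row sums, $\mathbf r=(r_1,\dots,r_M)$ with $r_i\in(0,1)$, and, writing $\mathcal E_0(f,f)=\frac12\sum_{x,y\in F^0}a_{xy}(f(x)-f(y))^2$, $r_w=\prod_i r_{w_i}$ and $\mathcal E_n(f,f)=\sum_{w\in\mathbb W_n}r_w^{-1}\mathcal E_0(f\circ\psi_w|_{F^0},f\circ\psi_w|_{F^0})$ for $f:F^n\to\mathbb R$, one has $\mathcal E_0(f,f)=\min\{\mathcal E_1(g,g):g:F^1\to\mathbb R,\ g|_{F^0}=f\}$ for all $f:F^0\to\mathbb R$. Let $\mathcal D=\{f\in C(F):\sup_n\mathcal E_n(f|_{F^n},f|_{F^n})<\infty\}$, $\mathcal E(f,f)=\lim_n\mathcal E_n(f|_{F^n},f|_{F^n})$ (extended to a bilinear form by polarisation). Let $d_H$ be the unique real with $\sum_i r_i^{d_H}=1$ and $\mu$ the Borel probability measure on $F$ with $\mu(F_w)=r_w^{d_H}$ for all $w\in\mathbb W_*$. Let $\mathcal H=L^2(F,\mu)$ with inner product $\langle\cdot,\cdot\rangle_\mu$.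 For $b\subseteq F^0$ (i.e. $b\in2^{F^0}$) let $\mathcal D_b=\{f\in\mathcal D:f|_{F^0\setminus b}=0\}$; $(\mathcal E,\mathcal D_b)$ is a Dirichlet form on $\mathcal H$ and $\Delta_b$ is its generator, the nonpositive self-adjoint operator with: $f\in\mathcal D(\Delta_b)$, $\Delta_bf=h$ iff $f\in\mathcal D_b$ and $\mathcal E(f,g)=-\langle h,g\rangle_\mu$ for all $g\in\mathcal D_b$. There is an orthonormal basis $(\phi^b_k)_{k\ge1}$ of $\mathcal H$ with $-\Delta_b\phi^b_k=\lambda^b_k\phi^b_k$, $0\le\lambda^b_1\le\lambda^b_2\le\cdots$. Noise and solution. $W$ is a cylindrical Wiener process on $\mathcal H$: $\mathbb E[\langle f,W(s)\rangle_\mu\langle W(t),g\rangle_\mu]=(s\wedge t)\langle f,g\rangle_\mu$; thus $(\langle\phi^b_k,W\rangle_\mu)_{k\ge1}$ are independent standard real Brownian motions. For $\lambda,\beta\ge0$, $V_\beta(\lambda,\cdot):[0,\infty)\to\mathbb R$ is the unique solution of $v''+2\beta v'+\lambda v=0$, $v(0)=0$, $v'(0)=1$. Put $Y^{b,\beta}_k(t)=\int_0^tV_\beta(\lambda^b_k,t-s)\langle\phi^b_k,dW(s)\rangle_\mu$. The unique global solution of the SPDE is the $\mathcal H$-valued centred Gaussian process $u(t)=\int_0^tV_\beta(-\Delta_b,t-s)\,dW(s)=\sum_{k\ge1}Y^{b,\beta}_k(t)\phi^b_k$ (series in $L^2(\Omega;\mathcal H)$). *)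

(* Defs.v *)
From HB Require Import structures.
From mathcomp Require Import all_boot all_order all_algebra.
From mathcomp Require Import all_classical all_reals all_analysis.
From mathcomp Require Import measurable_realfun.
Set Implicit Arguments.
Unset Strict Implicit.
Unset Printing Implicit Defensive.
Import Order.TTheory GRing.Theory Num.Theory.
Import numFieldNormedType.Exports.
Local Open Scope classical_set_scope.
Local Open Scope ring_scope.

(* The library provides L^2(mu) as a type of a.e.-classes of functions but no
   algebraic or normed structure on it; the instances below make it a
   normedModType for the norm 'N[mu]_2. *)
Section L2.
Context d (T : measurableType d) (R : realType) (mu : {measure set T -> \bar R}).

Local Notation L2 := (LspaceType mu (lee1n 2)).
Local Notation Lf := (LfunType mu (lee1n 2)).

Lemma L2_measurable (f : L2) : measurable_fun [set: T] (f : T -> R).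
Proof. exact: (@measurable_funPT _ _ _ _ (repr (f : {mfun_ mu, T >-> measurableTypeR R}))). Qed.

Lemma L2_Lfun (f : L2) : (f : T -> R) \in Lfun mu 2%:E.
Proof.
rewrite inE; apply/andP; split; rewrite inE/=; first exact: L2_measurable.
exact: Lebesgue_finite.
Qed.

Lemma ae_Lnorm2 (f g : T -> R) : measurable_fun setT f -> measurable_fun setT g ->
  f = g %[ae mu] -> 'N[mu]_2%:E[EFin \o f]%E = 'N[mu]_2%:E[EFin \o g]%E.
Proof.
move=> mf mg fg; rewrite unlock /Lnorm; congr (_ `^ _)%E.
have m (h : T -> R) : measurable_fun setT h ->
    measurable_fun setT (EFin \o (fun x => `|h x| `^ 2)).
  move=> mh; apply/measurable_EFinP.
  by apply: (measurableT_comp (measurable_powR _)); exact: measurableT_comp.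
apply: ae_eq_integral => //; [exact: m|exact: m|].
by apply: filterS fg => x /= + Dx => ->.
Qed.

Definition L2_rep (f : L2) : Lf := Lfun_Sub (lee1n 2) (L2_Lfun f).

Lemma L2_mfun (f : Lf) : measurable_fun [set: T] (f : T -> measurableTypeR R).
Proof. exact: (@measurable_funPT _ _ T R f). Qed.

Definition L2_quot (f : Lf) : {mfun_ mu, T >-> measurableTypeR R} :=
  \pi_({mfun_ mu, T >-> measurableTypeR R})%qT (@mfun_Sub _ _ T (measurableTypeR R) f (mem_set (L2_mfun f))).

Lemma L2_quotK (f : Lf) : (L2_quot f : T -> R) = f %[ae mu].
Proof.
have /eqP := reprK (L2_quot f).
by rewrite /L2_quot eqmodE => /asboolP; apply: filterS => x.
Qed.

Lemma L2_quot_finite (f : Lf) : finite_norm mu 2%:E (L2_quot f : T -> R).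
Proof.
have mq : measurable_fun setT (L2_quot f : T -> R).
  exact: (@measurable_funPT _ _ _ _ (repr (L2_quot f))).
rewrite /finite_norm (ae_Lnorm2 mq (L2_mfun f) (L2_quotK f)).
exact: Lfunction_finite.
Qed.

HB.instance Definition _ (f : Lf) :=
  isFinLebesgue.Build _ _ _ mu _ (lee1n 2) (L2_quot f) (L2_quot_finite f).

Definition L2_class (f : Lf) : L2 := L2_quot f.

Lemma L2_repK f : L2_rep (L2_class f) = f %[ae mu].
Proof. exact: L2_quotK. Qed.

Lemma L2P (f g : L2) : L2_rep f = L2_rep g %[ae mu] -> f = g.
Proof.
case: f g => [f [[f2]]] [g [[g2]]] /= fg.
have e : f = g.
  by rewrite -[f]reprK -[g]reprK; apply/eqP; rewrite eqmodE; apply/asboolP.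
by case: _ / e g2 {fg} => g2; rewrite (Prop_irrelevance f2 g2).
Qed.
HB.instance Definition _ := gen_eqMixin L2.
HB.instance Definition _ := gen_choiceMixin L2.

Lemma L2_classP (f g : Lf) : f = g %[ae mu] -> L2_class f = L2_class g.
Proof.
move=> fg; apply: L2P; have e1 := L2_repK f; have e2 := L2_repK g.
by apply: filterS3 e1 e2 fg => x /= e1 e2 e3 Dx; rewrite e1// e2// e3.
Qed.

Definition L2_zero := L2_class 0.
Definition L2_opp (f : L2) := L2_class (- L2_rep f).
Definition L2_add (f g : L2) := L2_class (L2_rep f + L2_rep g).
Definition L2_scale (a : R) (f : L2) := L2_class (a *: L2_rep f).

Lemma L2_addA : associative L2_add.
Proof.
move=> f g h; apply: L2_classP.
have e1 := L2_repK (L2_rep f + L2_rep g).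
have e2 := L2_repK (L2_rep g + L2_rep h).
by apply: filterS2 e1 e2 => x /= e1 e2 Dx /=; rewrite !fctE e1// e2// !fctE addrA.
Qed.

Lemma L2_addC : commutative L2_add.
Proof. by move=> f g; rewrite /L2_add addrC. Qed.

Lemma L2_add0 : left_id L2_zero L2_add.
Proof.
move=> f; apply: L2P.
have e1 := L2_repK 0; have e2 := L2_repK (L2_rep L2_zero + L2_rep f).
by apply: filterS2 e1 e2 => x /= e1 e2 Dx; rewrite e2// !fctE e1// add0r.
Qed.

Lemma L2_addN : left_inverse L2_zero L2_opp L2_add.
Proof.
move=> f; apply: L2_classP.
by have := L2_repK (- L2_rep f); apply: filterS => x /= e Dx; rewrite !fctE e// addNr.
Qed.

HB.instance Definition _ :=
  GRing.isZmodule.Build L2 L2_addA L2_addC L2_add0 L2_addN.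

Lemma L2_scaleA a b (f : L2) : L2_scale a (L2_scale b f) = L2_scale (a * b) f.
Proof.
apply: L2_classP; have := L2_repK (b *: L2_rep f).
by apply: filterS => x /= e Dx; rewrite !fctE e// !fctE scalerA.
Qed.

Lemma L2_scale1 : left_id 1 L2_scale.
Proof.
by move=> f; apply: L2P; rewrite /L2_scale scale1r; exact: L2_repK.
Qed.

Lemma L2_scaleDr : right_distributive L2_scale +%R.
Proof.
move=> a f g; apply: L2_classP.
have e1 := L2_repK (L2_rep f + L2_rep g).
have e2 := L2_repK (a *: L2_rep f); have e3 := L2_repK (a *: L2_rep g).
apply: filterS3 e1 e2 e3 => x /= e1 e2 e3 Dx.
by rewrite !fctE e1// e2// e3// !fctE scalerDr.
Qed.

Lemma L2_scaleDl f : {morph L2_scale^~ f : a b / a + b}.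
Proof.
move=> a b; apply: L2_classP.
have e1 := L2_repK (a *: L2_rep f); have e2 := L2_repK (b *: L2_rep f).
apply: filterS2 e1 e2 => x /= e1 e2 Dx.
by rewrite !fctE e1// e2// !fctE scalerDl.
Qed.

HB.instance Definition _ :=
  GRing.Zmodule_isLmodule.Build R L2 L2_scaleA L2_scale1 L2_scaleDr L2_scaleDl.

Definition L2_norm (f : L2) : R := fine 'N[mu]_2%:E[EFin \o (f : T -> R)].

Lemma L2_norm_class (f : Lf) : L2_norm (L2_class f) = fine 'N[mu]_2%:E[EFin \o f].
Proof.
congr fine; apply: ae_Lnorm2; [exact: L2_measurable|exact: measurable_funPT|].
exact: L2_repK.
Qed.

Lemma L2_normD f g : L2_norm (f + g) <= L2_norm f + L2_norm g.
Proof. by rewrite L2_norm_class; exact: ler_LnormD. Qed.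

Lemma L2_normZ a f : L2_norm (a *: f) = `|a| * L2_norm f.
Proof.
apply: EFin_inj; rewrite L2_norm_class EFinM.
rewrite (finite_norm_fine (a *: L2_rep f)) (finite_norm_fine (L2_rep f)).
exact: LnormZ.
Qed.

Lemma L2_norm0 f : L2_norm f = 0 -> f = 0.
Proof.
move=> /(@fine_Lnormr_eq0 _ _ _ _ _ (lee1n 2) (L2_rep f)) f0; apply: L2P.
by have := L2_repK 0; apply: filterS2 f0 => x /= e1 e2 Dx; rewrite e1// e2.
Qed.

HB.instance Definition _ := Lmodule_isNormed.Build R L2 L2_normD L2_normZ L2_norm0.

End L2.

Notation "'L2' mu" := (LspaceType mu (lee1n 2)) (at level 10, mu at level 9).

Notation Borel E := (g_sigma_algebraType (@open E)).

(* Measurable types are pointed in the library. *)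
#[short(type="pointedMetricType")]
HB.structure Definition PointedMetric (K : numDomainType) :=
  {E of Metric K E & isPointed E}.

Definition dot d (T : measurableType d) (R : realType)
    (mu : {measure set T -> \bar R}) (f g : T -> R) : R :=
  \int[mu]_x (f x * g x).

Section SelfSimilar.
Context (R : realType) (F : pointedMetricType R) (M : nat).
Variables (psi : 'I_M -> F -> F) (pi : (nat -> 'I_M) -> F).

Definition strict_contraction (f : F -> F) : Prop :=
  exists2 c : R, 0 <= c < 1 & forall x y, mdist (f x) (f y) <= c * mdist x y.

Definition word_map (w : seq 'I_M) (x : F) : F := foldr psi x w.

Definition cell (w : seq 'I_M) : set F := range (word_map w).

Definition shift (n : nat) (w : nat -> 'I_M) : nat -> 'I_M :=
  fun k => w (k + n)%N.

Definition critical : set (nat -> 'I_M) :=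
  [set w | exists i j, i != j /\ (range (psi i) `&` range (psi j)) (pi w)].

Definition postcritical : set (nat -> 'I_M) :=
  \bigcup_(n in [set n | (1 <= n)%N]) (shift n @` critical).

Definition boundary : set F := pi @` postcritical.

(* The coding condition determines pi, and makes it a continuous surjection. *)
Record pcf_self_similar : Prop := {
  pcf_two : (2 <= M)%N;
  pcf_connected : connected [set: F];
  pcf_compact : compact [set: F];
  pcf_injective : forall i, injective (psi i);
  pcf_contraction : forall i, strict_contraction (psi i);
  pcf_cover : \bigcup_i range (psi i) = [set: F];
  pcf_coding : forall w, \bigcap_n cell (mkseq w n) = [set pi w];
  pcf_finite : finite_set postcritical
}.

(* A_0 is a function on F x F of which only the entries indexed by F^0 are
   used; likewise a function on F^n is represented by a function on F, of which
   [energy_at n] only reads the values on F^n. *)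
Variables (a : F -> F -> R) (r : 'I_M -> R).

Definition weight (w : seq 'I_M) : R := \prod_(i <- w) r i.

Definition energy0 (f : F -> R) : R :=
  2^-1 * \sum_(x \in boundary) \sum_(y \in boundary)
           a x y * (f x - f y) ^+ 2.

Definition energy_at (n : nat) (f : F -> R) : R :=
  \sum_(w : n.-tuple 'I_M) (weight w)^-1 * energy0 (f \o word_map w).

Definition irreducible_on (V : set F) : Prop :=
  forall S : set F, S `<=` V -> S !=set0 -> S <> V ->
    exists x y, [/\ S x, (V `\` S) y & a x y != 0].

Record regular_harmonic_structure : Prop := {
  hs_sym : forall x y, boundary x -> boundary y -> a x y = a y x;
  hs_ge0 : forall x y, boundary x -> boundary y -> x != y -> 0 <= a x y;
  hs_row : forall x, boundary x -> \sum_(y \in boundary) a x y = 0;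
  hs_irreducible : irreducible_on boundary;
  hs_ratio : forall i, 0 < r i < 1;
  hs_min : forall f : F -> R,
    (exists2 g : F -> R, {in boundary, g =1 f} & energy_at 1%N g = energy0 f) /\
    (forall g : F -> R, {in boundary, g =1 f} -> energy0 f <= energy_at 1%N g)
}.

Definition form_domain (f : F -> R) : Prop :=
  continuous f /\ has_ubound (range (energy_at ^~ f)).

Definition energy (f : F -> R) : R := limn (energy_at ^~ f).

Definition form (f g : F -> R) : R :=
  4^-1 * (energy (f \+ g) - energy (f \- g)).

Definition form_domain_bc (b : set F) (f : F -> R) : Prop :=
  form_domain f /\ {in boundary `\` b, forall x, f x = 0}.

Definition self_similar_measure (dH : R) (mu : set F -> \bar R) : Prop :=
  forall w, mu (cell w) = (weight w `^ dH)%:E.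

Variable mu : {measure set (Borel F) -> \bar R}.

(* f is in the domain of the generator with boundary condition b, with image h;
   ft is the continuous representative of the class f. *)
Definition generator (b : set F) (f h : L2 mu) : Prop :=
  exists2 ft : F -> R, form_domain_bc b ft /\ ft = f %[ae mu] &
    forall g, form_domain_bc b g -> form ft g = - dot mu h g.

(* Indices start at 0: phi 0 is the first eigenfunction. *)
Record eigenbasis (b : set F) (phi : nat -> L2 mu) (lambda : nat -> R) :
    Prop := {
  eb_orthonormal : forall i j, dot mu (phi i) (phi j) = (i == j)%:R;
  eb_complete : forall f : L2 mu,
    \sum_(k < n) dot mu f (phi k) *: phi k @[n --> \oo] --> f;
  eb_eigen : forall k, generator b (phi k) (- (lambda k *: phi k));
  eb_ge0 : 0 <= lambda 0%N;
  eb_nondecreasing : nondecreasing_seq lambda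
}.

End SelfSimilar.

Section Stochastic.
Context d (Omega : measurableType d) (R : realType) (P : probability Omega R).

(* The Gaussian law of variance 0 is the Dirac mass; [normal_prob 0 0] is not. *)
Definition centred_gaussian (X : Omega -> R) : Prop :=
  exists2 s : R, 0 <= s & forall A : set R, measurable A ->
    P (X @^-1` A) = if s == 0 then \d_(0 : R) A else normal_prob 0 s A.

Section Cylindrical.
Context d' (T : measurableType d') (mu : {measure set T -> \bar R}).

(* W t f stands for <f, W(t)>. *)
Record cylindrical_wiener (W : R -> L2 mu -> {RV P >-> R}) : Prop := {
  cw_gaussian : forall n (c t : 'I_n -> R) (f : 'I_n -> L2 mu),
    (forall i, 0 <= t i) ->
    centred_gaussian (fun w => \sum_(i < n) c i * W (t i) (f i) w);
  cw_covariance : forall (s t : R) (f g : L2 mu), 0 <= s -> 0 <= t ->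
    'E_P[(fun w => W s f w * W t g w)%R]%E =
      (Num.min s t * dot mu f g)%:E;
  cw_continuous : forall f,
    {ae P, forall w, {within `[0, +oo[, continuous (fun t => W t f w)}}
}.

End Cylindrical.

(* A step function is a list of triples (c, (x, y)), standing for the sum of the
   c 1_]x, y]. *)
Definition step_on (t : R) (s : seq (R * (R * R))) : Prop :=
  {in s, forall p, [&& 0 <= p.2.1, p.2.1 <= p.2.2 & p.2.2 <= t]}.

Definition step_fun (s : seq (R * (R * R))) (x : R) : R :=
  \sum_(p <- s) p.1 * \1_(`]p.2.1, p.2.2]%classic : set R) x.

Definition step_integral (B : R -> Omega -> R) (s : seq (R * (R * R)))
    (w : Omega) : R :=
  \sum_(p <- s) p.1 * (B p.2.2 w - B p.2.1 w).

(* Z = \int_0^t h dB: the L^2(P)-limit of the integrals of step functions that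
   converge to h in L^2([0, t]). *)
Definition wiener_integral (B : R -> Omega -> R) (t : R) (h : R -> R)
    (Z : Omega -> R) : Prop :=
  exists s : nat -> seq (R * (R * R)),
    [/\ forall n, step_on t (s n),
        (\int[lebesgue_measure]_(x in `[0%R, t]%classic)
           ((h x - step_fun (s n) x) ^+ 2)%R%:E)%E @[n --> \oo] --> 0%E &
        'E_P[(fun w => (Z w - step_integral B (s n) w) ^+ 2)%R]%E
          @[n --> \oo] --> 0%E].

(* v'' + 2 beta v' + lambda v = 0 on [0, +oo[, v 0 = 0, v' 0 = 1, where v' at 0
   is one-sided. *)
Definition damped_oscillator (beta lambda : R) (v : R -> R) : Prop :=
  exists v' : R -> R,
    [/\ v 0 = 0 /\ v' 0 = 1,
        {within `[0, +oo[, continuous v},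
        {within `[0, +oo[, continuous v'},
        forall t : R, 0 < t -> is_derive t 1 v (v' t) &
        forall t : R, 0 < t ->
          is_derive t 1 v' (- (2 * beta * v' t) - lambda * v t)].

Section Processes.
Context (E : normedModType R).

Definition series_process (Y : nat -> R -> Omega -> R) (phi : nat -> E)
    (u : R -> Omega -> E) : Prop :=
  forall t : R, 0 <= t ->
    measurable_fun [set: Omega] (u t : Omega -> Borel E) /\
    'E_P[(fun w => `|u t w - \sum_(k < n) Y k t w *: phi k| ^+ 2)%R]%E
      @[n --> \oo] --> 0%E.

Definition weak_limit (X : R -> Omega -> E) (nu : probability (Borel E) R) :
    Prop :=
  forall g : E -> R, continuous g -> (exists K, forall x, `|g x| <= K) ->
    'E_P[fun w => g (X t w)]%E @[t --> +oo] --> (\int[nu]_x (g x)%:E)%E.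

Definition nontrivial (nu : probability (Borel E) R) : Prop :=
  ~ exists x : Borel E, forall A : set (Borel E),
      measurable A -> nu A = \d_x A.

Definition process_sigma (X : R -> Omega -> E) : set (set Omega) :=
  <<s [set A | exists2 t, 0 <= t &
         exists2 B : set (Borel E), measurable B & A = X t @^-1` B] >>.

Definition process (X : R -> Omega -> E) : Prop :=
  forall t, 0 <= t -> measurable_fun [set: Omega] (X t : Omega -> Borel E).

Definition independent_processes (X X' : R -> Omega -> E) : Prop :=
  forall A A', process_sigma X A -> process_sigma X' A' ->
    P (A `&` A') = (P A * P A')%E.

End Processes.

End Stochastic.

(* Main.v *)
Require Import Defs.
From HB Require Import structures.
From mathcomp Require Import all_boot all_order all_algebra.
From mathcomp Require Import all_classical all_reals all_analysis.
From mathcomp Require Import measurable_realfun.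
From mathcomp Require Import ring lra.
Set Implicit Arguments.
Unset Strict Implicit.
Unset Printing Implicit Defensive.
Import Order.TTheory GRing.Theory Num.Theory.
Import numFieldNormedType.Exports.
Local Open Scope classical_set_scope.
Local Open Scope ring_scope.

(** The coordinate Y_k(t) = <u(t), phi_k> is a Wiener integral, a centred
   Gaussian of variance sigma_k(t) = t/(2 l_k) - sin(2 sqrt(l_k) t)/(4 l_k^(3/2))
   (t^3/3 if l_k = 0), and distinct coordinates are independent.  As soon as
   sqrt(l_k) t >= 1, sigma_k(t)/t lies between 1/(4 l_k) and 3/(4 l_k), so the
   convergence of the series u(t) at a single time forces the sum of 1/l_k over
   the positive eigenvalues to be finite.  Hence t^(-1/2) u(t), deprived of the
   constant mode if l_0 = 0, has the law of
     U_t = sum_k (sigma_k(t)/t)^(1/2) xi_k phi_k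
   for one fixed sequence (xi_k) of independent standard Gaussians, and U_t tends
   almost surely, by dominated convergence in l^2, to
   sum_k (2 l_k)^(-1/2) xi_k phi_k, whose law is the limit.  The lowest eigenvalue
   is positive unless b = F^0: a function of zero energy is constant, because
   cells of a connected self-similar set are chained through their boundaries.
   For b = F^0 the constant mode has variance t^2/3 after scaling, so that the
   characteristic function of its law tends to 0 off the origin, which excludes a
   weak limit. *)

(** * Square-integrable functions *)

Section SquareIntegrable.
Context d (T : measurableType d) (R : realType) (mu : {measure set T -> \bar R}).
Implicit Types f g h : T -> R.

(** Gaussianity, variances and independence are all handled through one object, the closed linear
    span [gspace W A] in L^2(P) of the variables [W t f] with [f] in [A]. Mean-square limits stay
    inside it, every element has an explicit characteristic function, and the spans of orthogonal
    sets are independent, so that only variances have to be computed. The identity between a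
    coordinate of [u t] and [Y k t] holds only off a null set that depends on [t]. This is harmless:
    [gspace] absorbs null modifications, and independence is proved for the sigma-algebra generated
    by the whole span, however many times are involved. The fixed sequence of Gaussians reproduces
    the law at each single time, which is all that a weak limit sees. Everything stays real: cosines
    with an arbitrary phase replace complex exponentials. *)

Definition sqint f : Prop :=
  measurable_fun setT f /\ mu.-integrable setT (fun x => (f x ^+ 2)%:E).

Lemma sqint_bound f g : measurable_fun setT f ->
  mu.-integrable setT (EFin \o g) -> (forall x, f x ^+ 2 <= g x) -> sqint f.
Proof.
move=> mf ig fg; split=> //; apply: le_integrable ig => //.
  by apply/measurable_EFinP; exact: measurable_funX.
move=> x _ /=; rewrite lee_fin ger0_norm ?sqr_ge0//.
exact: le_trans (fg x) (ler_norm _).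
Qed.

Lemma sqint_mul f g : sqint f -> sqint g ->
  mu.-integrable setT (EFin \o (f \* g)).
Proof.
move=> [mf f2] [mg g2]; have fg := integrableD measurableT f2 g2.
apply: le_integrable fg => //.
  by apply/measurable_EFinP; exact: measurable_funM.
move=> x _ /=; rewrite lee_fin normrM.
rewrite [leRHS]ger0_norm ?addr_ge0 ?sqr_ge0//.
rewrite -[f x ^+ 2]real_normK ?num_real// -[g x ^+ 2]real_normK ?num_real//.
have := sqr_ge0 (`|f x| - `|g x|); have := normr_ge0 (f x); have := normr_ge0 (g x).
nra.
Qed.

Lemma sqint0 : sqint (fun=> 0).
Proof.
split; first exact: measurable_cst.
by under eq_fun do rewrite expr0n/=; exact: integrable0.
Qed.

Lemma sqintD f g : sqint f -> sqint g -> sqint (f \+ g).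
Proof.
move=> [mf f2] [mg g2].
apply: (@sqint_bound _ (fun x => 2 * f x ^+ 2 + 2 * g x ^+ 2)).
- exact: measurable_funD.
- have := integrableD measurableT (integrableZl measurableT 2 f2)
                      (integrableZl measurableT 2 g2).
  by apply: eq_integrable => // x _.
- by move=> x /=; have := sqr_ge0 (f x - g x); nra.
Qed.

Lemma sqintZ c f : sqint f -> sqint (fun x => c * f x).
Proof.
move=> [mf f2]; apply: (@sqint_bound _ (fun x => c ^+ 2 * f x ^+ 2)).
- exact: measurable_funM.
- by have := integrableZl measurableT (c ^+ 2) f2; apply: eq_integrable => // x _.
- by move=> x; rewrite exprMn.
Qed.

Lemma sqintN f : sqint f -> sqint (\- f).
Proof.
move=> /(sqintZ (-1)); rewrite (_ : (fun x => -1 * f x) = \- f)//.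
by apply/funext => x /=; rewrite mulN1r.
Qed.

Lemma sqintB f g : sqint f -> sqint g -> sqint (f \- g).
Proof. by move=> sf /sqintN sg; exact: sqintD sf sg. Qed.

Lemma sqint_sum (I : Type) (s : seq I) (F : I -> T -> R) :
  (forall i, sqint (F i)) -> sqint (fun x => \sum_(i <- s) F i x).
Proof.
move=> sF; elim: s => [|i s IH].
  by under eq_fun do rewrite big_nil; exact: sqint0.
by under eq_fun do rewrite big_cons; exact: sqintD.
Qed.

Lemma dotC f g : dot mu f g = dot mu g f.
Proof. by apply: eq_Rintegral => x _; rewrite mulrC. Qed.

Lemma dotDl f g h : sqint f -> sqint g -> sqint h ->
  dot mu (f \+ g) h = dot mu f h + dot mu g h.
Proof.
move=> sf sg sh; rewrite /dot -RintegralD//; try exact: sqint_mul.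
by apply: eq_Rintegral => x _; rewrite /= mulrDl.
Qed.

Lemma dotZl c f h : sqint f -> sqint h ->
  dot mu (fun x => c * f x) h = c * dot mu f h.
Proof.
move=> sf sh; rewrite /dot -RintegralZl//; try exact: sqint_mul.
by apply: eq_Rintegral => x _; rewrite /= mulrA.
Qed.

Lemma dotNl f h : sqint f -> sqint h -> dot mu (\- f) h = - dot mu f h.
Proof.
move=> sf sh; rewrite -mulN1r -dotZl//.
by apply: eq_Rintegral => x _ /=; rewrite mulN1r.
Qed.

Lemma dotBl f g h : sqint f -> sqint g -> sqint h ->
  dot mu (f \- g) h = dot mu f h - dot mu g h.
Proof.
by move=> sf sg sh; rewrite dotDl ?dotNl//; exact: sqintN.
Qed.

Lemma dotDr f g h : sqint f -> sqint g -> sqint h ->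
  dot mu h (f \+ g) = dot mu h f + dot mu h g.
Proof. by move=> sf sg sh; rewrite dotC dotDl// !(dotC h). Qed.

Lemma dotZr c f h : sqint f -> sqint h ->
  dot mu h (fun x => c * f x) = c * dot mu h f.
Proof. by move=> sf sh; rewrite dotC dotZl// (dotC h). Qed.

Lemma dotBr f g h : sqint f -> sqint g -> sqint h ->
  dot mu h (f \- g) = dot mu h f - dot mu h g.
Proof. by move=> sf sg sh; rewrite dotC dotBl// !(dotC h). Qed.

Lemma dot0l h : dot mu (fun=> 0) h = 0.
Proof.
rewrite /dot (@eq_Rintegral _ _ _ _ _ (fun=> 0)); last by move=> x _; rewrite mul0r.
by rewrite /Rintegral integral0.
Qed.

Lemma dot_suml (I : Type) (s : seq I) (F : I -> T -> R) h :
  (forall i, sqint (F i)) -> sqint h ->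
  dot mu (fun x => \sum_(i <- s) F i x) h = \sum_(i <- s) dot mu (F i) h.
Proof.
move=> sF sh; elim: s => [|i s IH].
  rewrite big_nil -[RHS](dot0l h).
  by apply: eq_Rintegral => x _; rewrite big_nil.
rewrite big_cons -IH -dotDl//; last exact: sqint_sum.
by apply: eq_Rintegral => x _; rewrite big_cons.
Qed.

Lemma dot_sumr (I : Type) (s : seq I) (F : I -> T -> R) h :
  (forall i, sqint (F i)) -> sqint h ->
  dot mu h (fun x => \sum_(i <- s) F i x) = \sum_(i <- s) dot mu h (F i).
Proof.
by move=> sF sh; rewrite dotC dot_suml//; apply: eq_bigr => i _; exact: dotC.
Qed.

Lemma dot_ge0 f : 0 <= dot mu f f.
Proof. by apply: Rintegral_ge0 => x _; rewrite -expr2 sqr_ge0. Qed.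

Lemma dot_sqE f : dot mu f f = \int[mu]_x (f x ^+ 2).
Proof. by apply: eq_Rintegral => x _; rewrite expr2. Qed.

Lemma dot_EFin f : sqint f -> (\int[mu]_x (f x ^+ 2)%:E = (dot mu f f)%:E)%E.
Proof.
by move=> [mf f2]; rewrite dot_sqE /Rintegral fineK//; exact: integrable_fin_num.
Qed.

Lemma sqint_lty f : measurable_fun setT f ->
  (\int[mu]_x (f x ^+ 2)%:E < +oo)%E -> sqint f.
Proof.
move=> mf f2; split=> //; apply/integrableP; split.
  by apply/measurable_EFinP; exact: measurable_funX.
rewrite (eq_integral (fun x => (f x ^+ 2)%:E))//= => x _.
by rewrite ger0_norm ?sqr_ge0.
Qed.

(** A nonnegative quadratic polynomial in [t], evaluated at its minimiser. *)
Lemma cauchy_schwarz f g : sqint f -> sqint g ->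
  dot mu f g ^+ 2 <= dot mu f f * dot mu g g.
Proof.
move=> sf sg.
have q t : 0 <= dot mu f f + 2 * t * dot mu f g + t ^+ 2 * dot mu g g.
  have stg := sqintZ t sg.
  have := dot_ge0 (f \+ (fun x => t * g x)).
  rewrite dotDl ?dotDr//; try exact: sqintD.
  rewrite !dotZl ?dotZr// (dotC g f); congr (_ <= _); ring.
have := dot_ge0 g; rewrite le_eqVlt => /predU1P[g0|g0].
  rewrite -g0 mulr0; have [->|fg0] := eqVneq (dot mu f g) 0; first by rewrite expr0n.
  (* The leading coefficient vanishes, and this [t] gives the remaining affine function the value
     -1. *)
  have := q (- (dot mu f f + 1) / (2 * dot mu f g)); rewrite -g0 mulr0 addr0.
  rewrite (_ : 2 * _ * _ = - (dot mu f f + 1)); last by field.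
  by rewrite opprD addrA subrr sub0r oppr_ge0 ler10.
have := q (- dot mu f g / dot mu g g).
rewrite (_ : _ + _ + _ = dot mu f f - dot mu f g ^+ 2 / dot mu g g).
  by rewrite subr_ge0 ler_pdivrMr.
by field; rewrite gt_eqF.
Qed.

Lemma ae_dot f f' h : measurable_fun setT f -> measurable_fun setT f' ->
  measurable_fun setT h -> f = f' %[ae mu] -> dot mu f h = dot mu f' h.
Proof.
move=> mf mf' mh ff'; rewrite /dot /Rintegral; congr fine.
apply: ae_eq_integral => //; try by apply/measurable_EFinP; exact: measurable_funM.
by apply: filterS ff' => x /= e _; rewrite e.
Qed.

Lemma ae_sqint f f' : measurable_fun setT f' -> f = f' %[ae mu] ->
  sqint f -> sqint f'.
Proof.
move=> mf' ff' [mf f2]; apply: sqint_lty => //.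
have -> : (\int[mu]_x (f' x ^+ 2)%:E = \int[mu]_x (f x ^+ 2)%:E)%E.
  apply: ae_eq_integral => //.
  - by apply/measurable_EFinP; exact: measurable_funX.
  - by apply/measurable_EFinP; exact: measurable_funX.
  - by apply: filterS ff' => x /= e _; rewrite e.
by rewrite (dot_EFin (conj mf f2)) ltry.
Qed.

Lemma dot_eq0_ae f : sqint f -> dot mu f f = 0 -> f = (fun=> 0) %[ae mu].
Proof.
move=> sf f0; have [mf _] := sf; have := dot_EFin sf; rewrite f0 => i0.
have m2 : measurable_fun setT (fun x => (f x ^+ 2)%:E).
  by apply/measurable_EFinP; exact: measurable_funX.
have /(ae_eq_integral_abs mu measurableT m2) :
    (\int[mu]_x `|(f x ^+ 2)%:E| = 0)%E.
  by rewrite -[RHS]i0; apply: eq_integral => x _; rewrite gee0_abs// lee_fin sqr_ge0.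
apply: filterS => x /= /(_ Logic.I) [] e _; apply/eqP.
by rewrite -sqrf_eq0 e.
Qed.

Lemma cvg_dot0 (u v : nat -> T -> R) (l : R) :
  (forall n, sqint (u n)) -> (forall n, sqint (v n)) ->
  dot mu (u n) (u n) @[n --> \oo] --> 0 ->
  dot mu (v n) (v n) @[n --> \oo] --> l ->
  dot mu (u n) (v n) @[n --> \oo] --> 0.
Proof.
move=> su sv u0 vl; apply/cvgr0Pnorm_le => e e0.
have uv0 : dot mu (u n) (u n) * dot mu (v n) (v n) @[n --> \oo] --> 0.
  by rewrite -(mul0r l); exact: cvgM.
have /cvgr0Pnorm_le/(_ (e ^+ 2)) := uv0.
move=> /(_ (exprn_gt0 _ e0)); apply: filterS => n.
rewrite ger0_norm ?mulr_ge0 ?dot_ge0// => h.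
have := le_trans (cauchy_schwarz (su n) (sv n)) h.
by rewrite -real_normK ?num_real// ler_pXn2r// nnegrE ltW.
Qed.

(** Writing [u n] and [v n] through their distances to [f] and [g] leaves three error terms, each
    killed by [cvg_dot0]. Mean-square limits therefore preserve variances and orthogonality. *)
Lemma cvg_dot (u v : nat -> T -> R) f g :
  (forall n, sqint (u n)) -> (forall n, sqint (v n)) -> sqint f -> sqint g ->
  dot mu (f \- u n) (f \- u n) @[n --> \oo] --> 0 ->
  dot mu (g \- v n) (g \- v n) @[n --> \oo] --> 0 ->
  dot mu (u n) (v n) @[n --> \oo] --> dot mu f g.
Proof.
move=> su sv sf sg u0 v0.
have sfu n : sqint (f \- u n) by exact: sqintB.
have sgv n : sqint (g \- v n) by exact: sqintB.
have c1 := cvg_dot0 sfu sgv u0 v0.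
have cc (c : R) : c @[_ --> \oo] --> c by exact: cvg_cst.
have c2 := cvg_dot0 sfu (fun=> sg) u0 (cc (dot mu g g)).
have c3 := cvg_dot0 sgv (fun=> sf) v0 (cc (dot mu f f)).
rewrite (_ : (fun n => _) = (fun n => dot mu f g + (dot mu (f \- u n) (g \- v n)
   - dot mu (f \- u n) g - dot mu (g \- v n) f))).
  rewrite -[X in _ --> X]addr0; apply: cvgD; first exact: cc.
  have -> : (0 : R) = 0 - 0 - 0 by rewrite !subr0.
  by apply: cvgB => //; exact: cvgB.
apply/funext => n.
rewrite !dotBl// !dotBr// (dotC g f) (dotC (v n) f); ring.
Qed.

End SquareIntegrable.

(** * Square-integrable functions under a probability *)

Section FiniteSquareIntegrable.
Context d (T : measurableType d) (R : realType) (P : probability T R).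
Implicit Types f g : T -> R.

Lemma bounded_integrable f (K : R) : measurable_fun setT f ->
  (forall x, `|f x| <= K) -> P.-integrable setT (EFin \o f).
Proof.
move=> mf fK.
have iK : P.-integrable setT (EFin \o cst K) by exact: finite_measure_integrable_cst.
apply: le_integrable iK => //; first exact/measurable_EFinP.
move=> x _ /=; rewrite lee_fin (le_trans (fK x))//; exact: ler_norm.
Qed.

Lemma sqint_cst (c : R) : sqint P (cst c).
Proof.
split; first exact: measurable_cst.
by apply: (@bounded_integrable (fun=> c ^+ 2) `|c ^+ 2|) => //; exact: measurable_cst.
Qed.

Lemma sqint_integrable f : sqint P f -> P.-integrable setT (EFin \o f).
Proof.
move=> sf; have := sqint_mul sf (sqint_cst 1).
by apply: eq_integrable => // x _ /=; rewrite mulr1.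
Qed.

Lemma Rintegral_prob_cst (c : R) : \int[P]_x c = c.
Proof. by rewrite Rintegral_cst// [X in fine X]probability_setT mulr1. Qed.

Lemma expectation_dot f : sqint P f ->
  ('E_P[(fun w => f w ^+ 2)%R] = (dot P f f)%:E)%E.
Proof. by move=> sf; rewrite unlock; exact: dot_EFin. Qed.

Lemma Rintegral_norm_sq f : sqint P f -> (\int[P]_x `|f x|) ^+ 2 <= dot P f f.
Proof.
move=> sf; have [mf f2] := sf.
have sn : sqint P (fun x => `|f x|).
  split; first exact: measurableT_comp.
  by apply: eq_integrable f2 => // x _; rewrite real_normK ?num_real.
have := cauchy_schwarz sn (sqint_cst 1).
rewrite [X in _ * X]dot_sqE /cst expr1n Rintegral_prob_cst mulr1.
rewrite (_ : dot P _ (cst 1) = \int[P]_x `|f x|); last first.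
  by apply: eq_Rintegral => x _; rewrite mulr1.
rewrite (_ : dot P (fun x => _) _ = dot P f f)//.
by apply: eq_Rintegral => x _; rewrite -!expr2 real_normK ?num_real.
Qed.

End FiniteSquareIntegrable.

(** * Gaussian integrals *)

Section NormalIntegrals.
Context (R : realType).
Local Notation leb := (@lebesgue_measure R).
Implicit Types (m s : R) (f h : R -> R).

Lemma normal_prob_ge0_integral m s f : measurable_fun setT f ->
  (forall x, 0 <= f x) ->
  (\int[normal_prob m s]_x (f x)%:E =
   \int[leb]_x (f x * normal_pdf m s x)%:E)%E.
Proof.
move=> mf f0; have dom := normal_prob_dominates m s.
rewrite -(Radon_Nikodym_SigmaFinite.change_of_variables dom)//=; last first.
  exact/measurable_EFinP.
apply: ae_eq_integral => //.
- apply: emeasurable_funM; first exact/measurable_EFinP.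
  exact: (measurable_int leb (Radon_Nikodym_SigmaFinite.f_integrable dom)).
- apply/measurable_EFinP; apply: measurable_funM => //.
  exact: measurable_normal_pdf.
- suff : ae_eq leb setT (Radon_Nikodym_SigmaFinite.f (normal_prob m s) leb)
      (EFin \o normal_pdf m s).
    by apply: filterS => x /= e _; rewrite e// EFinM.
  apply: integral_ae_eq => //=.
  + exact: Radon_Nikodym_SigmaFinite.f_integrable.
  + by apply/measurable_EFinP; exact: measurable_normal_pdf.
  + move=> E _ mE; rewrite -Radon_Nikodym_SigmaFinite.f_integral//.
Qed.

(** Adding the bound [K] makes the integrand nonnegative, and [K] contributes [K] on both sides. *)
Lemma normal_prob_integral m s f (K : R) : measurable_fun setT f ->
  (forall x, `|f x| <= K) ->
  \int[normal_prob m s]_x f x = \int[leb]_x (f x * normal_pdf m s x).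
Proof.
move=> mf fK.
have mp := measurable_normal_pdf m s.
have ip := integrable_normal_pdf m s.
have ifp : leb.-integrable setT (EFin \o (fun x => f x * normal_pdf m s x)).
  have iK : leb.-integrable setT (EFin \o (fun x => K * normal_pdf m s x)).
    by have := integrableZl measurableT K ip; apply: eq_integrable => // x _.
  apply: le_integrable iK => //.
    by apply/measurable_EFinP; exact: measurable_funM.
  move=> x _ /=; rewrite lee_fin !normrM ler_wpM2r//.
  exact: le_trans (fK x) (ler_norm _).
have e1 : \int[normal_prob m s]_x (f x + K) =
    \int[leb]_x ((f x + K) * normal_pdf m s x).
  rewrite /Rintegral normal_prob_ge0_integral//.
    exact: measurable_funD.
  by move=> x; have := fK x; rewrite ler_norml => /andP[+ _]; rewrite -subr_ge0 opprK.
have e2 : \int[leb]_x ((f x + K) * normal_pdf m s x) =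
    \int[leb]_x (f x * normal_pdf m s x) + K.
  have iKp : leb.-integrable setT (EFin \o (fun x => K * normal_pdf m s x)).
    by have := integrableZl measurableT K ip; apply: eq_integrable => // x _.
  rewrite (@eq_Rintegral _ _ _ leb _
    (fun x => f x * normal_pdf m s x + K * normal_pdf m s x)); last first.
    by move=> x _; rewrite mulrDl.
  rewrite RintegralD// RintegralZl//.
  by rewrite [X in K * X](_ : _ = 1) ?mulr1// /Rintegral integral_normal_pdf.
have : \int[normal_prob m s]_x (f x + K) = \int[normal_prob m s]_x f x + K.
  rewrite RintegralD//; last by apply: finite_measure_integrable_cst.
    by rewrite Rintegral_prob_cst.
  exact: (@bounded_integrable _ _ _ (normal_prob m s) f K mf fK).
by rewrite e1 e2 => /addIr ->.
Qed.

(** On a bounded interval this is the fundamental theorem of calculus. The decay of [G] makes the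
    boundary terms O(1/n), and dominated convergence removes the truncation. *)
Lemma integral_derivative_line (G g : R -> R) (m C : R) :
  (forall x : R, is_derive x 1 G (g x)) -> continuous g ->
  leb.-integrable setT (EFin \o g) ->
  (forall x, `|G x| * `|x - m| <= C) ->
  \int[leb]_x g x = 0.
Proof.
move=> dG cg ig GC.
have C0 : 0 <= C by rewrite (le_trans _ (GC 0))// mulr_ge0.
have mg : measurable_fun setT g by exact: continuous_measurable_fun.
(* Both ends of [[- k n, k n]] are at distance at least [n + 1] from [m]. *)
pose k (n : nat) : R := `|m| + 1 + n%:R.
have k0 n : 0 < k n by rewrite /k; have := normr_ge0 m; have := ler0n R n; lra.
pose gn n x := (g \_ `[- k n, k n]) x.
have mgn n : measurable_fun setT (gn n).
  by apply/(measurable_restrictT _ (measurable_itv _)); exact: measurable_funTS.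
have c1 : (\int[leb]_x (gn n x)%:E)%E @[n --> \oo] --> (\int[leb]_x (g x)%:E)%E.
  apply: (@dominated_cvg _ _ _ leb setT _ (fun n x => (gn n x)%:E) _ (fun x => `|g x|%:E)) => //.
  - by move=> n; apply/measurable_EFinP; exact: mgn.
  - move=> x _; apply: cvg_EFin; first exact: nearW.
    apply: cvg_near_cst; near=> n.
    rewrite /= /gn patchE ifT// inE/= in_itv/= -ler_norml.
    rewrite /k ltW// ltr_wpDl ?addr_ge0//.
    by near: n; exact: nbhs_infty_gtr.
  - by have := integrable_abse ig; apply: eq_integrable.
  - move=> n x _; rewrite /gn patchE; case: ifPn => _; first exact: lexx.
    by rewrite /= normr0 lee_fin.
have e n : (\int[leb]_x (gn n x)%:E)%E = (G (k n) - G (- k n))%:E.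
  have -> : (\int[leb]_x (gn n x)%:E)%E = (\int[leb]_(x in `[(- k n)%R, k n]) (g x)%:E)%E.
    rewrite [RHS]integral_mkcond; apply: eq_integral => x _.
    by rewrite /gn !patchE; case: ifP.
  rewrite (@continuous_FTC2 _ g G) //.
  - by rewrite gtrN.
  - exact: continuous_subspaceT.
  - have cG x : {for x, continuous G}.
      by apply: differentiable_continuous; apply/derivable1_diffP; have [] := dG x.
    split; first by move=> x _; have [] := dG x.
      exact: cvg_at_right_filter (cG _).
    exact: cvg_at_left_filter (cG _).
  - by move=> x _; rewrite derive1E; have [_ ->] := dG x.
have bd n : `|G (k n) - G (- k n)| <= 2 * C / n.+1%:R.
  have km x : n.+1%:R <= `|x - m| -> `|G x| <= C / n.+1%:R.
    move=> xm; rewrite ler_pdivlMr ?ltr0n//.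
    by rewrite (le_trans _ (GC x))// ler_wpM2l.
  have -> : 2 * C / n.+1%:R = C / n.+1%:R + C / n.+1%:R by rewrite -mulrA; ring.
  rewrite (le_trans (ler_normB _ _))// lerD// km//.
    rewrite ler_normr; apply/orP; left; rewrite /k -natr1.
    have := ler_norm m; lra.
  rewrite ler_normr; apply/orP; right; rewrite /k -natr1.
  have := ler_norm (- m); rewrite normrN; lra.
have c2 : (\int[leb]_x (gn n x)%:E)%E @[n --> \oo] --> 0%E.
  under eq_fun do rewrite e.
  apply: cvg_EFin; first exact: nearW.
  rewrite /comp/=; apply: norm_cvg0.
  apply: (@squeeze_cvgr _ _ _ _ (cst 0) (fun n => 2 * C / n.+1%:R)).
  - by apply: nearW => n; rewrite normr_ge0 bd.
  - exact: cvg_cst.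
  - rewrite -(mulr0 (2 * C)); apply: cvgMr; exact: cvg_harmonic.
by rewrite /Rintegral; have /= -> := cvg_unique (@ereal_hausdorff R) c1 c2.
Unshelve. all: end_near. Qed.

Lemma normal_pdf_expE m s x : s != 0 ->
  normal_pdf m s x = normal_peak s * expR (- (x - m) ^+ 2 / (s ^+ 2 *+ 2)).
Proof. by move=> s0; rewrite normal_pdfE. Qed.

(** With u the squared standardised distance, exp (- u/2) splits into exp (- u/8), the profile of
    deviation [2 * s], and exp (- 3u/8), which absorbs the quadratic factor because exp y >= 1 + y.
    Serves to dominate quadratic growth against a Gaussian density. *)
Lemma normal_pdf_tail m s : s != 0 -> exists2 K : R, 0 <= K &
  forall x, (1 + (x - m) ^+ 2) * normal_pdf m s x <= K * normal_pdf m (2 * s) x.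
Proof.
move=> s0; have s20 : 2 * s != 0 by rewrite mulf_neq0.
have p0 := normal_peak_gt0 s0; have p20 := normal_peak_gt0 s20.
(* The factor 8/3 turns u into 3u/8, whose product with exp (- 3u/8) is at most 1. *)
exists (normal_peak s * (1 + s ^+ 2 * 8 / 3) / normal_peak (2 * s)).
  rewrite divr_ge0 ?mulr_ge0 ?(ltW p0) ?(ltW p20)//.
  by rewrite addr_ge0// mulr_ge0// mulr_ge0// sqr_ge0.
move=> x; rewrite !normal_pdf_expE//.
set u := (x - m) ^+ 2 / s ^+ 2.
have ss : 0 < s ^+ 2 by rewrite exprn_even_gt0.
have u0 : 0 <= u by rewrite divr_ge0// ?sqr_ge0.
have -> : (x - m) ^+ 2 = u * s ^+ 2 by rewrite /u divfK// gt_eqF.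
have -> : - (u * s ^+ 2) / (s ^+ 2 *+ 2) = - (u / 8) - (3 / 8 * u) by field; exact: s0.
have -> : - (u * s ^+ 2) / ((2 * s) ^+ 2 *+ 2) = - (u / 8) by field; exact: s0.
rewrite expRD.
set a := expR (- (u / 8)); set b := expR (- _).
have a0 : 0 <= a by exact: expR_ge0.
have b0 : 0 <= b by exact: expR_ge0.
have b1 : b * (1 + 3 / 8 * u) <= 1.
  rewrite /b expRN mulrC ler_pdivrMr ?expR_gt0// mul1r.
  exact: expR_ge1Dx.
have -> : normal_peak s * (1 + s ^+ 2 * 8 / 3) / normal_peak (2 * s) *
  (normal_peak (2 * s) * a) = normal_peak s * a * (1 + s ^+ 2 * 8 / 3).
  by field; rewrite gt_eqF.
rewrite [leLHS](_ : _ = normal_peak s * a * ((1 + u * s ^+ 2) * b)); last by ring.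
apply: ler_wpM2l; first by rewrite mulr_ge0// ltW.
have -> : (1 + u * s ^+ 2) * b = b + s ^+ 2 * 8 / 3 * (b * (3 / 8 * u)) by field.
have h1 : b <= 1 by nra.
have h2 : b * (3 / 8 * u) <= 1 by nra.
by rewrite lerD// ler_piMr// mulr_ge0// mulr_ge0// ltW.
Qed.

Lemma is_derive_normal_pdf m s (x : R) : s != 0 ->
  is_derive x 1 (normal_pdf m s) (- (x - m) / s ^+ 2 * normal_pdf m s x).
Proof.
move=> s0.
have -> : normal_pdf m s =
    (fun x => normal_peak s * expR (- (s ^- 2 / 2) * (x - m) ^+ 2)).
  apply/funext => y; rewrite normal_pdf_expE//; congr (_ * expR _).
  by field.
apply: is_derive_eq.
by rewrite /GRing.scale/=; field.
Qed.

(** Stein's identity: the integrand is the derivative of [h] times the density. The growth condition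
    admits functions [h] of linear growth. *)
Lemma normal_stein m s (h h' : R -> R) (C : R) : s != 0 ->
  (forall x : R, is_derive x 1 h (h' x)) -> continuous h' ->
  (forall x, `|h' x| <= C) ->
  (forall x, `|h x| * (1 + `|x - m|) <= C * (1 + (x - m) ^+ 2)) ->
  \int[leb]_x ((h' x - (x - m) / s ^+ 2 * h x) * normal_pdf m s x) = 0.
Proof.
move=> s0 dh ch' h'C hC.
have [K K0 tail] := normal_pdf_tail m s0.
have C0 : 0 <= C by exact: le_trans (h'C 0).
have ch : continuous h.
  move=> x; apply: differentiable_continuous; apply/derivable1_diffP.
  by have [] := dh x.
have cp := @continuous_normal_pdf _ m s s0.
have p0 x := normal_pdf_ge0 m s x.
have s20 : 2 * s != 0 by rewrite mulf_neq0.
have ss : 0 < s ^+ 2 by rewrite exprn_even_gt0.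
have hx x : `|h x| * `|x - m| <= C * (1 + (x - m) ^+ 2).
  by apply: le_trans (hC x); rewrite ler_wpM2l// lerDr.
pose g x := (h' x - (x - m) / s ^+ 2 * h x) * normal_pdf m s x.
have cg : continuous g.
  move=> x; apply: cvgM; last exact: cp.
  apply: cvgB; first exact: ch'.
  apply: cvgM; last exact: ch.
  apply: cvgM; last exact: cvg_cst.
  by apply: cvgB; [exact: cvg_id|exact: cvg_cst].
apply: (@integral_derivative_line (fun x => h x * normal_pdf m s x) g m
          (C * (K * normal_peak (2 * s)))).
- move=> x; have d1 := dh x; have d2 := is_derive_normal_pdf m x s0.
  by apply: is_derive_eq; rewrite /GRing.scale/= /g; field.
- exact: cg.
- have iK : leb.-integrable setT
      (EFin \o (fun x => C * (1 + s ^- 2) * K * normal_pdf m (2 * s) x)).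
    have := integrableZl measurableT (C * (1 + s ^- 2) * K)
      (integrable_normal_pdf m (2 * s)).
    by apply: eq_integrable => // x _.
  apply: le_integrable iK => //.
    by apply/measurable_EFinP; exact: continuous_measurable_fun.
  move=> x _ /=; rewrite lee_fin; apply: le_trans (ler_norm _).
  have s2 : 0 <= s ^- 2 by rewrite invr_ge0 ltW.
  rewrite -mulrA; apply: le_trans (ler_wpM2l _ (tail x)); last first.
    by rewrite mulr_ge0// addr_ge0.
  rewrite mulrA /g normrM (ger0_norm (p0 x)) ler_wpM2r//.
  rewrite (le_trans (ler_normB _ _))// !normrM (ger0_norm s2).
  have := hx x; have := h'C x; have := sqr_ge0 (x - m).
  set a := `|h' x|; set b := `|h x|; set c := `|x - m|; set e := (x - m) ^+ 2.
  move=> e0 aC bc.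
  have : s ^- 2 * (b * c) <= s ^- 2 * (C * (1 + e)) by rewrite ler_wpM2l.
  have : a <= C * (1 + e) by rewrite (le_trans aC)// ler_peMr// lerDl.
  lra.
- move=> x; rewrite normrM (ger0_norm (p0 x)).
  have pk := normal_pdf_ub m x s20.
  have t := tail x; have hh := hx x.
  have : C * ((1 + (x - m) ^+ 2) * normal_pdf m s x) <= C * (K * normal_peak (2 * s)).
    by rewrite ler_wpM2l// (le_trans t)// ler_wpM2l.
  apply: le_trans; rewrite mulrA mulrAC ler_wpM2r//.
Qed.

Lemma integrable_normal_tail m s (f : R -> R) (C : R) : s != 0 ->
  measurable_fun setT f -> (forall x, `|f x| <= C * (1 + (x - m) ^+ 2)) ->
  leb.-integrable setT (EFin \o (fun x => f x * normal_pdf m s x)).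
Proof.
move=> s0 mf fC; have [K K0 tail] := normal_pdf_tail m s0.
have p0 x := normal_pdf_ge0 m s x.
have C0 : 0 <= C.
  have := le_trans (normr_ge0 _) (fC m).
  by rewrite subrr expr0n/= addr0 mulr1.
have iK : leb.-integrable setT
    (EFin \o (fun x => C * K * normal_pdf m (2 * s) x)).
  have := integrableZl measurableT (C * K) (integrable_normal_pdf m (2 * s)).
  by apply: eq_integrable => // x _.
apply: le_integrable iK => //.
  apply/measurable_EFinP; apply: measurable_funM => //.
  exact: measurable_normal_pdf.
move=> x _ /=; rewrite lee_fin; apply: le_trans (ler_norm _).
rewrite normrM (ger0_norm (p0 x)) -mulrA.
apply: le_trans (ler_wpM2l C0 (tail x)).
by rewrite mulrA ler_wpM2r.
Qed.

Lemma normal_second_moment m s : s != 0 ->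
  (\int[normal_prob m s]_x ((x - m) ^+ 2)%:E = (s ^+ 2)%:E)%E.
Proof.
move=> s0; have ss : 0 < s ^+ 2 by rewrite exprn_even_gt0.
have m2 : measurable_fun setT (fun x : R => (x - m) ^+ 2).
  by apply: measurable_funX; exact: measurable_funB.
have i2 : leb.-integrable setT (EFin \o (fun x => (x - m) ^+ 2 * normal_pdf m s x)).
  apply: (@integrable_normal_tail m s _ 1) => // x.
  by rewrite ger0_norm ?sqr_ge0// mul1r lerDr.
rewrite normal_prob_ge0_integral//; last by move=> x; exact: sqr_ge0.
(* Stein's identity for the function [x - m]. *)
have st : \int[leb]_x ((1 - (x - m) / s ^+ 2 * (x - m)) * normal_pdf m s x) = 0.
  apply: (@normal_stein m s (fun x => x - m) (fun=> 1) 2) => //.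
  - by move=> x; apply: is_derive_eq; rewrite subr0.
  - by move=> x; exact: cvg_cst.
  - by move=> x; rewrite normr1; lra.
  - move=> x; rewrite -[(x - m) ^+ 2]real_normK ?num_real//.
    by have := sqr_ge0 (`|x - m| - 1); have := normr_ge0 (x - m); nra.
have ip := integrable_normal_pdf m s.
have e : \int[leb]_x ((1 - (x - m) / s ^+ 2 * (x - m)) * normal_pdf m s x) =
    1 - s ^- 2 * \int[leb]_x ((x - m) ^+ 2 * normal_pdf m s x).
  rewrite -RintegralZl//.
  have {2}-> : 1 = \int[leb]_x normal_pdf m s x by rewrite /Rintegral integral_normal_pdf.
  rewrite -RintegralB//; last first.
    have := integrableZl measurableT (s ^- 2) i2.
    by apply: eq_integrable => // x _.
  by apply: eq_Rintegral => x _; ring.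
move: st; rewrite e => /eqP; rewrite subr_eq0 => /eqP st.
rewrite -[LHS]fineK; last exact: (integrable_fin_num measurableT i2).
congr EFin; rewrite -[LHS]/(\int[leb]_x ((x - m) ^+ 2 * normal_pdf m s x)).
by apply: (mulfI (invr_neq0 (lt0r_neq0 ss))); rewrite -st mulVf// gt_eqF.
Qed.

(** As a function of the frequency b, the integral satisfies f' = - b s^2 f, by differentiation
    under the integral and Stein's identity for the sine. Hence f(b) exp (s^2 b^2 / 2) is constant,
    equal to its value at 0. *)
Lemma normal_cos s (c theta : R) : s != 0 ->
  \int[normal_prob 0 s]_x cos (c * x + theta) =
  expR (- (c ^+ 2 * s ^+ 2 / 2)) * cos theta.
Proof.
move=> s0; have ss : s ^+ 2 != 0 by rewrite expf_neq0.
have cl (b : R) : continuous (fun x : R => b * x + theta).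
  move=> x; apply: cvgD; last exact: cvg_cst.
  by apply: cvgM; [exact: cvg_cst|exact: cvg_id].
have ccos b : continuous (fun x : R => cos (b * x + theta)).
  by move=> x; apply: (continuous_comp (cl b x)); exact: continuous_cos.
have csin b : continuous (fun x : R => sin (b * x + theta)).
  by move=> x; apply: (continuous_comp (cl b x)); exact: continuous_sin.
have mcos b : measurable_fun setT (fun x : R => cos (b * x + theta)).
  exact: continuous_measurable_fun.
have msin b : measurable_fun setT (fun x : R => sin (b * x + theta)).
  exact: continuous_measurable_fun.
have cos1 (x : R) : `|cos x| <= 1 by rewrite ler_norml cos_geN1 cos_le1.
have sin1 (x : R) : `|sin x| <= 1 by rewrite ler_norml sin_geN1 sin_le1.
have p0 x := normal_pdf_ge0 0 s x.
have nx (x : R) : `|x| <= 1 * (1 + (x - 0) ^+ 2).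
  rewrite subr0 mul1r -[x ^+ 2]real_normK ?num_real//.
  by have := sqr_ge0 (`|x| - 1); have := normr_ge0 x; nra.
have icos b : leb.-integrable setT
    (EFin \o (fun x => cos (b * x + theta) * normal_pdf 0 s x)).
  apply: (@integrable_normal_tail 0 s _ 1) => // x.
  by rewrite mul1r (le_trans (cos1 _))// lerDl sqr_ge0.
pose f b := \int[leb]_x (cos (b * x + theta) * normal_pdf 0 s x).
have stein b : \int[leb]_x (- x * sin (b * x + theta) * normal_pdf 0 s x) =
    - (b * s ^+ 2) * f b.
  have := @normal_stein 0 s (fun x => sin (b * x + theta))
    (fun x => b * cos (b * x + theta)) (`|b| + 2) s0.
  have ix : leb.-integrable setT
      (EFin \o (fun x => - x * sin (b * x + theta) * normal_pdf 0 s x)).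
    apply: (@integrable_normal_tail 0 s _ 1) => //.
      by apply: measurable_funM => //; exact: measurableT_comp.
    move=> x; rewrite normrM normrN (le_trans _ (nx x))//.
    by rewrite ler_piMr.
  have -> : \int[leb]_x ((b * cos (b * x + theta) - (x - 0) / s ^+ 2 *
      sin (b * x + theta)) * normal_pdf 0 s x) =
      b * f b + s ^- 2 * \int[leb]_x (- x * sin (b * x + theta) * normal_pdf 0 s x).
    rewrite /f -!RintegralZl// -RintegralD//.
    - by apply: eq_Rintegral => x _; ring.
    - have := integrableZl measurableT b (icos b).
      by apply: eq_integrable => // x _.
    - have := integrableZl measurableT (s ^- 2) ix.
      by apply: eq_integrable => // x _.
  move=> H; have {H} : b * f b + s ^- 2 *
      \int[leb]_x (- x * sin (b * x + theta) * normal_pdf 0 s x) = 0.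
    apply: H.
    - by move=> x; apply: is_derive_eq; rewrite /GRing.scale/=; ring.
    - by move=> x; apply: cvgM; [exact: cvg_cst|exact: ccos].
    - move=> x; rewrite normrM (le_trans (ler_piMr _ (cos1 _)))//.
      by rewrite lerDl.
    - move=> x; have := nx x; rewrite subr0 mul1r => nx'.
      have := sin1 (b * x + theta); have := normr_ge0 (sin (b * x + theta)).
      have := normr_ge0 b; have := normr_ge0 x; have := sqr_ge0 x.
      nra.
  move=> /eqP; rewrite addr_eq0 => /eqP e.
  by apply: (mulfI (invr_neq0 ss)); rewrite -[LHS]opprK -e; field.
have df (b : R) : is_derive b 1 f (- (b * s ^+ 2) * f b).
  (* [G] dominates the derivative uniformly in the frequency, so any bounded interval around [b]
     serves. *)
  pose G (y : R) := `|y| * normal_pdf 0 s y.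
  pose k (b y : R) := cos (b * y + theta) * normal_pdf 0 s y.
  have iG : leb.-integrable setT (EFin \o G).
    by apply: (@integrable_normal_tail 0 s _ 1) => // x; rewrite normr_id.
  have dk (x y : R) : is_derive x 1 (k ^~ y)
      (- y * sin (x * y + theta) * normal_pdf 0 s y).
    by apply: is_derive_eq; rewrite /GRing.scale/=; ring.
  have cI : (`](b - 1), (b + 1)[ : set R)%classic b.
    by rewrite /= in_itv/=; apply/andP; split; lra.
  have kE x y : partial1of2 k x y = - y * sin (x * y + theta) * normal_pdf 0 s y.
    by rewrite partial1of2E; have [_ ->] := dk x y.
  have Gub (x y : R) : `|partial1of2 k x y| <= G y.
    rewrite kE normrM (ger0_norm (p0 y)) ler_wpM2r// normrM normrN.
    by rewrite ler_piMr.
  have iG0 y : 0 <= G y by rewrite mulr_ge0.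
  have dx (x y : R) : derivable (k ^~ y) x 1 by have [] := dk x y.
  apply: DeriveDef.
    exact: (@derivable_under_integral _ _ _ leb k setT measurableT b (b - 1) (b + 1)
      cI (fun x _ => icos x) (fun x y _ _ => dx x y) G iG0 iG (fun x y _ _ => Gub x y)).
  rewrite -derive1E (@differentiation_under_integral _ _ _ leb k setT measurableT b
    (b - 1) (b + 1) cI (fun x _ => icos x) (fun x y _ _ => dx x y) G iG0 iG
    (fun x y _ _ => Gub x y)).
  rewrite -stein; apply: eq_Rintegral => y _; exact: kE.
have dF (b : R) : is_derive b 1 (fun b => f b * expR (s ^+ 2 / 2 * b ^+ 2)) 0.
  have d := df b.
  by apply: is_derive_eq; rewrite /GRing.scale/=; field.
have := @is_derive_0_is_cst _ _ c 0 dF; rewrite /=.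
rewrite expr0n/= mulr0 expR0 mulr1.
have -> : f 0 = cos theta.
  rewrite /f; under eq_Rintegral do rewrite mul0r add0r.
  rewrite RintegralZl//; last exact: integrable_normal_pdf.
  by rewrite [X in _ * X](_ : _ = 1) ?mulr1// /Rintegral integral_normal_pdf.
move=> <-; rewrite (@normal_prob_integral _ _ _ 1)// -/(f c).
rewrite mulrCA -expRD [X in expR X](_ : _ = 0) ?expR0 ?mulr1//.
by field.
Qed.

End NormalIntegrals.

(** * Uniqueness of characteristic functions *)

Section FubiniReal.
Context d1 d2 (T1 : measurableType d1) (T2 : measurableType d2) (R : realType).
Variables (P : probability T1 R) (m2 : {sigma_finite_measure set T2 -> \bar R}).

(** The uniform bound on the inner integrals of [k] and the unit mass of [P] make [f] integrable for
    the product measure. *)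
Lemma Rintegral_Fubini (f k : T1 * T2 -> R) (K : R) :
  measurable_fun setT f -> measurable_fun setT k ->
  (forall z, `|f z| <= k z) ->
  (forall x, (\int[m2]_y (k (x, y))%:E <= K%:E)%E) ->
  (forall y, P.-integrable setT (fun x => (f (x, y))%:E)) ->
  \int[P]_x \int[m2]_y f (x, y) = \int[m2]_y \int[P]_x f (x, y).
Proof.
move=> mf mk fk kK if1.
have k0 z : 0 <= k z by rewrite (le_trans _ (fk z)).
have mfx x : measurable_fun setT (fun y => f (x, y)) by exact: measurableT_comp.
have mkx x : measurable_fun setT (fun y => k (x, y)) by exact: measurableT_comp.
have fxK x : (\int[m2]_y `|(f (x, y))%:E| <= K%:E)%E.
  apply: le_trans (kK x); apply: ge0_le_integral => //.
  - by apply: measurableT_comp => //; exact/measurable_EFinP.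
  - exact/measurable_EFinP.
  - by move=> y _; rewrite lee_fin.
have if2 x : m2.-integrable setT (fun y => (f (x, y))%:E).
  apply/integrableP; split; first exact/measurable_EFinP.
  by rewrite (le_lt_trans (fxK x))// ltry.
have ifp : (P \x m2)%E.-integrable setT (EFin \o f).
  apply/integrable12ltyP; first exact/measurable_EFinP.
  apply: (@le_lt_trans _ _ (\int[P]_x K%:E)%E); last first.
    by rewrite integral_cst// [X in (_ * X)%E]probability_setT mule1 ltry.
  apply: ge0_le_integral => //.
  - by move=> x _; exact: integral_ge0.
  - apply: (measurable_fun_fubini_tonelli_F (abse \o (EFin \o f))) => //=.
    by apply: measurableT_comp => //; exact/measurable_EFinP.
  - by move=> x _; exact: fxK.
have e1 x : (\int[m2]_y (f (x, y))%:E)%E = (\int[m2]_y f (x, y))%:E.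
  by rewrite /Rintegral fineK//; exact: integrable_fin_num.
have e2 y : (\int[P]_x (f (x, y))%:E)%E = (\int[P]_x f (x, y))%:E.
  by rewrite /Rintegral fineK//; exact: integrable_fin_num.
rewrite {1}/Rintegral [RHS]/Rintegral; congr fine.
under eq_integral do rewrite -e1; under [RHS]eq_integral do rewrite -e2.
exact: (Fubini ifp).
Qed.

End FubiniReal.

Section BoundedMeasurable.
Context d (T : measurableType d) (R : realType).
Implicit Types G X : T -> R.

Definition bmeas G := measurable_fun setT G /\ exists K : R, forall x, `|G x| <= K.

Lemma bmeas_cst c : bmeas (cst c).
Proof. by split; [exact: measurable_cst|exists `|c|]. Qed.

Lemma bmeasM G G' : bmeas G -> bmeas G' -> bmeas (fun x => G x * G' x).
Proof.
move=> [mG [K GK]] [mG' [K' GK']]; split; first exact: measurable_funM.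
by exists (K * K') => x; rewrite normrM ler_pM.
Qed.

Lemma bmeasD G G' : bmeas G -> bmeas G' -> bmeas (fun x => G x + G' x).
Proof.
move=> [mG [K GK]] [mG' [K' GK']]; split; first exact: measurable_funD.
by exists (K + K') => x; rewrite (le_trans (ler_normD _ _))// lerD.
Qed.

Lemma norm_cos_le1 (x : R) : `|cos x| <= 1.
Proof. by rewrite ler_norml cos_geN1 cos_le1. Qed.

Lemma bmeas_cos X : measurable_fun setT X -> bmeas (fun x => cos (X x)).
Proof.
move=> mX; split; last by exists 1 => x; exact: norm_cos_le1.
apply: (measurableT_comp _ mX); apply: continuous_measurable_fun.
exact: continuous_cos.
Qed.

Lemma bmeas_indic X (B : set R) : measurable_fun setT X -> measurable B ->
  bmeas (fun x => \1_B (X x)).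
Proof.
move=> mX mB; split; last first.
  by exists 1 => x; rewrite indicE; case: (_ \in _); rewrite ?normr1 ?normr0.
by apply: (measurableT_comp _ mX); exact: measurable_indic.
Qed.

Lemma bmeas_integrable (P : probability T R) G : bmeas G ->
  P.-integrable setT (EFin \o G).
Proof. by move=> [mG [K GK]]; exact: bounded_integrable GK. Qed.

Lemma bmeas_dominated_cvg (P : probability T R) (g : nat -> T -> R) h (K : R) :
  (forall n, measurable_fun setT (g n)) ->
  (forall n x, `|g n x| <= K) ->
  (forall x, g n x @[n --> \oo] --> h x) ->
  \int[P]_x g n x @[n --> \oo] --> \int[P]_x h x.
Proof.
move=> mg gK gh; have mh : measurable_fun setT h.
  exact: (measurable_fun_cvg mg).
have hK x : `|h x| <= K.
  have : `|g n x| @[n --> \oo] --> `|h x| by apply: cvg_norm; exact: gh.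
  move=> c; apply: (ler_cvg_to c (cvg_cst K)).
  by apply: nearW => n; exact: gK.
have ih := @bounded_integrable _ _ _ P _ _ mh hK.
rewrite /Rintegral.
apply: fine_cvg; rewrite fineK; last exact: integrable_fin_num.
apply: (@dominated_cvg _ _ _ P setT _ (fun n x => (g n x)%:E) _ (fun=> K%:E)) => //.
- by move=> n; exact/measurable_EFinP.
- by move=> x _; apply: cvg_EFin; [exact: nearW|exact: gh].
- exact: finite_measure_integrable_cst.
- by move=> n x _; rewrite lee_fin.
Qed.

End BoundedMeasurable.

(** Dynkin's pi-lambda theorem, in the form that extends identities from generators to
    sigma-algebras. *)
Lemma g_sigma_sub_dynkin (T' : Type) (C D : set (set T')) :
  setI_closed C -> dynkin D -> C `<=` D -> <<s C >> `<=` D.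
Proof.
by move=> CI dD CD; rewrite -setI_closed_g_dynkin_g_sigma_algebra//; exact: smallest_sub.
Qed.

(** * Weighted laws are determined by their cosine transforms *)

Section FourierUniqueness.
Context d (T : measurableType d) (R : realType) (P : probability T R).
Local Notation leb := (@lebesgue_measure R).
Implicit Types (G X : T -> R) (h : R -> R).

(* Gaussian mollification turns an average of characteristic functions into a
   density, which replaces Fourier inversion. *)
Lemma cos_gauss_average G X (s y : R) : s != 0 ->
  bmeas G -> measurable_fun setT X ->
  \int[P]_w (G w * normal_pdf y s (X w)) =
  normal_peak s * \int[normal_prob 0 s^-1]_c
    \int[P]_w (G w * cos (c * X w + (- c * y))).
Proof.
move=> s0 bG mX; have [mG [K GK]] := bG.
have sV0 : s^-1 != 0 by rewrite invr_eq0.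
pose f (z : T * measurableTypeR R) := G z.1 * cos (z.2 * X z.1 + (- z.2 * y)).
have mf : measurable_fun setT f.
  apply: measurable_funM; first exact: measurableT_comp.
  apply: (measurableT_comp (continuous_measurable_fun (@continuous_cos R))).
  apply: measurable_funD; apply: measurable_funM => //.
  - exact: measurableT_comp.
  - exact: measurable_funN.
have fK z : `|f z| <= (cst K z : R).
  rewrite normrM (le_trans _ (GK z.1))// ler_piMr//; exact: norm_cos_le1.
have := @Rintegral_Fubini _ _ _ _ R P (normal_prob 0 s^-1) f (cst K) K mf
   (measurable_cst _) fK.
rewrite /f/= => <-; last 2 first.
- by move=> x; rewrite integral_cst// [X in (_ * X)%E]probability_setT mule1.
- move=> c; apply: (bmeas_integrable P (G := fun w => G w * cos (c * X w + - c * y))).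
  apply: bmeasM => //; apply: bmeas_cos; apply: measurable_funD => //.
  exact: measurable_funM.
have ip : P.-integrable setT (EFin \o (fun w =>
    G w * expR (- (X w - y) ^+ 2 / (s ^+ 2 *+ 2)))).
  apply: (@bounded_integrable _ _ _ _ _ K).
    apply: measurable_funM => //; apply: measurableT_comp => //.
    apply: measurable_funM => //; apply: measurable_funN.
    by apply: measurable_funX; exact: measurable_funB.
  move=> w; rewrite normrM (le_trans _ (GK w))// ler_piMr//.
  rewrite ger0_norm ?expR_ge0// -expR0 ler_expR mulNr oppr_le0.
  by rewrite divr_ge0 ?sqr_ge0// mulrn_wge0// sqr_ge0.
rewrite (@eq_Rintegral _ _ _ P _
    (fun w => normal_peak s * (G w * expR (- (X w - y) ^+ 2 / (s ^+ 2 *+ 2))))).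
  rewrite RintegralZl//; congr (_ * _); apply: eq_Rintegral => w _.
  (* Averaging over the frequency evaluates the characteristic function of the normal law of
     deviation 1/s at [X w - y]; up to the peak this is the normal density of deviation [s]. *)
  transitivity (\int[normal_prob 0 s^-1]_c (G w * cos ((X w - y) * c + 0))); last first.
    by apply: eq_Rintegral => c _; congr (_ * cos _); ring.
  rewrite RintegralZl//; last first.
    apply: (@bmeas_integrable _ _ _ (normal_prob 0 s^-1) (fun c => cos ((X w - y) * c + 0))).
    by apply: bmeas_cos; apply: measurable_funD => //; exact: measurable_funM.
  rewrite normal_cos// cos0 mulr1; congr (_ * expR _).
  by field.
by move=> w _; rewrite normal_pdf_expE//; ring.
Qed.

(** Within distance [dl] of [x], continuity bounds the error by [e / 2]. Farther away the crude
    bound 2K is dominated by 2K (y - x)^2 / dl^2, whose mean is proportional to the variance. *)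
Lemma normal_approx h (K x : R) : continuous h -> (forall x, `|h x| <= K) ->
  \int[leb]_y (h y * normal_pdf x n.+1%:R^-1 y) @[n --> \oo] --> h x.
Proof.
move=> ch hK; apply/cvgrPdist_le => e e0.
have K0 : 0 <= K by exact: le_trans (hK 0).
have e20 : 0 < e / 2 by rewrite divr_gt0.
have /cvgrPdist_le/(_ _ e20)/nbhs_ballP[dl/= dl0 hdl] := ch x.
have mh : measurable_fun setT h by exact: continuous_measurable_fun.
have key (s : R) : s != 0 ->
    `|h x - \int[leb]_y (h y * normal_pdf x s y)| <=
      e / 2 + 2 * K / dl ^+ 2 * s ^+ 2.
  move=> s0; rewrite -(@normal_prob_integral _ _ _ _ K)//.
  pose N : probability _ R := normal_prob x s.
  have bh : bmeas (fun y : measurableTypeR R => h y) by split => //; exists K.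
  have s2 : sqint N (fun y => y - x).
    apply: sqint_lty; first exact: measurable_funB.
    by rewrite normal_second_moment// ltry.
  have -> : h x - \int[normal_prob x s]_y h y = \int[N]_y (h x - h y).
    rewrite RintegralB//; first by rewrite Rintegral_prob_cst.
      exact: finite_measure_integrable_cst.
    exact: (bmeas_integrable N bh).
  have ihh : N.-integrable setT (EFin \o (fun y => h x - h y)).
    apply: (bmeas_integrable N (G := fun y => h x - h y)); split.
      exact: measurable_funB.
    by exists (K + K) => y; rewrite (le_trans (ler_normB _ _))// lerD.
  rewrite (le_trans (le_normr_Rintegral measurableT ihh))//.
  have i1 : N.-integrable setT (EFin \o cst (e / 2)).
    exact: finite_measure_integrable_cst.
  have i2 : N.-integrable setT (EFin \o (fun y => 2 * K / dl ^+ 2 * (y - x) ^+ 2)).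
    have [_ i2] := s2; have := integrableZl measurableT (2 * K / dl ^+ 2) i2.
    by apply: eq_integrable => // y _.
  have -> : e / 2 + 2 * K / dl ^+ 2 * s ^+ 2 =
      \int[N]_y (cst (e / 2) y + 2 * K / dl ^+ 2 * (y - x) ^+ 2).
    rewrite RintegralD// Rintegral_prob_cst RintegralZl//; last by have [] := s2.
    congr (_ + _ * _); rewrite /Rintegral.
    by rewrite -[X in fine X]/(\int[normal_prob x s]_y ((y - x) ^+ 2)%:E)%E normal_second_moment.
  apply: le_Rintegral => //.
  - by apply: integrable_norm; exact: ihh.
  - have := integrableD measurableT i1 i2; by apply: eq_integrable => // y _.
  - move=> y _ /=; have [yd|yd] := ltP `|x - y| dl.
      have h0 : 0 <= 2 * K / dl ^+ 2 * (y - x) ^+ 2.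
        by rewrite mulr_ge0 ?sqr_ge0// divr_ge0 ?sqr_ge0// mulr_ge0.
      have := hdl y yd => /= h1; lra.
    rewrite (@le_trans _ _ (K + K))//.
      by rewrite (le_trans (ler_normB _ _))// lerD.
    rewrite -[leLHS]add0r lerD ?(ltW e20)//.
    rewrite mulrAC ler_pdivlMr ?exprn_gt0//.
    have -> : K + K = 2 * K by ring.
    rewrite ler_wpM2l ?mulr_ge0// -[leRHS]real_normK ?num_real// distrC.
    by rewrite ler_pXn2r// nnegrE ltW.
have c0 : e / 2 + 2 * K / dl ^+ 2 * n.+1%:R^-1 ^+ 2 @[n --> \oo] --> e / 2 + 2 * K / dl ^+ 2 * 0 ^+ 2.
  apply: cvgD; first exact: cvg_cst.
  apply: cvgM; first exact: cvg_cst.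
  by rewrite expr2; under eq_fun do rewrite expr2; apply: cvgM; exact: cvg_harmonic.
have /cvgr_lt : e / 2 + 2 * K / dl ^+ 2 * 0 ^+ 2 < e by rewrite expr0n/= mulr0 addr0; lra.
move=> /(_ _ _ _ _ c0); apply: filterS => n /ltW; apply: le_trans.
by apply: key; rewrite invr_eq0 pnatr_eq0.
Qed.

(** [h] is replaced by its Gaussian averages [S n]. After Fubini these involve only mollified
    densities, which [cos_gauss_average] expresses through the cosine transforms; bounded
    convergence removes the averaging. *)
Lemma fourier_unique_continuous G1 G2 X1 X2 h :
  bmeas G1 -> bmeas G2 -> measurable_fun setT X1 -> measurable_fun setT X2 ->
  (forall c theta, \int[P]_w (G1 w * cos (c * X1 w + theta)) =
                   \int[P]_w (G2 w * cos (c * X2 w + theta))) ->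
  continuous h -> (exists K : R, forall x, `|h x| <= K) ->
  \int[P]_w (G1 w * h (X1 w)) = \int[P]_w (G2 w * h (X2 w)).
Proof.
move=> bG1 bG2 mX1 mX2 H ch [K hK].
have K0 : 0 <= K by exact: le_trans (hK 0).
have mh : measurable_fun setT h by exact: continuous_measurable_fun.
pose S n x := \int[leb]_y (h y * normal_pdf x n.+1%:R^-1 y).
have sn0 n : n.+1%:R^-1 != 0 :> R by rewrite invr_eq0 pnatr_eq0.
have pdfC (s x y : R) : s != 0 -> normal_pdf x s y = normal_pdf y s x.
  by move=> s0; rewrite !normal_pdf_expE// -sqrrN opprB.
have SE n x : S n x = \int[normal_prob x n.+1%:R^-1]_y h y.
  by rewrite (@normal_prob_integral _ _ _ _ K).
have SK n x : `|S n x| <= K.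
  rewrite SE -[leRHS](@Rintegral_prob_cst _ _ _ (normal_prob x n.+1%:R^-1)).
  have ih := @bounded_integrable _ _ _ (normal_prob x n.+1%:R^-1) _ _ mh hK.
  rewrite (le_trans (le_normr_Rintegral _ _))//.
  apply: le_Rintegral => //.
  - by apply: integrable_norm.
  - exact: finite_measure_integrable_cst.
have ihpdf n x : leb.-integrable setT (EFin \o (fun y => h y * normal_pdf x n.+1%:R^-1 y)).
  apply: (@integrable_normal_tail _ x _ _ K) => // y.
  by rewrite (le_trans (hK y))// ler_peMr// lerDl sqr_ge0.
have mS n : measurable_fun setT (S n).
  (* Adding [K] makes the integrand nonnegative, so that Tonelli's theorem gives the measurability
     of the inner integral. *)
  pose k (z : measurableTypeR R * measurableTypeR R) : \bar R :=
    ((h z.2 + K) * normal_pdf z.1 n.+1%:R^-1 z.2)%:E.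
  have mk : measurable_fun setT k.
    apply/measurable_EFinP; apply: measurable_funM.
      by apply: measurable_funD => //; exact: measurableT_comp.
    rewrite (_ : (fun z => _) = (fun z : measurableTypeR R * measurableTypeR R =>
       normal_peak n.+1%:R^-1 *
       expR (- (z.2 - z.1) ^+ 2 / (n.+1%:R^-1 ^+ 2 *+ 2)))); last first.
      by apply/funext => z; rewrite normal_pdf_expE.
    apply: measurable_funM => //; apply: measurableT_comp => //.
    apply: measurable_funM => //; apply: measurable_funN.
    by apply: measurable_funX; exact: measurable_funB.
  have k0 z : (0 <= k z)%E.
    rewrite lee_fin mulr_ge0 ?normal_pdf_ge0//.
    by have := hK z.2; rewrite ler_norml => /andP[+ _]; rewrite -subr_ge0 opprK.
  have mF := @measurable_fun_fubini_tonelli_F _ _ _ _ R leb k mk k0.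
  rewrite (_ : S n = (fun x => fine (fubini_F leb k x) - K)); last first.
    apply/funext => x; rewrite /fubini_F /k/=.
    rewrite -[fine _]/(\int[leb]_y ((h y + K) * normal_pdf x n.+1%:R^-1 y)).
    transitivity (\int[leb]_y (h y * normal_pdf x n.+1%:R^-1 y + K * normal_pdf x n.+1%:R^-1 y) - K); last first.
      by congr (_ - _); apply: eq_Rintegral => y _; rewrite mulrDl.
    rewrite RintegralD//; last first.
      have := integrableZl measurableT K (integrable_normal_pdf x n.+1%:R^-1).
      by apply: eq_integrable => // y _.
    rewrite RintegralZl//; last exact: integrable_normal_pdf.
    by rewrite [X in K * X](_ : _ = 1) ?mulr1 ?addrK// /Rintegral integral_normal_pdf.
  by apply: measurable_funB => //; exact: measurableT_comp.
have swap n G X : bmeas G -> measurable_fun setT X ->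
    \int[P]_w (G w * S n (X w)) =
    \int[leb]_y (h y * \int[P]_w (G w * normal_pdf y n.+1%:R^-1 (X w))).
  move=> bG mX; have [mG [L GL]] := bG.
  have mpdf : measurable_fun setT (fun z : T * measurableTypeR R =>
      normal_pdf (X z.1) n.+1%:R^-1 z.2).
    rewrite (_ : (fun z => _) = (fun z : T * measurableTypeR R => normal_peak n.+1%:R^-1 *
       expR (- (z.2 - X z.1) ^+ 2 / (n.+1%:R^-1 ^+ 2 *+ 2)))); last first.
      by apply/funext => z; rewrite normal_pdf_expE.
    apply: measurable_funM => //; apply: measurableT_comp => //.
    apply: measurable_funM => //; apply: measurable_funN.
    apply: measurable_funX; apply: measurable_funB => //.
    exact: measurableT_comp.
  have mpdfy y : measurable_fun setT (fun w => normal_pdf y n.+1%:R^-1 (X w)).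
    by apply: (measurableT_comp _ mX); exact: measurable_normal_pdf.
  pose f (z : T * measurableTypeR R) :=
    G z.1 * (h z.2 * normal_pdf (X z.1) n.+1%:R^-1 z.2).
  pose k (z : T * measurableTypeR R) :=
    L * K * normal_pdf (X z.1) n.+1%:R^-1 z.2.
  have mf : measurable_fun setT f.
    apply: measurable_funM; first exact: measurableT_comp.
    by apply: measurable_funM => //; exact: measurableT_comp.
  have mk : measurable_fun setT k by exact: measurable_funM.
  have fk z : `|f z| <= k z.
    rewrite /f /k mulrA !normrM (ger0_norm (normal_pdf_ge0 _ _ _)).
    by rewrite ler_wpM2r ?normal_pdf_ge0// ler_pM.
  have iG y : P.-integrable setT (EFin \o (fun w => G w * normal_pdf y n.+1%:R^-1 (X w))).
    apply: bmeas_integrable; apply: bmeasM => //; split => //.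
    exists (normal_peak n.+1%:R^-1) => w; rewrite ger0_norm ?normal_pdf_ge0//.
    exact: normal_pdf_ub.
  have := @Rintegral_Fubini _ _ _ _ R P leb f k (L * K) mf mk fk.
  rewrite /f /k/= => F.
  transitivity (\int[P]_x \int[leb]_y (G x * (h y * normal_pdf (X x) n.+1%:R^-1 y))).
    by apply: eq_Rintegral => w _; rewrite RintegralZl.
  rewrite F.
  - apply: eq_Rintegral => y _; rewrite -(@RintegralZl _ _ _ P _ _ (h y) measurableT (iG y)).
    by apply: eq_Rintegral => w _; rewrite pdfC//; ring.
  - move=> w; under eq_integral do rewrite EFinM.
    rewrite integralZl//; last exact: integrable_normal_pdf.
    by rewrite integral_normal_pdf mule1.
  - move=> y; have := integrableZl measurableT (h y) (iG y).
    by apply: eq_integrable => // w _ /=; rewrite pdfC// -EFinM; congr EFin; ring.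
have cvgS G X : bmeas G -> measurable_fun setT X ->
    \int[P]_w (G w * S n (X w)) @[n --> \oo] --> \int[P]_w (G w * h (X w)).
  move=> [mG [L GL]] mX.
  apply: (@bmeas_dominated_cvg _ _ _ P _ _ (L * K)).
  - by move=> n; apply: measurable_funM => //; exact: measurableT_comp.
  - by move=> n w; rewrite normrM ler_pM.
  - move=> w; apply: cvgM; first exact: cvg_cst.
    exact: (@normal_approx h K (X w) ch hK).
have e n : \int[P]_w (G1 w * S n (X1 w)) = \int[P]_w (G2 w * S n (X2 w)).
  rewrite (swap n _ _ bG1 mX1) (swap n _ _ bG2 mX2).
  apply: eq_Rintegral => y _; congr (_ * _).
  rewrite (cos_gauss_average _ (sn0 n) bG1 mX1) (cos_gauss_average _ (sn0 n) bG2 mX2).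
  congr (_ * _).
  by apply: eq_Rintegral => c _; exact: H.
have c1 := cvgS _ _ bG1 mX1; have c2 := cvgS _ _ bG2 mX2.
rewrite (eq_cvg _ _ e) in c1.
exact: (cvg_unique (@Rhausdorff R) c1 c2).
Qed.

(** Open right half-lines are stable under intersection and generate the Borel sets, and their
    indicators are bounded limits of continuous functions. *)
Lemma fourier_unique G1 G2 X1 X2 (B : set R) :
  bmeas G1 -> bmeas G2 -> measurable_fun setT X1 -> measurable_fun setT X2 ->
  (forall c theta, \int[P]_w (G1 w * cos (c * X1 w + theta)) =
                   \int[P]_w (G2 w * cos (c * X2 w + theta))) ->
  measurable B ->
  \int[P]_w (G1 w * \1_B (X1 w)) = \int[P]_w (G2 w * \1_B (X2 w)).
Proof.
move=> bG1 bG2 mX1 mX2 H.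
pose D := [set B : set R | measurable B /\
  \int[P]_w (G1 w * \1_B (X1 w)) = \int[P]_w (G2 w * \1_B (X2 w))].
suff : <<s @RGenOInfty.G R >> `<=` D.
  move=> sub mB; suff: D B by case.
  apply: sub; suff : (@RGenOInfty.G R).-sigma.-measurable B by [].
  by rewrite -RGenOInfty.measurableE.
(* Frequency and phase 0 give equal total masses, from which complements follow. *)
have HT : \int[P]_w G1 w = \int[P]_w G2 w.
  have := H 0 0; rewrite (@eq_Rintegral _ _ _ P setT G1); last first.
    by move=> w _; rewrite mul0r addr0 cos0 mulr1.
  move=> ->; apply: eq_Rintegral => w _.
  by rewrite mul0r addr0 cos0 mulr1.
apply: g_sigma_sub_dynkin.
- move=> _ _ [x ->] [y ->]; exists (Num.max x y).
  apply/seteqP; split => z /=; rewrite !in_itv/= !andbT gt_max; first by move=> [-> ->].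
  by move/andP.
- split.
  + split; first exact: measurableT.
    rewrite (@eq_Rintegral _ _ _ P setT G1); last by move=> w _; rewrite indicT mulr1.
    by rewrite HT; apply: eq_Rintegral => w _; rewrite indicT mulr1.
  + move=> B' [mB' e]; split; first exact: measurableC.
    have c G X : bmeas G -> measurable_fun setT X ->
        \int[P]_w (G w * \1_(~` B') (X w)) =
        \int[P]_w G w - \int[P]_w (G w * \1_B' (X w)).
      move=> bG mX; rewrite -RintegralB//; last 2 first.
      * exact: bmeas_integrable.
      * by apply: bmeas_integrable; apply: bmeasM => //; exact: bmeas_indic.
      apply: eq_Rintegral => w _; rewrite !indicE in_setC.
      by case: (X w \in B'); rewrite /=; ring.
    by rewrite !c// e HT.
  + move=> F tF DF; split; first by apply: bigcupT_measurable => n; have [] := DF n.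
    have c G X : bmeas G -> measurable_fun setT X ->
        \int[P]_w (G w * \sum_(i < n) \1_(F i) (X w)) @[n --> \oo] -->
        \int[P]_w (G w * \1_(\bigcup_k F k) (X w)).
      move=> [mG [L GL]] mX.
      have sE n x : \sum_(i < n) \1_(F i) x = \1_(\big[setU/set0]_(i < n) F i) x :> R.
        elim: n => [|n IH]; first by rewrite !big_ord0 indic0.
        rewrite !big_ord_recr/= IH !indicE in_setU.
        case: (boolP (x \in F n)) => xFn; last by rewrite orbF addr0.
        rewrite orbT; case: (boolP (x \in _)) => xU; last by rewrite add0r.
        exfalso; move: xU; rewrite inE -bigcup_mkord => -[i /= iltn Fi].
        have := tF n i Logic.I Logic.I.
        move=> /(_ (ex_intro _ x (conj (set_mem xFn) Fi))) ni.
        by rewrite ni ltnn in iltn.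
      apply: (@bmeas_dominated_cvg _ _ _ P _ _ L).
      * move=> n; apply: measurable_funM => //; apply: measurable_sum => i.
        by apply: (measurableT_comp _ mX); apply: measurable_indic; have [] := DF i.
      * move=> n w; rewrite sE normrM indicE.
        by case: (_ \in _); rewrite ?normr1 ?normr0 ?mulr1 ?mulr0// (le_trans _ (GL w)).
      * move=> w; apply: cvgM; first exact: cvg_cst.
        under eq_fun do rewrite sE.
        apply: cvg_near_cst; rewrite !indicE.
        have [[k _ Fk]|nF] := pselect ((\bigcup_k F k) (X w)).
          rewrite (mem_set (A := \bigcup_k F k)); last by exists k.
          exists k.+1 => // n /= kn; rewrite indicE mem_set// -bigcup_mkord.
          by exists k.
        rewrite (memNset nF); apply: nearW => n; rewrite indicE memNset//.
        by rewrite -bigcup_mkord => -[i _ Fi]; apply: nF; exists i.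
    have e n : \int[P]_w (G1 w * \sum_(i < n) \1_(F i) (X1 w)) =
               \int[P]_w (G2 w * \sum_(i < n) \1_(F i) (X2 w)).
      have s G X : bmeas G -> measurable_fun setT X ->
          \int[P]_w (G w * \sum_(i < n) \1_(F i) (X w)) =
          \sum_(i < n) \int[P]_w (G w * \1_(F i) (X w)).
        move=> bG mX; elim: n => [|n IH].
          rewrite big_ord0 (@eq_Rintegral _ _ _ P setT (fun=> 0)) ?Rintegral_prob_cst//.
          by move=> w _; rewrite big_ord0 mulr0.
        rewrite big_ord_recr/= -IH -RintegralD//.
        - by apply: eq_Rintegral => w _; rewrite big_ord_recr/= mulrDr.
        - apply: bmeas_integrable; apply: bmeasM => //.
          elim: {IH} n => [|n IH].
            by under eq_fun do rewrite big_ord0; exact: bmeas_cst.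
          under eq_fun do rewrite big_ord_recr/=; apply: bmeasD => //.
          by apply: bmeas_indic => //; have [] := DF n.
        - apply: bmeas_integrable; apply: bmeasM => //.
          by apply: bmeas_indic => //; have [] := DF n.
      by rewrite !s//; apply: eq_bigr => i _; have [] := DF i.
    have c1 := c _ _ bG1 mX1; have c2 := c _ _ bG2 mX2.
    rewrite (eq_cvg _ _ e) in c1.
    exact: (cvg_unique (@Rhausdorff R) c1 c2).
- move=> _ [a ->]; split; first exact: measurable_itv.
  (* A ramp of slope [n] starting at [a] and capped at 1; it tends to the indicator of []a,
     +oo[]. *)
  pose hn (n : nat) (x : R) := Num.min 1 (n%:R * Num.max 0 (x - a)).
  have hn0 n x : 0 <= hn n x <= 1.
    rewrite /hn le_min ler01 mulr_ge0//=; last by rewrite le_max lexx.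
    by rewrite ge_min lexx.
  have chn n : continuous (hn n).
    move=> x; apply: (@continuous_min _ _ (cst 1) (fun x => n%:R * Num.max 0 (x - a))).
      exact: cvg_cst.
    apply: cvgM; first exact: cvg_cst.
    apply: (@continuous_max _ _ (cst 0) (fun x => x - a)); first exact: cvg_cst.
    by apply: cvgB; [exact: cvg_id|exact: cvg_cst].
  have chn' G X : bmeas G -> measurable_fun setT X ->
      \int[P]_w (G w * hn n (X w)) @[n --> \oo] -->
      \int[P]_w (G w * \1_(`]a, +oo[%classic) (X w)).
    move=> [mG [L GL]] mX; apply: (@bmeas_dominated_cvg _ _ _ P _ _ L).
    + move=> n; apply: measurable_funM => //; apply: (measurableT_comp _ mX).
      exact: continuous_measurable_fun.
    + move=> n w; have /andP[h0 h1] := hn0 n (X w).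
      by rewrite normrM (ger0_norm h0) (le_trans _ (GL w))// ler_piMr.
    + move=> w; apply: cvgM; first exact: cvg_cst.
      apply: cvg_near_cst; rewrite indicE.
      have [aX|Xa] := ltP a (X w); last first.
        apply: nearW => n; rewrite memNset/=; last by rewrite in_itv/= andbT ltNge Xa.
        by rewrite /hn max_l ?subr_le0// mulr0 min_r.
      rewrite mem_set/=; last by rewrite in_itv/= andbT.
      near=> n; rewrite /hn max_r ?subr_ge0 ?ltW// min_l//.
      rewrite -ler_pdivrMr ?subr_gt0//; near: n; exact: nbhs_infty_ger.
  have c1 := chn' _ _ bG1 mX1; have c2 := chn' _ _ bG2 mX2.
  have e n : \int[P]_w (G1 w * hn n (X1 w)) = \int[P]_w (G2 w * hn n (X2 w)).
    apply: fourier_unique_continuous => //; exists 1 => x.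
    by have /andP[h0 h1] := hn0 n x; rewrite ger0_norm.
  rewrite (eq_cvg _ _ e) in c1.
  exact: (cvg_unique (@Rhausdorff R) c1 c2).
Unshelve. all: end_near. Qed.

(* Coordinates are traded for indicators one at a time: the others stay inside
   the cosine, as the bounded weight [G w * cos (rest)] of [fourier_unique]. *)
Lemma fourier_unique_prod (n : nat) G1 G2 (X1 X2 : nat -> T -> R) (B : nat -> set R) :
  bmeas G1 -> bmeas G2 ->
  (forall i, measurable_fun setT (X1 i)) -> (forall i, measurable_fun setT (X2 i)) ->
  (forall i, measurable (B i)) ->
  (forall (c : nat -> R) theta,
    \int[P]_w (G1 w * cos (\sum_(i < n) c i * X1 i w + theta)) =
    \int[P]_w (G2 w * cos (\sum_(i < n) c i * X2 i w + theta))) ->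
  \int[P]_w (G1 w * \prod_(i < n) \1_(B i) (X1 i w)) =
  \int[P]_w (G2 w * \prod_(i < n) \1_(B i) (X2 i w)).
Proof.
move=> + + mX1 mX2 mB; elim: n G1 G2 => [|n IH] G1 G2 bG1 bG2 H.
  have e G (X : nat -> T -> R) : \int[P]_w (G w * \prod_(i < 0) \1_(B i) (X i w : R)) =
      \int[P]_w (G w * cos (\sum_(i < 0) 0 * X i w + 0)).
    by apply: eq_Rintegral => w _; rewrite !big_ord0 add0r cos0.
  by rewrite !e; exact: (H (fun=> 0) 0).
have e G (X : nat -> T -> R) : \int[P]_w (G w * \prod_(i < n.+1) \1_(B i) (X i w : R)) =
    \int[P]_w (G w * \1_(B n) (X n w) * \prod_(i < n) \1_(B i) (X i w)).
  by apply: eq_Rintegral => w _; rewrite big_ord_recr/=; ring.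
have msum c (X : nat -> T -> R) : (forall i, measurable_fun setT (X i)) ->
    measurable_fun setT (fun w => \sum_(i < n) (c i : R) * X i w : R).
  by move=> mX; apply: measurable_sum => i; exact: measurable_funM.
have bc c (X : nat -> T -> R) th : (forall i, measurable_fun setT (X i)) ->
    bmeas (fun w => cos (\sum_(i < n) (c i : R) * X i w + th)).
  by move=> mX; apply: bmeas_cos; apply: measurable_funD => //; exact: msum.
rewrite !e; apply: IH.
- by apply: bmeasM => //; exact: bmeas_indic.
- by apply: bmeasM => //; exact: bmeas_indic.
move=> c theta.
have e' G (X : nat -> T -> R) : \int[P]_w (G w * \1_(B n) (X n w) *
      cos (\sum_(i < n) c i * X i w + theta)) =
    \int[P]_w (G w * cos (\sum_(i < n) c i * X i w + theta) * \1_(B n) (X n w)).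
  by apply: eq_Rintegral => w _; ring.
rewrite !e'; apply: fourier_unique => //.
- by apply: bmeasM => //; exact: bc.
- by apply: bmeasM => //; exact: bc.
move=> b th.
(* The product of cosines is half a sum of cosines in which the last coordinate has coefficient [b]
   or [- b]; the hypothesis on [n.+1] coordinates applies to each. *)
have e2 G (X : nat -> T -> R) : bmeas G -> (forall i, measurable_fun setT (X i)) ->
   \int[P]_w (G w * cos (\sum_(i < n) c i * X i w + theta) * cos (b * X n w + th)) =
   2^-1 * (\int[P]_w (G w * cos (\sum_(i < n.+1)
                (if (i < n)%N then c i else b) * X i w + (theta + th))) +
           \int[P]_w (G w * cos (\sum_(i < n.+1)
                (if (i < n)%N then c i else - b) * X i w + (theta - th)))).
  move=> bG mX.
  have bi (b' t' : R) : P.-integrable setT (EFin \o (fun w => G w * cos (\sum_(i < n.+1)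
                (if (i < n)%N then c i else b') * X i w + t'))).
    apply: bmeas_integrable; apply: bmeasM => //; apply: bmeas_cos.
    apply: measurable_funD => //; apply: measurable_sum => i.
    exact: measurable_funM.
  rewrite -RintegralD// -RintegralZl//; last first.
    by have := integrableD measurableT (bi b (theta + th)) (bi (- b) (theta - th));
      apply: eq_integrable => // w _.
  apply: eq_Rintegral => w _; rewrite !big_ord_recr/= ltnn.
  have es b' : \sum_(i < n) (if (i < n)%N then c i else b') * X i w =
      \sum_(i < n) c i * X i w by apply: eq_bigr => i _; rewrite ltn_ord.
  rewrite !es; set A := \sum_(i < n) _.
  have -> : A + b * X n w + (theta + th) = (A + theta) + (b * X n w + th) by ring.
  have -> : A + - b * X n w + (theta - th) = (A + theta) - (b * X n w + th) by ring.
  set a := A + theta; set e3 := b * X n w + th.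
  by move: a e3 => a e3; have := cosD a e3; have := cosB a e3 => -> ->; field.
by rewrite !e2//; congr (_ * (_ + _)); apply: (H (fun i => if (i < n)%N then c i else _)).
Qed.

End FourierUniqueness.

(** * The Hilbert space L2 *)

Section L2Hilbert.
Context d (T : measurableType d) (R : realType) (mu : {measure set T -> \bar R}).
Implicit Types f g h : L2 mu.

Lemma L2_sqint f : sqint mu f.
Proof.
by split; [exact: L2_measurable|exact: (Lfun2_integrable_sqr (L2_Lfun f))].
Qed.
Hint Resolve L2_sqint : core.

Lemma sqint_Lfun (f : T -> R) : sqint mu f -> f \in Lfun mu 2%:E.
Proof.
move=> sf; have [mf _] := sf; rewrite inE; apply/andP; split; rewrite inE//=.
rewrite /finite_norm; apply: (@lty_poweRy _ _ 2) => //.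
rewrite powR_Lnorm//.
rewrite (_ : (\int[mu]_x _)%E = (\int[mu]_x (f x ^+ 2)%:E)%E).
  by rewrite dot_EFin// ltry.
apply: eq_integral => x _ /=.
by rewrite powR_mulrn// real_normK ?num_real.
Qed.

Lemma L2_norm_sq f : `|f| ^+ 2 = dot mu f f.
Proof.
apply: EFin_inj; rewrite -dot_EFin//.
have -> : (`|f| ^+ 2)%:E = ('N[mu]_2%:E[EFin \o (f : T -> R)] `^ 2)%E.
  have <- : (`|f|)%:E = 'N[mu]_2%:E[EFin \o (f : T -> R)]%E.
    exact: (finite_norm_fine (L2_rep f)).
  by rewrite poweR_EFin powR_mulrn.
rewrite powR_Lnorm//; apply: eq_integral => x _ /=.
by rewrite powR_mulrn// real_normK ?num_real.
Qed.

Lemma L2_addE f g : (f + g : L2 mu) = (fun x => f x + g x) %[ae mu].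
Proof. exact: L2_repK. Qed.

Lemma L2_scaleE c f : (c *: f : L2 mu) = (fun x => c * f x) %[ae mu].
Proof. exact: L2_repK. Qed.

Lemma dotL2D f g h : dot mu (f + g : L2 mu) h = dot mu f h + dot mu g h.
Proof.
rewrite -dotDl//; apply: ae_dot => //; try exact: L2_measurable.
  by apply: measurable_funD; exact: L2_measurable.
exact: L2_addE.
Qed.

Lemma dotL2Z c f h : dot mu (c *: f : L2 mu) h = c * dot mu f h.
Proof.
rewrite -dotZl//; apply: ae_dot => //; try exact: L2_measurable.
  by apply: measurable_funM => //; exact: L2_measurable.
exact: L2_scaleE.
Qed.

Lemma dotL2N f h : dot mu (- f : L2 mu) h = - dot mu f h.
Proof. by rewrite -scaleN1r dotL2Z mulN1r. Qed.

Lemma dotL2B f g h : dot mu (f - g : L2 mu) h = dot mu f h - dot mu g h.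
Proof. by rewrite dotL2D dotL2N. Qed.

Lemma dotL20 h : dot mu (0 : L2 mu) h = 0.
Proof. by rewrite -(scale0r (0 : L2 mu)) dotL2Z mul0r. Qed.

Lemma dotL2_sum (I : Type) (s : seq I) (F : I -> L2 mu) h :
  dot mu (\sum_(i <- s) F i) h = \sum_(i <- s) dot mu (F i) h.
Proof.
elim: s => [|i s IH]; first by rewrite !big_nil dotL20.
by rewrite !big_cons dotL2D IH.
Qed.

Lemma norm_dotL2_le f g : `|dot mu f g| <= `|f| * `|g|.
Proof.
rewrite -(@ler_pXn2r _ 2)// ?nnegrE ?mulr_ge0//.
by rewrite real_normK ?num_real// exprMn !L2_norm_sq cauchy_schwarz.
Qed.

Lemma continuous_dotL2 h : continuous (fun f : L2 mu => dot mu f h).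
Proof.
move=> f; apply/(@cvgrPdist_le _ _ _ (nbhs f) (nbhs_filter f)) => e e0; near=> g.
rewrite -dotL2B (le_trans (norm_dotL2_le _ _))//.
rewrite (@le_trans _ _ (`|f - g| * (`|h| + 1)))//.
  by rewrite ler_wpM2l// lerDl.
rewrite -ler_pdivlMr ?ltr_wpDl//; near: g.
by apply: cvgr_dist_le => //; rewrite divr_gt0// ltr_wpDl.
Unshelve. all: end_near. Qed.

Section Orthonormal.
Variable phi : nat -> L2 mu.
Hypothesis orth : forall i j, dot mu (phi i) (phi j) = (i == j)%:R.

Lemma dotL2_span (c : nat -> R) n j :
  dot mu (\sum_(k < n) c k *: phi k) (phi j) = if (j < n)%N then c j else 0.
Proof.
rewrite dotL2_sum; under eq_bigr do rewrite dotL2Z orth.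
case: ifPn => jn.
  rewrite (bigD1 (Ordinal jn))//= eqxx mulr1 big1 ?addr0// => i ij.
  rewrite (_ : (i == j :> nat) = false) ?mulr0//.
  by apply/negbTE; apply: contra ij => /eqP e; apply/eqP/val_inj.
rewrite big1// => i _; rewrite (_ : (i == j :> nat) = false) ?mulr0//.
by apply/negbTE; apply: contra jn => /eqP <-.
Qed.

Lemma norm_span_sq (c : nat -> R) n :
  `|\sum_(k < n) c k *: phi k| ^+ 2 = \sum_(k < n) c k ^+ 2.
Proof.
rewrite L2_norm_sq dotL2_sum; apply: eq_bigr => i _.
by rewrite dotL2Z dotC dotL2_span ltn_ord expr2.
Qed.

Lemma dot_span f (c : nat -> R) n :
  dot mu f (\sum_(k < n) c k *: phi k) = \sum_(k < n) c k * dot mu f (phi k).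
Proof.
rewrite dotC dotL2_sum; apply: eq_bigr => i _.
by rewrite dotL2Z dotC.
Qed.

(** Pythagoras: the partial sum is the orthogonal projection of [f] on the first [n] vectors. *)
Lemma norm_sub_span f n :
  `|f - \sum_(k < n) dot mu f (phi k) *: phi k| ^+ 2 =
  `|f| ^+ 2 - \sum_(k < n) dot mu f (phi k) ^+ 2.
Proof.
set s := \sum_(k < n) _; rewrite -(norm_span_sq (fun k => dot mu f (phi k))) -/s !L2_norm_sq dotL2B.
rewrite (dotC mu f) (dotC mu s (f - s)) !dotL2B.
have e : dot mu f s = dot mu s s.
  rewrite /s (dot_span f (fun k => dot mu f (phi k))) -L2_norm_sq.
  rewrite (norm_span_sq (fun k => dot mu f (phi k))).
  by apply: eq_bigr => i _; rewrite expr2.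
by rewrite (dotC mu s f) e subrr subr0.
Qed.

Hypothesis complete : forall f : L2 mu,
  \sum_(k < n) dot mu f (phi k) *: phi k @[n --> \oo] --> f.

Lemma parseval f : \sum_(k < n) dot mu f (phi k) ^+ 2 @[n --> \oo] --> `|f| ^+ 2.
Proof.
under eq_fun do rewrite -(norm_span_sq (fun k => dot mu f (phi k))).
by rewrite expr2; under eq_fun do rewrite expr2; apply: cvgM; apply: cvg_norm; exact: complete.
Qed.

Lemma bessel f n : \sum_(k < n) dot mu f (phi k) ^+ 2 <= `|f| ^+ 2.
Proof. by rewrite -subr_ge0 -norm_sub_span sqr_ge0. Qed.

Lemma L2_coord_ext f g : (forall k, dot mu f (phi k) = dot mu g (phi k)) -> f = g.
Proof.
move=> fg; have cf := @complete f.
have e : (fun n => \sum_(k < n) dot mu f (phi k) *: phi k) =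
         (fun n => \sum_(k < n) dot mu g (phi k) *: phi k).
  by apply/funext => n; apply: eq_bigr => k _; rewrite fg.
rewrite e in cf.
exact: (cvg_unique (@norm_hausdorff _ _) cf (@complete g)).
Qed.

Lemma norm_phi k : `|phi k| = 1.
Proof.
by apply/eqP; rewrite -(@eqrXn2 _ 2)// L2_norm_sq orth eqxx expr1n.
Qed.

(** Indexed by a countable type; its density is the separability of L2. *)
Definition rat_comb (q : seq rat) : L2 mu :=
  \sum_(k < size q) ratr (nth 0 q k) *: phi k.

Lemma rat_comb_dense f (e : R) : 0 < e -> exists q, `|f - rat_comb q| < e.
Proof.
move=> e0; have e20 : 0 < e / 2 by rewrite divr_gt0.
have /cvgrPdist_lt/(_ _ e20)[n _ /(_ n (leqnn n)) /= fn] := @complete f.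
(* The [n] coefficient errors share [e / 2]; dividing by [n.+1] covers [n = 0]. *)
have dl : 0 < e / 2 / n.+1%:R by rewrite divr_gt0.
have /choice[q qd] : forall k : nat, exists q : rat,
    `|dot mu f (phi k) - ratr q| < e / 2 / n.+1%:R.
  move=> k; set x := dot mu f (phi k).
  have [|q] := @rat_in_itvoo R (x - e / 2 / n.+1%:R) (x + e / 2 / n.+1%:R).
    by rewrite ltrD2l gtrN.
  by rewrite in_itv/= => xq; exists q; rewrite distrC ltr_distl.
exists (mkseq q n); rewrite /rat_comb size_mkseq.
set s := \sum_(k < n) dot mu f (phi k) *: phi k in fn.
rewrite -(subrK s f) -addrA (le_lt_trans (ler_normD _ _))//.
rewrite [ltRHS]splitr ltr_leD// /s -sumrB.
apply: le_trans (ler_norm_sum _ _ _) _.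
rewrite (@le_trans _ _ (\sum_(k < n) e / 2 / n.+1%:R))//.
  apply: ler_sum => k _; rewrite nth_mkseq// -scalerBl normrZ norm_phi mulr1.
  exact: ltW (qd k).
rewrite sumr_const card_ord -[leLHS]mulr_natr -mulrA ler_piMr ?(ltW e20)//.
by rewrite mulrC ler_pdivrMr// mul1r ler_nat.
Qed.

(** By density, balls centred at rational combinations with radii 1/(m+1) suffice. Their index type
    is countable, so that Borel measurability can be tested on balls. *)
Lemma open_bigcup_balls (U : set (L2 mu)) : open U ->
  U = \bigcup_(p in [set p : seq rat * nat |
         ball (rat_comb p.1) p.2.+1%:R^-1 `<=` U])
        ball (rat_comb p.1) (p.2.+1%:R^-1 : R).
Proof.
move=> oU; apply/seteqP; split => [f Uf|f [p pU fp]]; last exact: pU.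
have /nbhs_ballP[e /= e0 eU] : nbhs f U by exact: open_nbhs_nbhs.
have e20 : 0 < e / 2 by rewrite divr_gt0.
have /cvgr_lt/(_ _ e20)[m _ /(_ m (leqnn m)) /= me] := @cvg_harmonic R.
have m0 : 0 < m.+1%:R^-1 :> R by [].
have [q fq] := rat_comb_dense f m0.
exists (q, m) => /=; last by rewrite -ball_normE/= distrC.
move=> g; rewrite -ball_normE/= => qg; apply: eU; rewrite -ball_normE/=.
rewrite -(subrKA (rat_comb q)) (le_lt_trans (ler_normD _ _))//.
rewrite [ltRHS]splitr ltrD//; exact: lt_trans me.
Qed.

(** Open sets are countable unions of balls, and Parseval writes the squared distance to a centre as
    a limit of sums of squared coordinates. *)
Lemma measurable_L2 d' (T' : measurableType d') (X : T' -> L2 mu) :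
  (forall k, measurable_fun setT (fun w => dot mu (X w) (phi k))) ->
  measurable_fun [set: T'] (X : T' -> Borel (L2 mu)).
Proof.
move=> mX; apply: (@measurability _ _ T' (Borel (L2 mu)) setT X (@open (L2 mu))) => //.
move=> _ [U oU <-]; rewrite setTI (open_bigcup_balls oU) preimage_bigcup.
rewrite bigcup_mkcond; apply: countable_bigcupT_measurable => //.
move=> [q m] /=; case: ifPn => // _.
have mN : measurable_fun setT (fun w => `|X w - rat_comb q| ^+ 2).
  apply: (@measurable_fun_cvg _ _ _ _
    (fun n w => \sum_(k < n) dot mu (X w - rat_comb q) (phi k) ^+ 2)).
    move=> n; apply: measurable_sum => k; apply: measurable_funX.
    by under eq_fun do rewrite dotL2B; exact: measurable_funB.
  by move=> w _; exact: parseval.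
have := mN measurableT `]-oo, ((m.+1%:R^-1 : R) ^+ 2)[%classic (measurable_itv _).
rewrite setTI; congr (measurable _); apply/seteqP; split => w /=;
  rewrite in_itv/= -ball_normE/= distrC ltr_pXn2r// ?nnegrE//.
Qed.

End Orthonormal.

Lemma measurable_continuous_L2 (g : L2 mu -> R) : continuous g ->
  measurable_fun [set: Borel (L2 mu)] (g : Borel (L2 mu) -> R).
Proof.
move=> cg; apply: (measurability (@RGenOpens.G R)).
  exact: RGenOpens.measurableE.
move=> _ [A oA <-]; rewrite setTI; apply: sub_sigma_algebra.
by move/continuousP : cg; apply; case: oA => x [y ->]; exact: interval_open.
Qed.

End L2Hilbert.
#[global] Hint Resolve L2_sqint : core.

Section RieszFischer.
Context d (T : measurableType d) (R : realType) (mu : probability T R).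
Variable phi : nat -> L2 mu.
Hypothesis orth : forall i j, dot mu (phi i) (phi j) = (i == j)%:R.

(* Along a subsequence the increments of the partial sums have L^2 norm at most
   2^-j, hence a summable L^1 norm, so the partial sums converge a.e.; Fatou's
   lemma identifies the a.e. limit as the L^2 limit. *)
Lemma riesz_fischer (c : nat -> R) (K : R) :
  (forall n, \sum_(k < n) c k ^+ 2 <= K) ->
  exists f : L2 mu, forall k, dot mu f (phi k) = c k.
Proof.
move=> cK.
pose S n := \sum_(k < n) c k ^+ 2.
have ndS : nondecreasing_seq S.
  apply/nondecreasing_seqP => n; rewrite /S big_ord_recr/= lerDl; exact: sqr_ge0.
have cS : cvgn S by apply: nondecreasing_is_cvgn => //; exists K => _ [n _ <-]; exact: cK.
have Sl n : S n <= limn S by exact: nondecreasing_cvgn_le.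
(* [N0 j] makes the tail of the squares at most (2^-j)^2, hence later increments of norm at most
   2^-j. *)
have /choice[N0 N0P] : forall j : nat, exists n, limn S - S n <= (2^-1 ^+ j) ^+ 2.
  move=> j; have e0 : 0 < (2^-1 ^+ j) ^+ 2 :> R by rewrite !exprn_gt0// invr_gt0.
  move/cvgrPdist_le : cS => /(_ _ e0)[n _ /(_ n (leqnn n)) /= h].
  by exists n; rewrite (le_trans (ler_norm _)).
(* A strictly increasing sequence that dominates [N0]. *)
pose N := fix N j := if j is j'.+1 then maxn (N j').+1 (N0 j) else N0 0%N.
have N0N j : (N0 j <= N j)%N by case: j => //= j; exact: leq_maxr.
have NS j : (N j < N j.+1)%N by rewrite /= leq_maxl.
have Nge j : (j <= N j)%N by elim: j => // j IH; exact: leq_ltn_trans (NS j).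
have Nmono : {homo N : i j / (i <= j)%N >-> (i <= j)%N}.
  by move=> i j; elim: j i => [|j IH] i; [rewrite leqn0 => /eqP ->|
    rewrite leq_eqVlt => /predU1P[->//|/IH/leq_trans]; apply; exact: ltnW].
pose s n : L2 mu := \sum_(k < n) c k *: phi k.
pose u j : T -> R := s (N j).
have mu_ j : measurable_fun setT (u j) by exact: L2_measurable.
have su j : sqint mu (u j) by exact: L2_sqint.
have dist i j : (i <= j)%N -> dot mu (u j \- u i) (u j \- u i) <= (2^-1 ^+ i) ^+ 2.
  move=> ij; have Nij := Nmono _ _ ij.
  have -> : dot mu (u j \- u i) (u j \- u i) = `|s (N j) - s (N i)| ^+ 2.
    have dl (h : L2 mu) : dot mu (u j \- u i) h = dot mu (s (N j) - s (N i)) h.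
      by rewrite dotBl// dotL2B.
    rewrite L2_norm_sq -dl (dotC mu _ (s (N j) - s (N i))).
    have sd := sqintB (su j) (su i).
    by rewrite !dotBr// !dl.
  have e : `|s (N j) - s (N i)| ^+ 2 = S (N j) - S (N i).
    pose c' k := if (k < N i)%N then 0 else c k.
      have -> : s (N j) - s (N i) = \sum_(k < N j) c' k *: phi k.
      rewrite /s -(subnKC Nij) !big_split_ord/= addrAC.
      rewrite [X in _ = X + _]big1 ?add0r; last first.
        by move=> k _; rewrite /c' ltn_ord scale0r.
      rewrite subrr add0r; apply: eq_bigr => k _.
      by rewrite /c' ltnNge leq_addr.
    rewrite norm_span_sq// /S -(subnKC Nij) !big_split_ord/= addrAC subrr add0r.
    rewrite big1 ?add0r; last by move=> k _; rewrite /c' ltn_ord expr0n.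
    by apply: eq_bigr => k _; rewrite /c' ltnNge leq_addr.
  rewrite e (le_trans _ (N0P i))// lerB//.
  by apply: ndS; exact: N0N.
have L1 j : \int[mu]_x `|u j.+1 x - u j x| <= 2^-1 ^+ j.
  have I0 : 0 <= \int[mu]_x `|u j.+1 x - u j x| by exact: Rintegral_ge0.
  have h0 : 0 <= 2^-1 ^+ j :> R by exact: exprn_ge0.
  rewrite -(@ler_pXn2r _ 2)//.
  apply: le_trans (dist j j.+1 (leqnSn j)).
  by apply: (@Rintegral_norm_sq _ _ _ mu (u j.+1 \- u j)); exact: sqintB.
have md j : measurable_fun setT (fun x => `|u j.+1 x - u j x|%:E).
  by apply/measurable_EFinP; apply: measurableT_comp => //; exact: measurable_funB.
have L1E j : (\int[mu]_x `|u j.+1 x - u j x|%:E <= (2^-1 ^+ j)%:E)%E.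
  have ij : mu.-integrable setT (EFin \o (fun x => `|u j.+1 x - u j x|)).
    apply: integrable_norm; apply: (sqint_integrable (P := mu)); exact: sqintB.
  rewrite -[leLHS]fineK ?lee_fin; first exact: L1.
  exact: (integrable_fin_num measurableT ij).
have cu : {ae mu, forall x, cvgn (u ^~ x)}.
  pose Su (x : T) := (\sum_(0 <= j <oo) `|u j.+1 x - u j x|%:E)%E.
  have iS : (\int[mu]_x Su x < +oo)%E.
    rewrite /Su integral_nneseries//.
    apply: (@le_lt_trans _ _ (\sum_(0 <= j <oo) (2^-1 ^+ j)%:E)%E).
      by apply: lee_nneseries => *; [apply: integral_ge0 => *; rewrite lee_fin|exact: L1E].
    apply: (@le_lt_trans _ _ 2%:E); last by rewrite ltry.
    apply: lime_le; first by apply: is_cvg_nneseries => j _ _; rewrite lee_fin.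
    apply: nearW => n; rewrite sumEFin lee_fin.
    have -> : \sum_(0 <= j < n) 2^-1 ^+ j = 2 - 2 * 2^-1 ^+ n :> R.
      elim: n => [|n IH]; first by rewrite big_nil expr0 mulr1 subrr.
      by rewrite big_nat_recr//= IH exprS; field.
    by rewrite lerBlDr lerDl mulr_ge0// exprn_ge0.
  have mSu : measurable_fun setT Su.
    by apply: ge0_emeasurable_sum => //.
  have Su0 x : (0 <= Su x)%E by apply: nneseries_ge0.
  have /integrable_ae : mu.-integrable setT Su.
    apply/integrableP; split=> //.
    by under eq_integral do rewrite gee0_abs//.
  move=> /(_ measurableT); apply: filterS => x /(_ Logic.I) Sx.
  have : cvgn [series `|u j.+1 x - u j x|]_j.
    apply: nondecreasing_is_cvgn.
      by apply/nondecreasing_seqP => n; rewrite /series/= big_nat_recr//= lerDl.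
    exists (fine (Su x)) => _ [n _ <-]; rewrite -lee_fin fineK// /series/= -sumEFin.
    by apply: nneseries_lim_ge => j _; rewrite lee_fin.
  move=> /normed_cvg; rewrite /series/=.
  rewrite (_ : (fun n => _) = (fun n => u n x - u 0%N x)); last first.
    by apply/funext => n; rewrite telescope_sumr.
  move=> c1; rewrite (_ : u ^~ x = (fun n => (u n x - u 0%N x) + u 0%N x)); last first.
    by apply/funext => n; rewrite subrK.
  by apply: is_cvgD => //; exact: is_cvg_cst.
(* The upper limit is measurable everywhere, including the null set where the sequence may
   diverge. *)
pose f x := fine (limn_esup (fun j => (u j x)%:E)).
have mf : measurable_fun setT f.
  apply: measurableT_comp => //; apply: measurable_fun_limn_esup => j.
  exact/measurable_EFinP.
have uf : {ae mu, forall x, u j x @[j --> \oo] --> f x}.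
  apply: filterS cu => x cx.
  have cE : (u j x)%:E @[j --> \oo] --> (limn (u ^~ x))%:E.
    by apply: cvg_EFin; [exact: nearW|exact: cx].
  rewrite /f is_cvg_limn_esupE; last by apply/cvg_ex; eexists; exact: cE.
  by rewrite (cvg_lim _ cE).
have dif i : (\int[mu]_x ((f x - u i x) ^+ 2)%:E <= ((2^-1 ^+ i) ^+ 2)%:E)%E.
  pose g j x := ((u (j + i)%N x - u i x) ^+ 2)%:E.
  have mg j : measurable_fun setT (g j).
    by apply/measurable_EFinP; apply: measurable_funX; exact: measurable_funB.
  have -> : (\int[mu]_x ((f x - u i x) ^+ 2)%:E = \int[mu]_x limn_einf (g ^~ x))%E.
    apply: ae_eq_integral => //.
    - by apply/measurable_EFinP; apply: measurable_funX; exact: measurable_funB.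
    - apply: (@measurableT_comp _ _ _ _ _ _ (-%E) _ (fun x => limn_esup (\- (g ^~ x))%E)).
        exact: oppe_measurable.
      apply: measurable_fun_limn_esup => j.
      by apply: measurableT_comp => //; exact: mg.
    - apply: filterS uf => x ux _; apply/esym.
      have cg : g ^~ x @ \oo --> ((f x - u i x) ^+ 2)%:E.
        apply: cvg_EFin; first exact: nearW.
        rewrite /comp/= expr2; under eq_fun do rewrite expr2.
        have : (u (j + i)%N x - u i x) @[j --> \oo] --> f x - u i x.
          by apply: cvgB; [rewrite (cvg_shiftn i (u ^~ x))|exact: cvg_cst].
        by move=> h; exact: cvgM.
      rewrite is_cvg_limn_einfE; last by apply/cvg_ex; eexists; exact: cg.
      exact: cvg_lim.
  apply: (le_trans (fatou mu measurableT mg _)).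
    by move=> j x _; rewrite lee_fin sqr_ge0.
  have gb j : (\int[mu]_x g j x <= ((2^-1 ^+ i) ^+ 2)%:E)%E.
    have -> : (\int[mu]_x g j x = (dot mu (u (j + i)%N \- u i) (u (j + i)%N \- u i))%:E)%E.
      by rewrite -dot_EFin//; exact: sqintB.
    by rewrite lee_fin dist// leq_addl.
  rewrite limn_einf_lim; apply: lime_le; first exact: is_cvg_einfs.
  apply: nearW => j; apply: le_trans (gb j).
  by apply: ereal_inf_lbound; exists j => /=.
have sf : sqint mu f.
  have s0 : sqint mu (f \- u 0%N).
    apply: sqint_lty; first exact: measurable_funB.
    by rewrite (le_lt_trans (dif 0%N))// ltry.
  have := sqintD s0 (su 0%N).
  by rewrite (_ : (_ \+ _) = f)//; apply/funext => x /=; rewrite subrK.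
pose F : L2 mu := L2_class (Lfun_Sub (lee1n 2) (sqint_Lfun sf)).
exists F => k.
have FE : F = f %[ae mu] by exact: L2_repK.
rewrite (@ae_dot _ _ _ mu F f)//; try exact: L2_measurable.
have b i : dot mu (f \- u i) (phi k) ^+ 2 <= (2^-1 ^+ i) ^+ 2.
  rewrite (le_trans (cauchy_schwarz _ _))//; first exact: sqintB.
  rewrite orth eqxx mulr1 -lee_fin -dot_EFin//; last exact: sqintB.
  exact: dif.
(* Once [N i] exceeds [k], the coefficient of [u i] along [phi k] is exactly [c k]. *)
have b' i : (k < N i)%N -> `|dot mu f (phi k) - c k| <= 2^-1 ^+ i.
  move=> ki; have h0 : 0 <= 2^-1 ^+ i :> R by exact: exprn_ge0.
  rewrite -(@ler_pXn2r _ 2)//.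
  rewrite real_normK ?num_real// (le_trans _ (b i))// dotBl//.
  by rewrite /u /s dotL2_span// ki.
apply/eqP; rewrite -subr_eq0 -normr_le0; apply/ler_addgt0Pr => e e0.
rewrite add0r.
have h1 : `|2^-1 : R| < 1 by rewrite ger0_norm ?invr_ge0// invf_lt1// ltr1n.
have := @cvg_geometric R 1 2^-1 h1; move/cvgr0Pnorm_le => /(_ _ e0)[n _ /= ne].
have := ne (maxn n k.+1) (leq_maxl _ _); rewrite mul1r => h.
rewrite (le_trans (b' (maxn n k.+1) _))//.
  by rewrite (leq_trans _ (Nge _))// leq_maxr.
by rewrite (le_trans (ler_norm _)).
Qed.

End RieszFischer.

(** * Laws on L2 are determined by cylinder sets *)

Section LawUniqueness.
Context d (T : measurableType d) (R : realType) (mu : {measure set T -> \bar R}).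
Variable phi : nat -> L2 mu.
Hypothesis orth : forall i j, dot mu (phi i) (phi j) = (i == j)%:R.
Hypothesis complete : forall f : L2 mu,
  \sum_(k < n) dot mu f (phi k) *: phi k @[n --> \oo] --> f.

Definition cylinder (A : set (L2 mu)) : Prop := exists n (B : nat -> set R),
  (forall i, measurable (B i)) /\
  A = [set x | forall i, (i < n)%N -> B i (dot mu x (phi i))].

Lemma cylinder_setI : setI_closed cylinder.
Proof.
move=> _ _ [n [B [mB ->]]] [n' [B' [mB' ->]]].
exists (maxn n n'), (fun i => (if (i < n)%N then B i else setT) `&`
                              (if (i < n')%N then B' i else setT)).
split; first by move=> i; apply: measurableI; case: ifP.
apply/seteqP; split => x /=.
  by move=> [h h'] i _; split; case: ifP => //; [exact: h|exact: h'].
move=> h; split => i ilt.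
  by have [|] := h i; [rewrite leq_max ilt|rewrite ilt].
by have [|] := h i; [rewrite leq_max ilt orbT|rewrite ilt].
Qed.

(** The identity, from L2 with the cylinder sigma-algebra to L2 with the Borel one, has measurable
    coordinates, so [measurable_L2] makes it measurable. *)
Lemma borel_cylinder (A : set (Borel (L2 mu))) : measurable A -> <<s cylinder >> A.
Proof.
move=> mA.
have := @measurable_L2 _ _ _ mu phi orth complete _ (g_sigma_algebraType cylinder) id.
have mc k : measurable_fun setT (fun w : g_sigma_algebraType cylinder => dot mu w (phi k)).
  move=> _ B mB; rewrite setTI; apply: sub_sigma_algebra.
  exists k.+1, (fun i => if i == k then B else setT); split.
    by move=> i; case: ifP.
  apply/seteqP; split => x /=; last by move/(_ k (ltnSn k)); rewrite eqxx.
  by move=> Bx i _; case: eqP => // ->.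
by move=> /(_ mc measurableT A mA); rewrite setTI.
Qed.

(** Cylinders are stable under intersection and generate the Borel sets, and their probabilities are
    expectations of products of indicators; so the two image measures agree. *)
Lemma L2_law_unique d' (Om : measurableType d') (P : probability Om R)
    (X1 X2 : Om -> L2 mu) (g : L2 mu -> R) :
  (forall k, measurable_fun setT (fun w => dot mu (X1 w) (phi k))) ->
  (forall k, measurable_fun setT (fun w => dot mu (X2 w) (phi k))) ->
  (forall n (B : nat -> set R), (forall i, measurable (B i)) ->
    \int[P]_w \prod_(i < n) \1_(B i) (dot mu (X1 w) (phi i)) =
    \int[P]_w \prod_(i < n) \1_(B i) (dot mu (X2 w) (phi i)) :> R) ->
  continuous g -> (exists K, forall x, `|g x| <= K) ->
  \int[P]_w g (X1 w) = \int[P]_w g (X2 w).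
Proof.
move=> mX1 mX2 H cg [K gK].
have mX1' := measurable_L2 orth complete mX1.
have mX2' := measurable_L2 orth complete mX2.
have mg := measurable_continuous_L2 cg.
have prE (X : Om -> L2 mu) n (B : nat -> set R) :
    measurable_fun setT (X : Om -> Borel (L2 mu)) ->
    (forall i, measurable (B i)) ->
    (forall k, measurable_fun setT (fun w => dot mu (X w) (phi k))) ->
    P [set w | forall i, (i < n)%N -> B i (dot mu (X w) (phi i))] =
    (\int[P]_w \prod_(i < n) \1_(B i) (dot mu (X w) (phi i)))%:E.
  move=> mX mB mXk.
  set A := [set w | _].
  have AE w : \prod_(i < n) \1_(B i) (dot mu (X w) (phi i)) = \1_A w :> R.
    rewrite [RHS]indicE; have [Aw|nA] := pselect (A w).
      rewrite mem_set// big1// => i _; rewrite indicE mem_set//; exact: Aw.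
    rewrite memNset//.
    have /existsNP[i /not_implyP[ilt nB]] := nA.
    by rewrite (bigD1 (Ordinal ilt))//= indicE memNset// mul0r.
  have mA : measurable A.
    rewrite (_ : A = \bigcap_(i in `I_n) ((fun w => dot mu (X w) (phi i)) @^-1` B i)).
      apply: bigcap_measurableType => i _; rewrite -[X in measurable X]setTI.
      exact: mXk.
    by apply/seteqP; split => w /=.
  rewrite (@eq_Rintegral _ _ _ P setT (\1_A : Om -> R)); last by move=> w _; exact: AE.
  rewrite /Rintegral integral_indic// setIT fineK//; exact: fin_num_measure.
have law (A : set (Borel (L2 mu))) : measurable A -> P (X1 @^-1` A) = P (X2 @^-1` A).
  move=> /borel_cylinder.
  pose D := [set A : set (L2 mu) | [/\ measurable (X1 @^-1` A),
     measurable (X2 @^-1` A) & P (X1 @^-1` A) = P (X2 @^-1` A)]].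
  suff sub : <<s cylinder >> `<=` D by move=> /sub [].
  apply: (@g_sigma_sub_dynkin _ cylinder D cylinder_setI).
  - split.
    + by split; rewrite ?preimage_setT//; exact: measurableT.
    + move=> B [m1 m2 e]; split; [exact: (measurableC m1)|exact: (measurableC m2)|].
      have c (A' : set Om) : measurable A' -> P (~` A') = (1 - P A')%E.
        by move=> mA'; rewrite probability_setC.
      by have := c _ m1; have := c _ m2; rewrite e => <-.
    + move=> F tF DF.
      have m1 n : measurable (X1 @^-1` F n) by have [] := DF n.
      have m2 n : measurable (X2 @^-1` F n) by have [] := DF n.
      split; rewrite !preimage_bigcup; try exact: bigcupT_measurable.
      have tp (X : Om -> L2 mu) : trivIset setT (fun n => X @^-1` F n).
        by move=> i j _ _ [w [wi wj]]; apply: tF => //; exists (X w).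
      rewrite !measure_bigcup//.
      by apply: eq_eseriesr => n _; have [] := DF n.
  - move=> _ [n [B [mB ->]]]; rewrite /D/=.
    have mpre (X : Om -> L2 mu) : (forall k, measurable_fun setT (fun w => dot mu (X w) (phi k))) ->
       measurable (X @^-1` [set x | forall i, (i < n)%N -> B i (dot mu x (phi i))]).
      move=> mX; rewrite (_ : _ @^-1` _ = \bigcap_(i in `I_n) ((fun w => dot mu (X w) (phi i)) @^-1` B i)).
        apply: bigcap_measurableType => i _; rewrite -[X in measurable X]setTI.
        exact: mX.
      by apply/seteqP; split => w /=.
    split; [exact: mpre|exact: mpre|].
    by rewrite /= (prE X1 n B mX1' mB mX1) (prE X2 n B mX2' mB mX2) H.
have pf (X : Om -> L2 mu) : measurable_fun setT (X : Om -> Borel (L2 mu)) ->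
    \int[P]_w g (X w) =
    fine (\int[pushforward P (X : Om -> Borel (L2 mu))]_x (g x)%:E)%E.
  move=> mX; rewrite (integral_pushforward mX)//; first exact/measurable_EFinP.
  exact: (@bounded_integrable _ _ _ P (fun w => g (X w)) K (measurableT_comp mg mX)
    (fun w => gK (X w))).
rewrite (pf _ mX1') (pf _ mX2'); congr fine.
by apply: eq_measure_integral => A mA _; exact: law.
Qed.

End LawUniqueness.

(** * Lowest eigenvalues *)

Section Fractal.
Context (R : realType) (F : pointedMetricType R) (M : nat).
Variables (psi : 'I_M -> F -> F) (pi : (nat -> 'I_M) -> F).
Hypothesis hF : pcf_self_similar psi pi.

Local Notation wmap := (word_map psi).
Local Notation bd := (boundary psi pi).

(** * Coding, intersections and connectedness of cells *)

Definition scons (i : 'I_M) (s : nat -> 'I_M) : nat -> 'I_M :=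
  fun k => if k is k'.+1 then s k' else i.

Lemma cellP w x : cell psi w x <-> exists y, x = wmap w y.
Proof. by split=> [[y _ <-]|[y ->]]; exists y. Qed.

Lemma mkseq_scons i s n : mkseq (scons i s) n.+1 = i :: mkseq s n.
Proof. by rewrite /mkseq/= -[1%N]/(1 + 0)%N iotaDl -map_comp. Qed.

Lemma pi_cell s n : cell psi (mkseq s n) (pi s).
Proof.
have : (\bigcap_n cell psi (mkseq s n)) (pi s) by rewrite (pcf_coding hF).
by apply.
Qed.

Lemma psi_pi i s : psi i (pi s) = pi (scons i s).
Proof.
suff : (\bigcap_n cell psi (mkseq (scons i s) n)) (psi i (pi s)).
  by rewrite (pcf_coding hF).
move=> [|n] _; first by exists (psi i (pi s)).
have [y _ ys] := pi_cell s n.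
by exists y => //; rewrite mkseq_scons /= -ys.
Qed.

(** The itinerary of [x]: a preimage under some [psi i] is chosen at each step and its letter is
    recorded. *)
Lemma pi_surj x : exists s, pi s = x.
Proof.
have /choice[p pP] : forall x, exists iy : 'I_M * F, x = psi iy.1 iy.2.
  move=> y; have : [set: F] y by [].
  by rewrite -(pcf_cover hF) => -[i _ [z _ <-]]; exists (i, z).
pose it n := iter n (fun y => (p y).2) x.
pose s n := (p (it n)).1.
exists s; apply/esym.
suff : (\bigcap_n cell psi (mkseq s n)) x by rewrite (pcf_coding hF).
move=> n _; apply/cellP; exists (it n).
elim: n => // n IH; rewrite mkseqS /word_map -cats1 foldr_cat/=.
by rewrite /s -pP.
Qed.

Lemma wmap_pi w s : wmap w (pi s) = pi (foldr scons s w).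
Proof. by elim: w => //= i w IH; rewrite IH psi_pi. Qed.

Lemma shift_foldr w s : Defs.shift (size w) (foldr scons s w) = s.
Proof.
apply/funext => k; rewrite /Defs.shift.
by elim: w => [|i w IH] /=; rewrite ?addn0// addnS.
Qed.

(** A common prefix is removed by injectivity. At the first differing letter the point lies in two
    cells of level one, so each of its codes is critical; what follows the word in such a code is a
    shift of it, hence post-critical. *)
Lemma cells_meet w v x : size w = size v -> w <> v ->
  cell psi w x -> cell psi v x ->
  exists y z, [/\ bd y, bd z, x = wmap w y & x = wmap v z].
Proof.
elim: w v x => [|i w IH] [|j v] x //= [wv] + /cellP[y xy] /cellP[z xz].
move: xz; have [<-|ij] := eqVneq i j => xz wvn.
  have wv' : w <> v by move=> e; apply: wvn; rewrite e.
  have e : wmap w y = wmap v z.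
    by apply: (pcf_injective hF (i := i)); move: xy xz => /= -> ->.
  have [||y' [z' [by' bz' ey ez]]] := IH v (wmap w y) wv wv'.
  - by apply/cellP; exists y.
  - by apply/cellP; exists z.
  by exists y', z'; split => //=; rewrite xy/=; congr (psi i _).
have [sy ey] := pi_surj y; have [sz ez] := pi_surj z.
have cr : (range (psi i) `&` range (psi j)) x.
  by split; [exists (wmap w y) => //; rewrite xy|exists (wmap v z) => //; rewrite xz].
have b w' s i' j' : i' != j' -> x = wmap (i' :: w') (pi s) ->
    (range (psi i') `&` range (psi j')) x -> bd (pi s).
  move=> ij' e c; exists s => //; exists (size (i' :: w')) => //=.
  exists (foldr scons s (i' :: w')); last exact: shift_foldr.
  by exists i', j'; split => //; rewrite -wmap_pi -e.
exists y, z; split => //.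
  by rewrite -ey; apply: (b w _ i j) => //; rewrite ey.
rewrite -ez; apply: (b v _ j i); rewrite 1?eq_sym ?ez//.
by rewrite setIC.
Qed.

Lemma psi_continuous i : continuous (psi i).
Proof.
move=> x; have [c /andP[c0 c1] psiP] := pcf_contraction hF i.
apply/cvg_ballP => e e0; apply/nbhs_ballP; exists e => //= y.
rewrite !ballEmdist/= => xy; rewrite (le_lt_trans (psiP _ _))//.
by rewrite (le_lt_trans _ xy)// ler_piMl ?mdist_ge0// ltW.
Qed.

Lemma wmap_continuous w : continuous (wmap w).
Proof.
elim: w => [|i w IH] x; first exact: cvg_id.
by apply: (continuous_comp (IH x)); exact: psi_continuous.
Qed.

Lemma cell_closed w : closed (cell psi w).
Proof.
apply: compact_closed; first exact: metric_hausdorff.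
apply: continuous_compact; last exact: (pcf_compact hF).
exact/continuous_subspaceT/wmap_continuous.
Qed.

Lemma cell_cover n x : exists w : n.-tuple 'I_M, cell psi w x.
Proof.
have [s <-] := pi_surj x.
have sz : size (mkseq s n) == n by rewrite size_mkseq.
by exists (Tuple sz); exact: pi_cell.
Qed.

(** The value of [f] sorts the cells into two finite unions, both closed, and disjoint by
    assumption; connectedness leaves only one of them. *)
Lemma cells_connected (n : nat) (T : Type) (f : n.-tuple 'I_M -> T) :
  (forall w v x, cell psi (tval w) x -> cell psi (tval v) x -> f w = f v) ->
  forall w v, f w = f v.
Proof.
move=> fP w v.
pose A := \bigcup_(u in [set u | f u = f w]) cell psi (tval u).
pose B := \bigcup_(u in [set u | f u <> f w]) cell psi (tval u).
have cA : closed A by apply: closed_bigcup => [|u _]; [exact: finite_finset|exact: cell_closed].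
have cB : closed B by apply: closed_bigcup => [|u _]; [exact: finite_finset|exact: cell_closed].
have AB : A = ~` B.
  apply/seteqP; split => [x [u /= fu xu] [u' /= fu' xu']|x nB].
    by apply: fu'; rewrite -fu; exact: fP xu' xu.
  have [u xu] := cell_cover n x; exists u => //=.
  by apply: contrapT => fu; apply: nB; exists u.
have AT : A = [set: F].
  apply: (pcf_connected hF).
  - exists (wmap w point); exists w => //; by exists point.
  - by exists A; rewrite ?setTI// AB; exact: closed_openC.
  - by exists A; rewrite ?setTI.
have : A (wmap v point) by rewrite AT.
move=> [u /= <- xu]; apply: (fP u v _ xu); by exists point.
Qed.

(** Otherwise distinct cells of level one would never meet, against connectedness, as there are at
    least two of them. *)
Lemma boundary_nonempty : exists x, bd x.
Proof.
apply: contrapT => nb.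
have M2 := pcf_two hF.
have M0 : (0 < M)%N by exact: leq_trans M2.
have := @cells_connected 1 _ id _ [tuple Ordinal M0] [tuple Ordinal M2].
move=> /(_ _)/(congr1 val) H; have {H} [] // : val [tuple Ordinal M0] = val [tuple Ordinal M2].
apply: H => w v x xw xv; apply: contrapT => wv; apply: nb.
have wv' : tval w <> tval v by move=> e; apply: wv; exact: val_inj.
have [|y [z [by_ _ _ _]]] := cells_meet _ wv' xw xv; first by rewrite !size_tuple.
by exists y.
Qed.

Lemma mdist_bounded (x0 : F) : exists D : R, forall x, mdist x0 x <= D.
Proof.
have cm : continuous (mdist x0 : F -> R).
  move=> x; apply/cvgrPdist_lt => e e0; apply/nbhs_ballP; exists e => //= y.
  rewrite ballEmdist/= => xy.
  rewrite ltr_norml; have := metric_triangle x0 x y; have := metric_triangle x0 y x.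
  rewrite (metric_sym y x) => h1 h2; apply/andP; split; lra.
have := compact_bounded (continuous_compact (continuous_subspaceT cm) (pcf_compact hF)).
move=> [D [_ /(_ (D + 1))]]; rewrite ltrDl ltr01 => /(_ isT) DP.
exists (D + 1) => x; apply: le_trans (ler_norm _) _.
by apply: DP; exists x.
Qed.

Lemma contraction_uniform : exists2 c : R, 0 <= c < 1 &
  forall w x y, mdist (wmap w x) (wmap w y) <= c ^+ size w * mdist x y.
Proof.
have /choice[c cP] : forall i, exists c : R, 0 <= c < 1 /\
    forall x y, mdist (psi i x) (psi i y) <= c * mdist x y.
  by move=> i; have [c c1 cP] := pcf_contraction hF i; exists c.
pose m := \big[Num.max/0]_(i < M) c i.
have mi i : c i <= m by exact: le_bigmax.
have m0 : 0 <= m by apply: bigmax_ge_id.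
have m1 : m < 1.
  apply/bigmax_ltP; split => // i _; by have [/andP[]] := cP i.
exists m; first by rewrite m0.
elim=> [|i w IH] x y /=; first by rewrite expr0 mul1r.
have [_ /(_ (wmap w x) (wmap w y)) h] := cP i.
apply: (le_trans h); rewrite exprS -mulrA ler_pM ?mdist_ge0//.
by have [/andP[]] := cP i.
Qed.

(** The cell of [mkseq s n] contains both points, and its size decays geometrically; the bound [D]
    on distances from [x0] plays the part of the diameter. *)
Lemma cell_shrink s x0 : wmap (mkseq s n) x0 @[n --> \oo] --> pi s.
Proof.
have [D DP] := mdist_bounded x0; have [c /andP[c0 c1] cP] := contraction_uniform.
have D0 : 0 <= D by exact: le_trans (mdist_ge0 _ _) (DP x0).
have c0' : c ^+ n * D @[n --> \oo] --> 0.
  rewrite -(mul0r D); apply: cvgM; last exact: cvg_cst.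
  by apply: cvg_expr; rewrite ger0_norm.
apply/cvg_ballP => e e0.
move/cvgr0Pnorm_lt : c0' => /(_ _ e0); apply: filterS => n.
rewrite ger0_norm ?mulr_ge0 ?exprn_ge0// => ne.
rewrite ballEmdist/= metric_sym (le_lt_trans _ ne)//.
have /cellP[y ->] := pi_cell s n.
rewrite (le_trans (cP _ _ _))// size_mkseq ler_wpM2l ?exprn_ge0//.
Qed.

(** * Energy of a harmonic structure *)

Variables (a : F -> F -> R) (r : 'I_M -> R).
Hypothesis har : regular_harmonic_structure psi pi a r.

Local Notation E0 := (energy0 psi pi a).
Local Notation En := (energy_at psi pi a r).

Lemma boundary_finite : finite_set bd.
Proof. by apply: finite_image; exact: (pcf_finite hF). Qed.

Lemma energy0_ge0 f : 0 <= E0 f.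
Proof.
rewrite /energy0 mulr_ge0//; apply: fsumr_ge0 => x bx; apply: fsumr_ge0 => y by_.
have [->|xy] := eqVneq x y; first by rewrite subrr expr0n mulr0.
by rewrite mulr_ge0 ?sqr_ge0// (hs_ge0 har).
Qed.

(** All terms are nonnegative, so each vanishes. If the level set of [f] through [x] were not the
    whole boundary, irreducibility would provide a nonzero coefficient between it and its
    complement. *)
Lemma energy0_eq0 f x y : E0 f = 0 -> bd x -> bd y -> f x = f y.
Proof.
move=> /eqP; rewrite mulf_eq0 invr_eq0 pnatr_eq0/= => /eqP f0 bx by_.
have t0 u v : bd u -> bd v -> 0 <= a u v * (f u - f v) ^+ 2.
  move=> bu bv; have [->|uv] := eqVneq u v; first by rewrite subrr expr0n mulr0.
  by rewrite mulr_ge0 ?sqr_ge0// (hs_ge0 har).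
have z u v : bd u -> bd v -> a u v * (f u - f v) ^+ 2 = 0.
  move=> bu bv.
  have := @pfsumr_eq0 _ _ bd (fun u => \sum_(v \in bd) a u v * (f u - f v) ^+ 2).
  move=> /(_ boundary_finite (fun u bu => fsumr_ge0 (fun v bv => t0 u v bu bv)) f0 u bu).
  by move=> /(pfsumr_eq0 boundary_finite (fun v bv => t0 u v bu bv)); apply.
pose S := [set u | bd u /\ f u = f x].
have [SE|SE] := pselect (S = bd).
  by have [_ ->] : S y by rewrite SE.
have [|||u [v [[bu fu] [bv nSv] auv]]] := hs_irreducible har (S := S).
- by move=> u [].
- by exists x.
- exact: SE.
exfalso; apply: nSv; split => //.
have /eqP := z u v bu bv; rewrite mulf_eq0 (negbTE auv)/= sqrf_eq0 subr_eq0.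
by move/eqP <-.
Qed.

Lemma weight_gt0 w : 0 < weight r w.
Proof. by apply: prodr_gt0 => i _; have /andP[] := hs_ratio har i. Qed.

Lemma energy_at_ge0 n f : 0 <= En n f.
Proof.
apply: sumr_ge0 => w _; rewrite mulr_ge0 ?energy0_ge0//.
by rewrite invr_ge0 ltW// weight_gt0.
Qed.

Lemma energy_at0 f : En 0 f = E0 f.
Proof.
rewrite /energy_at (big_pred1 [tuple]) => [|w]; last by apply/esym/eqP; exact: tuple0.
by rewrite /weight big_nil invr1 mul1r.
Qed.

Lemma energy_atS n f : En n.+1 f = \sum_(i < M) (r i)^-1 * En n (f \o psi i).
Proof.
rewrite /energy_at.
under [RHS]eq_bigr do rewrite mulr_sumr.
rewrite pair_big/= (reindex (fun p : 'I_M * n.-tuple 'I_M => [tuple of p.1 :: p.2])); last first.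
  exists (fun t : n.+1.-tuple 'I_M => (thead t, [tuple of behead t])).
    by move=> [i t] _ /=; congr (_, _); apply/val_inj.
  by move=> t _ /=; rewrite -tuple_eta.
apply: eq_bigr => -[i w] _ /=.
by rewrite /weight big_cons invfM -mulrA.
Qed.

(** The passage from level 0 to level 1 is the minimum property of the harmonic structure; splitting
    off the first letter carries it to all levels. *)
Lemma energy_at_nondecreasing f : nondecreasing_seq (En ^~ f).
Proof.
apply/nondecreasing_seqP => n; elim: n f => [|n IH] f.
  rewrite energy_at0; have [_] := hs_min har f; exact.
rewrite (energy_atS n) (energy_atS n.+1); apply: ler_sum => i _.
rewrite ler_wpM2l//; have /andP[r0 _] := hs_ratio har i.
by rewrite invr_ge0 ltW.
Qed.

Lemma energy_at_le f n : form_domain psi pi a r f -> En n f <= energy psi pi a r f.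
Proof.
move=> [_ ub]; apply: nondecreasing_cvgn_le; first exact: energy_at_nondecreasing.
by apply: nondecreasing_is_cvgn => //; exact: energy_at_nondecreasing.
Qed.

(** Every level energy vanishes, so [f] is constant on the vertices of each cell, and cells that
    meet do so at a common vertex. At each level the images of one boundary point [x0] thus carry a
    single value, and along a code they converge to any given point. *)
Lemma energy_eq0_cst f : form_domain psi pi a r f -> energy psi pi a r f = 0 ->
  forall x y, f x = f y.
Proof.
move=> df e0; have [cf _] := df.
have z n : En n f = 0.
  by apply/eqP; rewrite eq_le energy_at_ge0 andbT -e0 energy_at_le.
have [x0 bx0] := boundary_nonempty.
have lev n (w v : n.-tuple 'I_M) : f (wmap w x0) = f (wmap v x0).
  apply: (@cells_connected n _ (fun w => f (wmap (tval w) x0))) => {w v} w v x xw xv.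
  have cw (u : n.-tuple 'I_M) y : bd y -> f (wmap u y) = f (wmap u x0).
    move=> by_; apply: (@energy0_eq0 (f \o wmap u)) => //.
    have := psumr_eq0P _ (z n); move=> /(_ _ u isT) H.
    have /eqP : (weight r u)^-1 * E0 (f \o wmap u) = 0.
      apply: H => v' _; rewrite mulr_ge0 ?energy0_ge0//.
      by rewrite invr_ge0 ltW// weight_gt0.
    by rewrite mulf_eq0 invr_eq0 gt_eqF ?weight_gt0//= => /eqP.
  have [->//|wv] := eqVneq w v.
  have wv' : tval w <> tval v.
    by move=> e; move/eqP : wv; apply; exact: val_inj.
  have [|y [y' [by_ by' xy xy']]] := cells_meet _ wv' xw xv; first by rewrite !size_tuple.
  by rewrite -(cw w y)// -(cw v y')// -xy -xy'.
move=> x y; have [s <-] := pi_surj x; have [t <-] := pi_surj y.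
have c1 : f (wmap (mkseq s n) x0) @[n --> \oo] --> f (pi s).
  by apply: continuous_cvg; [exact: cf|exact: cell_shrink].
have c2 : f (wmap (mkseq t n) x0) @[n --> \oo] --> f (pi t).
  by apply: continuous_cvg; [exact: cf|exact: cell_shrink].
have e n : f (wmap (mkseq s n) x0) = f (wmap (mkseq t n) x0).
  have ss : size (mkseq s n) == n by rewrite size_mkseq.
  have st : size (mkseq t n) == n by rewrite size_mkseq.
  exact: (lev n (Tuple ss) (Tuple st)).
rewrite (eq_cvg _ _ e) in c1.
exact: (cvg_unique (@Rhausdorff R) c1 c2).
Qed.

Lemma energy_at_shift n f c : En n (fun x => f x + c) = En n f.
Proof.
apply: eq_bigr => w _; congr (_ * (_ * _)).
apply: eq_fsbigr => x _; apply: eq_fsbigr => y _ /=.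
by congr (_ * _ ^+ 2); ring.
Qed.

Lemma energy_at_scale n f c : En n (fun x => c * f x) = c ^+ 2 * En n f.
Proof.
rewrite /energy_at mulr_sumr; apply: eq_bigr => w _.
rewrite [RHS]mulrCA; congr (_ * _).
rewrite /energy0 [RHS]mulrCA; congr (_ * _).
rewrite mulr_fsumr; apply: eq_fsbigr => x _.
rewrite mulr_fsumr; apply: eq_fsbigr => y _ /=.
by ring.
Qed.

Lemma energy_scale f c : form_domain psi pi a r f ->
  energy psi pi a r (fun x => c * f x) = c ^+ 2 * energy psi pi a r f.
Proof.
move=> [_ ub]; rewrite /energy.
under eq_fun do rewrite energy_at_scale.
have cE : cvgn (En ^~ f).
  by apply: nondecreasing_is_cvgn => //; exact: energy_at_nondecreasing.
by apply: cvg_lim => //; apply: cvgM => //; exact: cvg_cst.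
Qed.

Lemma form_diag f : form_domain psi pi a r f ->
  Defs.form psi pi a r f f = energy psi pi a r f.
Proof.
move=> df; rewrite /Defs.form.
have -> : f \+ f = (fun x => 2 * f x) by apply/funext => x /=; ring.
have -> : f \- f = (fun x => 0 * f x) by apply/funext => x /=; ring.
by rewrite !energy_scale//; field.
Qed.

(** Energies ignore additive constants, so the two terms of the polarisation agree. *)
Lemma form_cst f : Defs.form psi pi a r f (fun=> 1) = 0.
Proof.
rewrite /Defs.form; suff -> : energy psi pi a r (f \+ (fun=> 1)) = energy psi pi a r (f \- (fun=> 1)).
  by rewrite subrr mulr0.
by rewrite /energy; congr (limn _); apply/funext => n; rewrite /= !energy_at_shift.
Qed.

Lemma form_domain_cst : form_domain psi pi a r (fun=> 1).
Proof.
split; first by move=> x; exact: cvg_cst.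
exists 0 => _ [n _ <-].
have -> : (fun=> 1) = (fun x : F => 0 * 1 + 1 : R) by apply/funext => x; ring.
by rewrite energy_at_shift (energy_at_scale n (fun=> 1)) expr0n mul0r.
Qed.

Lemma measurable_continuous (E : ptopologicalType) (g : E -> R) : continuous g ->
  measurable_fun [set: Borel E] (g : Borel E -> R).
Proof.
move=> cg; apply: (measurability (@RGenOpens.G R)).
  exact: RGenOpens.measurableE.
move=> _ [A oA <-]; rewrite setTI; apply: sub_sigma_algebra.
by move/continuousP : cg; apply; case: oA => x [y ->]; exact: interval_open.
Qed.

(** * Eigenfunctions of eigenvalue zero *)

Variable mu : probability (Borel F) R.
Variables (b : set F) (phi : nat -> L2 mu) (lambda : nat -> R).
Hypothesis hphi : eigenbasis psi pi a r b phi lambda.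

Lemma lambda_ge0 k : 0 <= lambda k.
Proof.
apply: le_trans (eb_ge0 hphi) _; by apply: (eb_nondecreasing hphi).
Qed.

(** The weak eigenvalue equation: the signs in the generator and in its image cancel. The continuous
    representative [ft] is kept because it is itself an admissible test function. *)
Lemma eigen_form k : exists2 ft : F -> R,
  form_domain_bc psi pi a r b ft /\ ft = phi k %[ae mu] &
  forall g, form_domain_bc psi pi a r b g ->
    Defs.form psi pi a r ft g = lambda k * dot mu (phi k) g.
Proof.
have [ft [dft ftk] H] := eb_eigen hphi k; exists ft => // g dg.
have mg := measurable_continuous dg.1.1.
rewrite H//.
have -> : dot mu (- (lambda k *: phi k)) g = dot mu (fun x => - lambda k * phi k x) g.
  apply: ae_dot => //.
  - exact: L2_measurable.
  - by apply: measurable_funM => //; exact: L2_measurable.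
  - have e1 := L2_repK (- L2_rep (lambda k *: phi k)).
    have e2 := L2_scaleE (lambda k) (phi k).
    by apply: filterS2 e1 e2 => x /= e1 e2 Dx; rewrite e1// !fctE e2// mulNr.
have bg : sqint mu g.
  have := compact_bounded (continuous_compact (continuous_subspaceT dg.1.1) (pcf_compact hF)).
  move=> [D [_ /(_ (D + 1))]]; rewrite ltrDl ltr01 => /(_ isT) DP.
  have gD x : `|g x| <= D + 1 by apply: DP; exists x.
  split=> //; apply: (@bounded_integrable _ _ _ mu (fun x => g x ^+ 2) ((D + 1) ^+ 2)).
    exact: measurable_funX.
  by move=> x; rewrite normrX ler_pXn2r// nnegrE (le_trans _ (gD x)).
by rewrite dotZl ?mulNr ?opprK.
Qed.

Lemma dot_ae_cst (f g : L2 mu) (c c' : R) : f = cst c %[ae mu] -> g = cst c' %[ae mu] ->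
  dot mu f g = c * c'.
Proof.
move=> fc gc'.
rewrite (@ae_dot _ _ _ mu f (cst c) g)//; try exact: L2_measurable.
rewrite dotC (@ae_dot _ _ _ mu g (cst c') (cst c))//; try exact: L2_measurable.
by rewrite /dot /= Rintegral_prob_cst mulrC.
Qed.

(** Testing the eigenvalue equation with the eigenfunction itself gives zero energy. *)
Lemma lambda_eq0_cst k : lambda k = 0 -> exists c : R,
  form_domain_bc psi pi a r b (cst c) /\ phi k = cst c %[ae mu].
Proof.
move=> lk0; have [ft [dft ftk] H] := eigen_form k.
have := H ft dft; rewrite lk0 mul0r form_diag; last exact: dft.1.
move=> /(energy_eq0_cst dft.1) ftc.
have e : ft = cst (ft point) by apply/funext => x; exact: ftc.
exists (ft point); rewrite -e; split => //.
exact: ae_eq_sym.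
Qed.

(** A constant eigenfunction would vanish at a boundary point outside [b], hence everywhere, against
    its unit norm. *)
Lemma lambda_gt0_dirichlet k : b `<=` bd -> b <> bd -> 0 < lambda k.
Proof.
move=> bbd nb; rewrite lt_neqAle lambda_ge0 andbT eq_sym; apply/eqP => lk0.
have [c [[_ dc] pc]] := lambda_eq0_cst lk0.
have [x [bx nbx]] : exists x, bd x /\ ~ b x.
  apply: contrapT => /forallNP h; apply: nb; apply/seteqP; split => // x bx.
  by apply: contrapT => nbx; apply: (h x).
have c0 : c = 0 by apply: (dc x); rewrite inE.
have := eb_orthonormal hphi k k; rewrite eqxx (dot_ae_cst pc pc) c0 mul0r => /eqP.
by rewrite eq_sym oner_eq0.
Qed.

(** Testing with the constant 1 gives [lambda k * dot mu (phi k) one = 0]. Were [lambda 0] positive,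
    so would be all eigenvalues, and 1 would have no nonzero coordinate; were [lambda 1] zero, two
    constants would be orthonormal. *)
Lemma lambda_neumann : b = bd -> lambda 0%N = 0 /\ 0 < lambda 1%N.
Proof.
move=> bbd; have d1 : form_domain_bc psi pi a r b (fun=> 1).
  split; first exact: form_domain_cst.
  by move=> x; rewrite inE bbd => -[].
have o1 : sqint mu (fun=> 1 : R) by exact: sqint_cst.
pose one : L2 mu := L2_class (Lfun_Sub (lee1n 2) (sqint_Lfun o1)).
have oneE : one = cst 1 %[ae mu] by exact: L2_repK.
have dot1 k : lambda k * dot mu (phi k) one = 0.
  have [ft [dft ftk] /(_ _ d1)] := eigen_form k; rewrite form_cst => e.
  rewrite dotC (@ae_dot _ _ _ mu one (cst 1) (phi k))//; try exact: L2_measurable.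
  by rewrite dotC -e.
split.
  apply/eqP; apply: contraT => l0.
  have lk k : lambda k != 0.
    rewrite gt_eqF// (@lt_le_trans _ _ (lambda 0%N))//.
      by rewrite lt_neqAle eq_sym l0 lambda_ge0.
    by apply: (eb_nondecreasing hphi).
  have one0 : one = 0.
    apply: (L2_coord_ext (eb_complete hphi)) => k; rewrite dotL20 dotC.
    by have /eqP := dot1 k; rewrite mulf_eq0 (negbTE (lk k))/= => /eqP.
  have := dot_ae_cst oneE oneE; rewrite one0 dotL20 mulr1 => /eqP.
  by rewrite eq_sym oner_eq0.
rewrite lt_neqAle lambda_ge0 andbT eq_sym; apply/eqP => l1.
have l0 : lambda 0%N = 0.
  apply/eqP; rewrite eq_le lambda_ge0 andbT -l1.
  by apply: (eb_nondecreasing hphi).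
have [c [_ pc]] := lambda_eq0_cst l0; have [c' [_ pc']] := lambda_eq0_cst l1.
have := eb_orthonormal hphi 0%N 1%N; rewrite (dot_ae_cst pc pc') /= => /eqP.
have := eb_orthonormal hphi 0%N 0%N; rewrite (dot_ae_cst pc pc) /= => e.
have := eb_orthonormal hphi 1%N 1%N; rewrite (dot_ae_cst pc' pc') /= => e'.
rewrite mulf_eq0 => /orP[/eqP c0|/eqP c0].
  by move: e; rewrite c0 mul0r => /eqP; rewrite eq_sym oner_eq0.
by move: e'; rewrite c0 mul0r => /eqP; rewrite eq_sym oner_eq0.
Qed.

End Fractal.

(** * The harmonic oscillator *)

Section Oscillator.
Context (R : realType).
Local Notation leb := (@lebesgue_measure R).
Implicit Types (l t : R) (v : R -> R).

Definition osc l t : R := if l == 0 then t else sin (Num.sqrt l * t) / Num.sqrt l.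

Definition osc' l t : R := if l == 0 then 1 else cos (Num.sqrt l * t).

Lemma is_derive_osc l t : 0 <= l -> is_derive t 1 (osc l) (osc' l t).
Proof.
move=> l0; rewrite /osc /osc'; have [_|ln0] := eqVneq l 0.
  exact: is_derive_id.
have s0 : Num.sqrt l != 0 by rewrite gt_eqF// sqrtr_gt0 lt_neqAle eq_sym ln0.
by apply: is_derive_eq; rewrite /GRing.scale/=; field.
Qed.

Lemma is_derive_osc' l t : 0 <= l -> is_derive t 1 (osc' l) (- (l * osc l t)).
Proof.
move=> l0; rewrite /osc /osc'; have [->|ln0] := eqVneq l 0.
  by apply: is_derive_eq; rewrite mul0r oppr0.
have s0 : Num.sqrt l != 0 by rewrite gt_eqF// sqrtr_gt0 lt_neqAle eq_sym ln0.
apply: is_derive_eq; rewrite /GRing.scale/= -{3}(sqr_sqrtr l0).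
by field.
Qed.

Lemma continuous_osc l : 0 <= l -> continuous (osc l).
Proof.
move=> l0 t; apply: differentiable_continuous; apply/derivable1_diffP.
by have [] := is_derive_osc t l0.
Qed.

(* The energy [(v' - osc')^2 + l (v - osc)^2] is conserved and starts at 0. *)
Lemma oscillator_unique l v : 0 <= l -> damped_oscillator 0 l v ->
  forall t, 0 <= t -> v t = osc l t.
Proof.
move=> l0 [v' [[v0 v'0] cv cv' dv dv']].
pose D t := v t - osc l t; pose D' t := v' t - osc' l t.
have dD t : 0 < t -> is_derive t 1 D (D' t).
  move=> t0; have d1 := dv t t0; have d2 := is_derive_osc t l0.
  exact: is_deriveB.
have dD' t : 0 < t -> is_derive t 1 D' (- (l * D t)).
  move=> t0; have d1 := dv' t t0; have d2 := is_derive_osc' t l0.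
  by apply: is_derive_eq; rewrite /D; ring.
have sub t : `[0, t]%classic `<=` `[(0 : R), +oo[%classic.
  by move=> x /=; rewrite !in_itv/= => /andP[->].
have co : continuous (osc l) by exact: continuous_osc.
have co' : continuous (osc' l).
  move=> t; apply: differentiable_continuous; apply/derivable1_diffP.
  by have [] := is_derive_osc' t l0.
have cD t : {within `[0, t], continuous D}.
  have c1 := continuous_subspaceW (sub t) cv.
  have c2 := @continuous_subspaceT _ _ `[0, t]%classic _ co.
  by move=> x; apply: cvgB; [exact: c1|exact: c2].
have cD' t : {within `[0, t], continuous D'}.
  have c1 := continuous_subspaceW (sub t) cv'.
  have c2 := @continuous_subspaceT _ _ `[0, t]%classic _ co'.
  by move=> x; apply: cvgB; [exact: c1|exact: c2].
have D0 : D 0 = 0.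
  rewrite /D v0 /osc; case: ifP => _; first by rewrite subrr.
  by rewrite mulr0 sin0 mul0r subrr.
have D'0 : D' 0 = 0.
  by rewrite /D' v'0 /osc'; case: ifP => _; rewrite ?mulr0 ?cos0 subrr.
pose E t := D' t * D' t + l * (D t * D t).
have E0 t : 0 <= t -> E t = 0.
  rewrite le_eqVlt => /predU1P[<-|t0].
    by rewrite /E D0 D'0 !mulr0 addr0.
  have dE x : x \in `]0, t[ -> is_derive x 1 E (cst 0 x).
    rewrite in_itv/= => /andP[x0 xt]; have d1 := dD x x0; have d2 := dD' x x0.
    by apply: is_derive_eq; rewrite /GRing.scale/=; ring.
  have cE : {within `[0, t], continuous E}.
    move=> x; apply: cvgD; first by apply: cvgM; exact: cD'.
    by apply: cvgM; [exact: cvg_cst|apply: cvgM; exact: cD].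
  have [c _] := MVT t0 dE cE.
  by rewrite mul0r => /eqP; rewrite subr_eq0 => /eqP ->; rewrite /E D0 D'0 !mulr0 addr0.
have D'z t : 0 <= t -> D' t = 0.
  move=> /E0 /eqP; rewrite /E -!expr2 paddr_eq0 ?sqr_ge0 ?(mulr_ge0 l0 (sqr_ge0 _))//.
  by rewrite sqrf_eq0 => /andP[/eqP].
move=> t; rewrite le_eqVlt => /predU1P[<-|t0].
  by move: D0 => /eqP; rewrite subr_eq0 => /eqP.
have dDt x : x \in `]0, t[ -> is_derive x 1 D (D' x).
  by rewrite in_itv/= => /andP[x0 xt]; exact: dD.
have [c] := MVT t0 dDt (cD t).
rewrite in_itv/= => /andP[c0 _]; rewrite (D'z _ (ltW c0)) mul0r D0 subr0.
by move/eqP; rewrite subr_eq0 => /eqP.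
Qed.

Definition osc_var l t : R :=
  if l == 0 then t ^+ 3 / 3
  else t / (2 * l) - sin (2 * (Num.sqrt l * t)) / (4 * (l * Num.sqrt l)).

Lemma integral_osc_sq l t : 0 <= l -> 0 < t ->
  (\int[leb]_(s in `[0%R, t]) ((osc l (t - s)) ^+ 2)%:E = (osc_var l t)%:E)%E.
Proof.
move=> l0 t0.
(* Antiderivative in [s] of [osc l (t - s) ^+ 2], from sin^2 y = (1 - cos 2y) / 2. *)
pose G s := if l == 0 then - (t - s) ^+ 3 / 3 else
  s / (2 * l) + sin (2 * (Num.sqrt l * (t - s))) / (4 * (l * Num.sqrt l)).
have dG (s : R) : is_derive s 1 G ((osc l (t - s)) ^+ 2).
  rewrite /G /osc; have [_|ln0] := eqVneq l 0.
    by apply: is_derive_eq; rewrite /GRing.scale/=; field.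
  have s0 : Num.sqrt l != 0 by rewrite gt_eqF// sqrtr_gt0 lt_neqAle eq_sym ln0.
  apply: is_derive_eq; rewrite /GRing.scale/=.
  set y := Num.sqrt l * (t - s).
  have -> : 2 * y = y + y by ring.
  rewrite cosD -!expr2 cos2sin2 expr_div_n (sqr_sqrtr l0).
  by field; rewrite ln0 s0.
rewrite (@continuous_FTC2 _ (fun s => (osc l (t - s)) ^+ 2) G) //.
- rewrite -EFinB; congr EFin; rewrite /G /osc_var; case: ifP => _.
    by rewrite subrr subr0; ring.
  rewrite subrr subr0 !mulr0 sin0 mul0r; ring.
- apply: continuous_subspaceT => s.
  have c : (osc l (t - x)) @[x --> s] --> osc l (t - s).
    apply: continuous_cvg; first exact: continuous_osc.
    by apply: cvgB; [exact: cvg_cst|exact: cvg_id].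
  apply: (@continuous_comp _ _ _ (fun s => osc l (t - s)) (fun x => x ^+ 2)); first exact: c.
  exact: exprn_continuous.
- have cG x : {for x, continuous G}.
    by apply: differentiable_continuous; apply/derivable1_diffP; have [] := dG x.
  split; first by move=> x _; have [] := dG x.
    exact: cvg_at_right_filter (cG _).
  exact: cvg_at_left_filter (cG _).
- by move=> x _; rewrite derive1E; have [_ ->] := dG x.
Qed.

(** The difference is the sine term alone. Relative to 1/l the error depends only on sqrt l t, which
    makes it uniform over a spectrum bounded away from 0. *)
Lemma osc_var_dist l t : 0 < l -> 0 < t ->
  `|osc_var l t / t - (2 * l)^-1| <= (4 * l)^-1 * (Num.sqrt l * t)^-1.
Proof.
move=> l0 t0; rewrite /osc_var gt_eqF//.
have s0 : 0 < Num.sqrt l by rewrite sqrtr_gt0.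
set S := sin _.
rewrite (_ : _ - _ = - (S * ((4 * l)^-1 * (Num.sqrt l * t)^-1))); last first.
  by field; rewrite !gt_eqF.
have y0 : 0 <= (4 * l)^-1 * (Num.sqrt l * t)^-1.
  by rewrite mulr_ge0// invr_ge0 mulr_ge0// ltW.
rewrite normrN normrM (ger0_norm y0) ler_piMl//.
by rewrite ler_norml sin_geN1 sin_le1.
Qed.

End Oscillator.

(** * Gaussian spaces *)

Section CharacteristicFunction.
Context d (Omega : measurableType d) (R : realType) (P : probability Omega R).
Implicit Types X Z : Omega -> R.

Lemma cos_lipschitz (a b : R) : `|cos a - cos b| <= `|a - b|.
Proof.
wlog ab : a b / a <= b.
  move=> H; have [/H//|/ltW/H] := leP a b.
  by rewrite distrC [in X in _ <= X]distrC.
move: ab; rewrite le_eqVlt => /predU1P[->|ab]; first by rewrite !subrr.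
have dc (x : R) : x \in `]a, b[ -> is_derive x 1 cos (- sin x) by move=> _; exact: is_derive_cos.
have [c _ e] := MVT ab dc (continuous_subspaceT (@continuous_cos R)).
rewrite distrC e normrM normrN [leRHS]distrC ler_piMl//.
by rewrite ler_norml sin_geN1 sin_le1.
Qed.

(** The phase lets a real cosine carry the whole characteristic function: phase 0 gives its real
    part, phase - pi/2 its imaginary part. Null variables are included, with variance 0. *)
Definition gaussian_char X : Prop := forall c theta,
  \int[P]_w cos (c * X w + theta) =
  expR (- (c ^+ 2 * dot P X X / 2)) * cos theta.

Lemma centred_gaussian_char X : measurable_fun setT X -> centred_gaussian P X ->
  sqint P X /\ gaussian_char X.
Proof.
move=> mX [s s0 law]; have [s00|sn0] := eqVneq s 0.
  have X0 : X = cst 0 %[ae P].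
    have m0 : measurable (X @^-1` [set 0]).
      by rewrite -[X in measurable X]setTI; exact: mX.
    exists (~` (X @^-1` [set 0])); split; first exact: measurableC.
      rewrite probability_setC// law ?measurable_set1// s00 eqxx diracE.
      by rewrite mem_set// subee.
    by move=> w /= h e; apply: h => _.
  have sX : sqint P X.
    apply: ae_sqint (sqint_cst P 0) => //.
    exact: ae_eq_sym.
  split=> // c theta.
  have XX : dot P X X = 0.
    by rewrite (@ae_dot _ _ _ P X (cst 0) X)// dot0l.
  rewrite XX mulr0 mul0r oppr0 expR0 mul1r.
  rewrite -[RHS](@Rintegral_prob_cst _ _ _ P).
  rewrite /Rintegral; congr fine; apply: ae_eq_integral => //.
  - apply/measurable_EFinP.
    have [] // := @bmeas_cos _ _ R (fun w => c * X w + theta).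
    by apply: measurable_funD => //; exact: measurable_funM.
  - by apply: filterS X0 => w /= e _; rewrite e// mulr0 add0r.
have lawE (A : set R) : measurable A -> pushforward P X A = normal_prob 0 s A.
  by move=> mA; rewrite /pushforward law// (negbTE sn0).
have s2 : (\int[P]_w ((X w) ^+ 2)%:E = (s ^+ 2)%:E)%E.
  rewrite -(normal_second_moment 0 sn0).
  rewrite [RHS](eq_measure_integral (pushforward P (X : Omega -> measurableTypeR R))); last first.
    by move=> A mA _; exact/esym/lawE.
  rewrite ge0_integral_pushforward//.
  - by apply: eq_integral => w _ /=; rewrite subr0.
  - apply/measurable_EFinP; apply: measurable_funX; exact: measurable_funB.
  - by move=> x _; rewrite lee_fin sqr_ge0.
have sX : sqint P X by apply: sqint_lty => //; rewrite s2 ltry.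
split=> // c theta.
have -> : dot P X X = s ^+ 2 by apply: EFin_inj; rewrite -dot_EFin.
rewrite -(normal_cos c theta sn0) /Rintegral; congr fine.
rewrite [RHS](eq_measure_integral (pushforward P (X : Omega -> measurableTypeR R))); last first.
  by move=> A mA _; exact/esym/lawE.
have bc : bmeas (fun x : measurableTypeR R => cos (c * x + theta)).
  by apply: bmeas_cos; apply: measurable_funD => //; exact: measurable_funM.
rewrite integral_pushforward//.
- by apply/measurable_EFinP; exact: bc.1.
- apply: (bmeas_integrable P (G := fun w => cos (c * X w + theta))).
  by apply: bmeas_cos; apply: measurable_funD => //; exact: measurable_funM.
Qed.

(** The cosine is 1-Lipschitz, so mean-square convergence carries the left-hand sides to the limit;
    [cvg_dot] carries the variances. *)
Lemma gaussian_char_lim X (Z : nat -> Omega -> R) : sqint P X ->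
  (forall n, sqint P (Z n)) -> (forall n, gaussian_char (Z n)) ->
  dot P (X \- Z n) (X \- Z n) @[n --> \oo] --> 0 -> gaussian_char X.
Proof.
move=> sX sZ gZ XZ c theta.
have bc Y : sqint P Y -> bmeas (fun w => cos (c * Y w + theta)).
  move=> [mY _]; apply: bmeas_cos; apply: measurable_funD => //.
  exact: measurable_funM.
have c1 : \int[P]_w cos (c * Z n w + theta) @[n --> \oo] -->
    \int[P]_w cos (c * X w + theta).
  apply/cvgrPdist_le => e e0.
  have XZ' : c ^+ 2 * dot P (X \- Z n) (X \- Z n) @[n --> \oo] --> 0.
    rewrite -[X in _ --> X](mulr0 (c ^+ 2)); apply: cvgM => //; exact: cvg_cst.
  have e20 : 0 < e ^+ 2 by rewrite exprn_gt0.
  move/cvgr0Pnorm_le : XZ' => /(_ _ e20); apply: filterS => n.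
  rewrite ger0_norm ?(mulr_ge0 (sqr_ge0 _) (dot_ge0 _ _))// => h.
  have iX := bmeas_integrable P (bc _ sX); have iZ := bmeas_integrable P (bc _ (sZ n)).
  have sXZ := sqintB sX (sZ n).
  rewrite -RintegralB//.
  have iD : P.-integrable setT (EFin \o (fun w => cos (c * X w + theta) - cos (c * Z n w + theta))).
    by have := integrableB measurableT iX iZ; apply: eq_integrable.
  apply: le_trans (le_normr_Rintegral measurableT iD) _.
  have iXZ : P.-integrable setT (EFin \o (fun w => `|X w - Z n w|)).
    by apply: integrable_norm; apply: (sqint_integrable sXZ).
  apply: (@le_trans _ _ (`|c| * \int[P]_w `|X w - Z n w|)).
    rewrite -RintegralZl//; apply: le_Rintegral => //.
    - exact: integrable_norm.
    - by have := integrableZl measurableT `|c| iXZ; apply: eq_integrable.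
    - move=> w _; apply: le_trans (cos_lipschitz _ _) _.
      by rewrite -normrM le_eqVlt; apply/orP; left; apply/eqP; congr `| _ |; ring.
  have I0 : 0 <= \int[P]_w `|X w - Z n w| by exact: Rintegral_ge0.
  rewrite -(@ler_pXn2r _ 2)// ?nnegrE ?mulr_ge0// ?(ltW e0)//.
  rewrite exprMn real_normK ?num_real// (le_trans _ h)// ler_wpM2l ?sqr_ge0//.
  exact: (Rintegral_norm_sq sXZ).
have c2 : expR (- (c ^+ 2 * dot P (Z n) (Z n) / 2)) * cos theta @[n --> \oo] -->
    expR (- (c ^+ 2 * dot P X X / 2)) * cos theta.
  apply: cvgM; last exact: cvg_cst.
  apply: continuous_cvg; first exact: continuous_expR.
  apply: cvgN; apply: cvgM; last exact: cvg_cst.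
  apply: cvgM; first exact: cvg_cst.
  exact: cvg_dot.
rewrite (eq_cvg _ _ (fun n => gZ n c theta)) in c1.
exact: (cvg_unique (@Rhausdorff R) c1 c2).
Qed.

End CharacteristicFunction.

(** * The Gaussian space of a cylindrical Wiener process *)

Section GaussianSpace.
Context d (Omega : measurableType d) (R : realType) (P : probability Omega R).
Context d' (T : measurableType d') (mu : {measure set T -> \bar R}).
Variable W : R -> L2 mu -> {RV P >-> R}.
Hypothesis hW : cylindrical_wiener W.
Implicit Types (A : set (L2 mu)) (s : seq (R * (R * L2 mu))) (X : Omega -> R).

(** A list of triples (c, (t, f)) codes a finite linear combination of values of the noise. *)
Definition wsum s (w : Omega) : R := \sum_(p <- s) p.1 * W p.2.1 p.2.2 w.

Definition wsupp A s : Prop := {in s, forall p, 0 <= p.2.1 /\ A p.2.2}.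

Lemma W_sqint t f : 0 <= t -> sqint P (W t f).
Proof.
move=> t0; apply: sqint_lty; first exact: measurable_funPT.
have := cw_covariance hW f f t0 t0; rewrite unlock => h.
rewrite (_ : (\int[P]_x _)%E = (\int[P]_w (W t f w * W t f w)%:E)%E) ?h ?ltry//.
Qed.

Lemma dot_W (s t : R) f g : 0 <= s -> 0 <= t ->
  dot P (W s f) (W t g) = Num.min s t * dot mu f g.
Proof.
move=> s0 t0; have := cw_covariance hW f g s0 t0; rewrite unlock => h.
by rewrite /dot /Rintegral h.
Qed.

Lemma wsum_tnth s w : wsum s w = \sum_(i < size s)
  (tnth (in_tuple s) i).1 * W (tnth (in_tuple s) i).2.1 (tnth (in_tuple s) i).2.2 w.
Proof. by rewrite /wsum [LHS]big_tnth. Qed.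

Lemma wsupp_tnth A s i : wsupp A s ->
  0 <= (tnth (in_tuple s) i).2.1 /\ A (tnth (in_tuple s) i).2.2.
Proof. by move=> /(_ (tnth (in_tuple s) i)); apply; exact: mem_tnth. Qed.

Lemma wsum_sqint A s : wsupp A s -> sqint P (wsum s).
Proof.
move=> As; rewrite (_ : wsum s = (fun w => \sum_(i < size s) (tnth (in_tuple s) i).1 *
  W (tnth (in_tuple s) i).2.1 (tnth (in_tuple s) i).2.2 w)); last first.
  by apply/funext => w; exact: wsum_tnth.
apply: sqint_sum => i; apply: sqintZ; apply: W_sqint.
by have [] := wsupp_tnth i As.
Qed.

Lemma wsum_gaussian A s : wsupp A s -> gaussian_char P (wsum s).
Proof.
move=> As; have [ms _] := wsum_sqint As.
suff /(centred_gaussian_char ms)[] : centred_gaussian P (wsum s) by [].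
have := cw_gaussian hW (fun i => (tnth (in_tuple s) i).1)
   (fun i => (tnth (in_tuple s) i).2.2) (t := fun i => (tnth (in_tuple s) i).2.1)
   (fun i => (wsupp_tnth i As).1).
rewrite (_ : (fun w => _) = wsum s)//.
by apply/funext => w; rewrite wsum_tnth.
Qed.

(** The covariance of two values of the noise is the minimum of the times multiplied by the inner
    product in L2, so orthogonal directions are uncorrelated at all times. *)
Lemma wsum_orth A A' s s' : (forall f g, A f -> A' g -> dot mu f g = 0) ->
  wsupp A s -> wsupp A' s' -> dot P (wsum s) (wsum s') = 0.
Proof.
move=> AA' As As'.
rewrite (_ : wsum s = (fun w => \sum_(i < size s) (tnth (in_tuple s) i).1 *
  W (tnth (in_tuple s) i).2.1 (tnth (in_tuple s) i).2.2 w)); last first.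
  by apply/funext => w; exact: wsum_tnth.
have sW i : sqint P (W (tnth (in_tuple s) i).2.1 (tnth (in_tuple s) i).2.2).
  by apply: W_sqint; have [] := wsupp_tnth i As.
have sW' i : sqint P (W (tnth (in_tuple s') i).2.1 (tnth (in_tuple s') i).2.2).
  by apply: W_sqint; have [] := wsupp_tnth i As'.
rewrite dot_suml; last exact: wsum_sqint As'.
  rewrite big1// => i _; rewrite dotZl//; last exact: wsum_sqint As'.
  rewrite (_ : wsum s' = (fun w => \sum_(i < size s') (tnth (in_tuple s') i).1 *
    W (tnth (in_tuple s') i).2.1 (tnth (in_tuple s') i).2.2 w)); last first.
    by apply/funext => w; exact: wsum_tnth.
  rewrite dot_sumr//; last by move=> j; exact: sqintZ.
  rewrite big1 ?mulr0// => j _; rewrite dotZr//.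
  have [t0 f0] := wsupp_tnth i As; have [t0' f0'] := wsupp_tnth j As'.
  by rewrite dot_W// AA'// !mulr0.
by move=> i; exact: sqintZ.
Qed.

(** The mean-square closure of the span of the noise in the directions of [A], as a set of functions
    rather than of classes. *)
Definition gspace A X : Prop := sqint P X /\
  exists s : nat -> seq (R * (R * L2 mu)), (forall n, wsupp A (s n)) /\
    dot P (X \- wsum (s n)) (X \- wsum (s n)) @[n --> \oo] --> 0.

Lemma gspaceS A A' X : A `<=` A' -> gspace A X -> gspace A' X.
Proof.
move=> AA' [sX [s [As c]]]; split=> //; exists s; split=> // n p ps.
by have [p0 Ap] := As n p ps; split=> //; exact: AA'.
Qed.

Lemma gspace_gaussian A X : gspace A X -> gaussian_char P X.
Proof.
move=> [sX [s [As c]]]; apply: gaussian_char_lim c => //.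
- by move=> n; exact: wsum_sqint (As n).
- by move=> n; exact: wsum_gaussian (As n).
Qed.

Lemma gspace_orth A A' X X' : (forall f g, A f -> A' g -> dot mu f g = 0) ->
  gspace A X -> gspace A' X' -> dot P X X' = 0.
Proof.
move=> AA' [sX [s [As c]]] [sX' [s' [As' c']]].
have ss n : sqint P (wsum (s n)) by exact: wsum_sqint (As n).
have ss' n : sqint P (wsum (s' n)) by exact: wsum_sqint (As' n).
have := cvg_dot ss ss' sX sX' c c'.
under eq_fun do rewrite (wsum_orth AA' (As _) (As' _)).
by move=> h; apply: (cvg_unique (@Rhausdorff R) h); exact: cvg_cst.
Qed.

Lemma gspace_W A t f : 0 <= t -> A f -> gspace A (W t f).
Proof.
move=> t0 Af; split; first exact: W_sqint.
exists (fun=> [:: (1, (t, f))]); split.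
  by move=> n p; rewrite inE => /eqP ->.
rewrite (_ : (fun n => _) = fun=> 0); first exact: cvg_cst.
apply/funext => n; rewrite -[RHS](dot0l P (fun=> 0)); congr (dot P _ _);
  by apply/funext => w /=; rewrite /wsum big_seq1 mul1r subrr.
Qed.

Lemma gspaceZ A c X : gspace A X -> gspace A (fun w => c * X w).
Proof.
move=> [sX [s [As cs]]]; split; first exact: sqintZ.
exists (fun n => [seq (c * p.1, p.2) | p <- s n]); split.
  by move=> n _ /mapP[p ps ->]; exact: As ps.
have ss n : sqint P (wsum (s n)) by exact: wsum_sqint (As n).
rewrite (_ : (fun n => _) = (fun n => c ^+ 2 *
   dot P (X \- wsum (s n)) (X \- wsum (s n)))).
  rewrite -[X in _ --> X](mulr0 (c ^+ 2)); apply: cvgM => //; exact: cvg_cst.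
apply/funext => n; rewrite (_ : _ \- _ = (fun w => c * (X \- wsum (s n)) w)).
  have sB := sqintB sX (ss n).
  by rewrite dotZl ?dotZr//; [rewrite mulrA expr2|exact: sqintZ].
apply/funext => w /=; rewrite /wsum big_map/= mulrBr mulr_sumr.
by congr (_ - _); apply: eq_bigr => p _; rewrite mulrA.
Qed.

Lemma gspaceD A X X' : gspace A X -> gspace A X' -> gspace A (fun w => X w + X' w).
Proof.
move=> [sX [s [As cs]]] [sX' [s' [As' cs']]]; split; first exact: sqintD.
exists (fun n => s n ++ s' n); split.
  by move=> n p; rewrite mem_cat => /orP[/As|/As'].
have ss n : sqint P (wsum (s n)) by exact: wsum_sqint (As n).
have ss' n : sqint P (wsum (s' n)) by exact: wsum_sqint (As' n).
have sB n := sqintB sX (ss n); have sB' n := sqintB sX' (ss' n).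
have cc := cvg_dot0 sB sB' cs cs'.
rewrite (_ : (fun n => _) = (fun n => dot P (X \- wsum (s n)) (X \- wsum (s n)) +
   dot P (X' \- wsum (s' n)) (X' \- wsum (s' n)) +
   (dot P (X \- wsum (s n)) (X' \- wsum (s' n)) + dot P (X \- wsum (s n)) (X' \- wsum (s' n))))).
  have -> : (0 : R) = 0 + 0 + (0 + 0) by rewrite !addr0.
  by apply: cvgD; apply: cvgD.
have key (U V : Omega -> R) : sqint P U -> sqint P V ->
    dot P (U \+ V) (U \+ V) = dot P U U + dot P V V + (dot P U V + dot P U V).
  by move=> sU sV; rewrite dotDl ?dotDr ?(dotC P V U)//; [ring|exact: sqintD].
apply/funext => n; rewrite (_ : _ \- _ = (X \- wsum (s n)) \+ (X' \- wsum (s' n))).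
  exact: key.
by apply/funext => w /=; rewrite /wsum big_cat/=; ring.
Qed.

Lemma gspace0 A : gspace A (fun=> 0).
Proof.
split; first exact: sqint0.
exists (fun=> [::]); split => //.
rewrite (_ : (fun n => _) = fun=> 0); first exact: cvg_cst.
apply/funext => n; rewrite -[RHS](dot0l P (fun=> 0)); congr (dot P _ _);
  by apply/funext => w /=; rewrite /wsum big_nil subrr.
Qed.

Lemma gspace_sum A (I : Type) (r : seq I) (X : I -> Omega -> R) :
  (forall i, gspace A (X i)) -> gspace A (fun w => \sum_(i <- r) X i w).
Proof.
move=> GX; elim: r => [|i r IH].
  by under eq_fun do rewrite big_nil; exact: gspace0.
by under eq_fun do rewrite big_cons; exact: gspaceD.
Qed.

(** Mean-square distances ignore null sets. This admits the coordinates of [u t], which are equal to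
    the [Y k t] only almost everywhere. *)
Lemma gspace_ae A X X' : measurable_fun setT X' -> X = X' %[ae P] ->
  gspace A X -> gspace A X'.
Proof.
move=> mX' XX' [sX [s [As cs]]]; have sX' := ae_sqint mX' XX' sX.
split=> //; exists s; split=> //.
rewrite (_ : (fun n => _) = (fun n => dot P (X \- wsum (s n)) (X \- wsum (s n))))//.
apply/funext => n; have ss := wsum_sqint (As n).
have [mB _] := sqintB sX ss; have [mB' _] := sqintB sX' ss.
have ae : X \- wsum (s n) = X' \- wsum (s n) %[ae P].
  by apply: filterS XX' => w /= e Dw; rewrite e.
by rewrite (ae_dot mB mB' mB ae) dotC (ae_dot mB mB' mB' ae).
Qed.

Lemma gspace_lim A X (s : nat -> seq (R * (R * L2 mu))) :
  measurable_fun setT X -> (forall n, wsupp A (s n)) ->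
  ('E_P[(fun w => (X w - wsum (s n) w) ^+ 2)%R] @[n --> \oo] --> 0)%E ->
  gspace A X /\ dot P (X \- wsum (s n)) (X \- wsum (s n)) @[n --> \oo] --> 0.
Proof.
move=> mX As c.
have ss n : sqint P (wsum (s n)) by exact: wsum_sqint (As n).
(* Convergence to 0 in the extended reals makes the expectation finite from some [N] on; the square
   integrability of [X] is read off there. *)
have /fine_cvgP[[N _ HN] _] := c.
have sB : sqint P (X \- wsum (s N)).
  have [mN _] := ss N; apply: sqint_lty; first exact: measurable_funB.
  by have := HN N (leqnn N); rewrite /= unlock ge0_fin_numE// integral_ge0// => w _; rewrite lee_fin sqr_ge0.
have sX : sqint P X.
  have := sqintD sB (ss N).
  by rewrite (_ : _ \+ _ = X)//; apply/funext => w /=; rewrite subrK.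
have cs : dot P (X \- wsum (s n)) (X \- wsum (s n)) @[n --> \oo] --> 0.
  have e n : ('E_P[(fun w => (X w - wsum (s n) w) ^+ 2)%R] =
      (dot P (X \- wsum (s n)) (X \- wsum (s n)))%:E)%E.
    by rewrite expectation_dot//; exact: sqintB.
  by move: c; under eq_fun do rewrite e; move/fine_cvg.
by split=> //; split=> //; exists s.
Qed.

End GaussianSpace.

(** * Wiener integrals *)

Section WienerIntegral.
Context d (Omega : measurableType d) (R : realType) (P : probability Omega R).
Context d' (T : measurableType d') (mu : {measure set T -> \bar R}).
Variable W : R -> L2 mu -> {RV P >-> R}.
Hypothesis hW : cylindrical_wiener W.
Local Notation leb := (@lebesgue_measure R).

(** The common algebra of the two sides of the Ito isometry: only inner products of the form
    [K * Num.min z z'] enter. It is used for the noise in L^2(P) and for the indicators of []0, z]]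
    in L^2 of Lebesgue measure. *)
Lemma dot_increments d1 (T1 : measurableType d1) (m : {measure set T1 -> \bar R})
    (e : R -> T1 -> R) (K : R) n (c x y : 'I_n -> R) :
  (forall z, 0 <= z -> sqint m (e z)) ->
  (forall z z', 0 <= z -> 0 <= z' -> dot m (e z) (e z') = K * Num.min z z') ->
  (forall i, 0 <= x i) -> (forall i, 0 <= y i) ->
  sqint m (fun u => \sum_(i < n) c i * (e (y i) u - e (x i) u)) /\
  dot m (fun u => \sum_(i < n) c i * (e (y i) u - e (x i) u))
        (fun u => \sum_(i < n) c i * (e (y i) u - e (x i) u)) =
  K * \sum_(i < n) \sum_(j < n) c i * c j *
    (Num.min (y i) (y j) - Num.min (y i) (x j) -
     (Num.min (x i) (y j) - Num.min (x i) (x j))).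
Proof.
move=> se de x0 y0.
have sB i : sqint m (e (y i) \- e (x i)) by apply: sqintB; exact: se.
have sF i : sqint m (fun u => c i * (e (y i) u - e (x i) u)).
  exact: (sqintZ (c i) (sB i)).
have sS : sqint m (fun u => \sum_(i < n) c i * (e (y i) u - e (x i) u)).
  exact: sqint_sum.
split=> //.
rewrite dot_suml// mulr_sumr; apply: eq_bigr => i _.
rewrite dot_sumr// mulr_sumr; apply: eq_bigr => j _.
have sx k := se _ (x0 k); have sy k := se _ (y0 k).
rewrite (dotZl (c i) (sB i) (sF j)) (dotZr (c j) (sB j) (sB i)).
rewrite (dotBl (sy i) (sx i) (sB j)).
rewrite (dotBr (sy j) (sx j) (sy i)) (dotBr (sy j) (sx j) (sx i)).
rewrite !de//; ring.
Qed.

Lemma dot_indic_itv (x y : R) : 0 <= x -> 0 <= y ->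
  sqint leb (\1_`]0, x]%classic : R -> R) /\
  dot leb (\1_`]0, x]%classic : R -> R) (\1_`]0, y]%classic : R -> R) = 1 * Num.min x y.
Proof.
move=> x0 y0.
have lm z : 0 <= z -> leb `]0, z]%classic = z%:E.
  rewrite lebesgue_measure_itv/= lte_fin; case: ltgtP => // [|<-//] _ _.
  by rewrite -EFinB subr0.
have mi z : measurable (`]0, z]%classic : set R) by exact: measurable_itv.
split.
  apply: sqint_lty; first exact: measurable_indic.
  pose A : set R := `]0, x]%classic; rewrite -/A.
  rewrite (_ : (\int[leb]_u (\1_A u ^+ 2)%:E)%E = (\int[leb]_u (\1_A u)%:E)%E).
    rewrite (integral_indic leb measurableT (mi x)) setIT.
    exact: (eq_ind_r (fun z => (z < +oo)%E) (ltry x) (lm _ x0)).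
  by apply: eq_integral => u _; rewrite indicE; case: (_ \in _); rewrite ?expr1n ?expr0n.
rewrite mul1r /dot /Rintegral.
under eq_integral.
  move=> u _; rewrite (_ : _ * _ = \1_`]0, Num.min x y]%classic u); last first.
    rewrite !indicE !mem_setE !in_itv/= le_min -natrM mulnb; congr (_%:R).
    by case: (0 < u); case: (u <= x); case: (u <= y).
  over.
pose A : set R := `]0, Num.min x y]%classic; rewrite -/A.
have m0 : 0 <= Num.min x y by rewrite le_min x0.
rewrite (integral_indic leb measurableT (mi (Num.min x y))) setIT.
exact: (congr1 fine (lm _ m0)).
Qed.

Section Steps.
Variables (f : L2 mu) (t : R).

Definition step_word (s : seq (R * (R * R))) : seq (R * (R * L2 mu)) :=
  flatten [seq [:: (p.1, (p.2.2, f)); (- p.1, (p.2.1, f))] | p <- s].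

Lemma wsum_step_word s :
  wsum W (step_word s) = step_integral (fun z => W z f) s.
Proof.
apply/funext => w; rewrite /wsum /step_integral /step_word.
elim: s => [|p s IH] /=; first by rewrite !big_nil.
by rewrite !big_cons IH/=; ring.
Qed.

Lemma step_word_supp s : step_on t s -> wsupp [set f] (step_word s).
Proof.
move=> ts q /flatten_mapP[p ps]; have /and3P[x0 xy yt] := ts p ps.
by rewrite !inE => /orP[/eqP->|/eqP->]/=; split => //; exact: le_trans xy.
Qed.

(** Both squared norms are the same double sum from [dot_increments]. *)
Lemma step_isometry s : step_on t s ->
  sqint leb (step_fun s) /\
  dot P (step_integral (fun z => W z f) s) (step_integral (fun z => W z f) s) =
  dot mu f f * dot leb (step_fun s) (step_fun s).
Proof.
move=> ts.
pose c (i : 'I_(size s)) := (tnth (in_tuple s) i).1.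
pose x (i : 'I_(size s)) := (tnth (in_tuple s) i).2.1.
pose y (i : 'I_(size s)) := (tnth (in_tuple s) i).2.2.
have xy i : 0 <= x i /\ x i <= y i.
  by have /and3P[] := ts _ (mem_tnth i (in_tuple s)).
have x0 i : 0 <= x i by have [] := xy i.
have y0 i : 0 <= y i by have [x0' xy'] := xy i; exact: le_trans xy'.
have eI : step_integral (fun z => W z f) s =
    (fun w => \sum_(i < size s) c i * (W (y i) f w - W (x i) f w)).
  by apply/funext => w; rewrite /step_integral [LHS]big_tnth.
(* As 0 <= x <= y, the indicator of []x, y]] is an increment of the family of indicators of []0,
   z]]. *)
have eF : step_fun s = (fun u => \sum_(i < size s) c i *
    ((\1_`]0, y i]%classic : R -> R) u - (\1_`]0, x i]%classic : R -> R) u)).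
  apply/funext => u; rewrite /step_fun [LHS]big_tnth; apply: eq_bigr => i _.
  congr (_ * _); rewrite !indicE !mem_setE !in_itv/=.
  rewrite -/(x i) -/(y i); have [x0' xy'] := xy i.
  have [ux|xu] := leP u (x i); have [uy|yu] := leP u (y i).
  - by rewrite !andbT subrr.
  - by move: (le_lt_trans xy' yu); rewrite ltNge ux.
  - by rewrite andbT andbF (le_lt_trans x0' xu) subr0.
  - by rewrite !andbF subrr.
have [_ d1] := @dot_increments _ _ P (fun z => W z f) (dot mu f f) _ c x y
  (fun z z0 => W_sqint hW f z0)
  (fun z z' z0 z0' => etrans (dot_W hW f f z0 z0') (mulrC _ _)) x0 y0.
have [s2 d2] := @dot_increments _ _ leb (fun z => \1_`]0, z]%classic) 1 _ c x y
  (fun z z0 => (dot_indic_itv z0 z0).1)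
  (fun z z' z0 z0' => (dot_indic_itv z0 z0').2) x0 y0.
by rewrite eF; split => //; rewrite eI d1 d2 mul1r.
Qed.

Lemma wiener_integral_gspace h (Z : Omega -> R) : measurable_fun setT Z ->
  wiener_integral P (fun s => W s f) t h Z -> gspace W [set f] Z.
Proof.
move=> mZ [s [son _ c]].
by have [] := @gspace_lim _ _ _ P _ _ mu W hW [set f] Z (fun n => step_word (s n)) mZ
  (fun n => step_word_supp (son n)); under eq_fun do rewrite wsum_step_word.
Qed.

(** The isometry of step integrals passes to the limit on both sides. *)
Lemma wiener_integral_var (h : R -> R) (Z : Omega -> R) (v : R) : measurable_fun setT Z ->
  measurable_fun `[0, t]%classic h ->
  (\int[leb]_(x in `[0%R, t]) ((h x) ^+ 2)%:E = v%:E)%E ->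
  wiener_integral P (fun s => W s f) t h Z -> dot P Z Z = dot mu f f * v.
Proof.
move=> mZ mh hv [s [son ch c]].
have [[sZ _] cZ] := @gspace_lim _ _ _ P _ _ mu W hW [set f] Z (fun n => step_word (s n))
  mZ (fun n => step_word_supp (son n))
  (eq_ind_r (fun F => ('E_P[(fun w => (Z w - F n w) ^+ 2)%R] @[n --> \oo] --> 0)%E) c
     (funext (fun n => wsum_step_word (s n)))).
(* Extension of [h] by 0 transfers the approximation to the whole line, since step functions on
   [[0, t]] vanish outside it. *)
pose D : set R := `[0, t]%classic; pose hh := h \_ D.
have mD : measurable D by exact: measurable_itv.
have mhh : measurable_fun setT hh by apply/(measurable_restrictT h mD).
have hhv : (\int[leb]_x (hh x ^+ 2)%:E = v%:E)%E.
  rewrite -hv [RHS]integral_mkcond; apply: eq_integral => x _.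
  by rewrite /hh !patchE; case: ifP => // _; rewrite expr0n.
have shh : sqint leb hh by apply: sqint_lty => //; rewrite hhv ltry.
have ss n : sqint leb (step_fun (s n)) by have [] := step_isometry (son n).
have step0 n x : ~ D x -> step_fun (s n) x = 0.
  move=> nD; rewrite /step_fun big_seq big1// => p ps.
  rewrite indicE memNset ?mulr0//= in_itv/= => /andP[px xp]; apply: nD.
  have /and3P[p0 _ pt] := son n p ps.
  by rewrite /D/= in_itv/= (le_trans p0 (ltW px)) (le_trans xp pt).
have c' : dot leb (hh \- step_fun (s n)) (hh \- step_fun (s n)) @[n --> \oo] --> 0.
  apply: (@fine_cvg _ _ _ _ (fun n => (dot leb (hh \- step_fun (s n)) (hh \- step_fun (s n)))%:E) 0).
  rewrite (_ : (fun n => _) = (fun n => \int[leb]_(x in `[0%R, t]%classic)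
           ((h x - step_fun (s n) x) ^+ 2)%R%:E)%E)//.
  apply/funext => n; rewrite -dot_EFin; last exact: sqintB.
  rewrite [RHS]integral_mkcond; apply: eq_integral => x _.
  rewrite /= /hh !patchE; case: ifPn => // /negP xD.
  by rewrite step0 ?subr0 ?expr0n// => Dx; apply: xD; rewrite inE.
have l1 := cvg_dot ss ss shh shh c' c'.
have sw n : sqint P (wsum W (step_word (s n))).
  exact: (wsum_sqint hW (step_word_supp (son n))).
have l2 := cvg_dot sw sw sZ sZ cZ cZ.
have e n : dot P (wsum W (step_word (s n))) (wsum W (step_word (s n))) =
    dot mu f f * dot leb (step_fun (s n)) (step_fun (s n)).
  by rewrite wsum_step_word; have [] := step_isometry (son n).
have l3 : dot P (wsum W (step_word (s n))) (wsum W (step_word (s n))) @[n --> \oo] -->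
    dot mu f f * dot leb hh hh.
  by under eq_fun do rewrite e; exact: cvgMr.
rewrite (cvg_unique (@Rhausdorff R) l2 l3); congr (_ * _).
by apply: EFin_inj; rewrite -dot_EFin.
Qed.

End Steps.

End WienerIntegral.

(** * Independence *)

Section GaussianIndependence.
Context d (Omega : measurableType d) (R : realType) (P : probability Omega R).

(** The events independent of a fixed [A'] form a Dynkin class. *)
Lemma indep_g_sigma (C : set (set Omega)) (A' : set Omega) :
  setI_closed C -> C `<=` measurable -> measurable A' ->
  (forall E, C E -> P (E `&` A') = (P E * P A')%E) ->
  forall A, <<s C >> A -> P (A `&` A') = (P A * P A')%E.
Proof.
move=> CI Cm mA' CA'.
pose D := [set A : set Omega | measurable A /\ P (A `&` A') = (P A * P A')%E].
suff sub : <<s C >> `<=` D by move=> A /sub [].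
apply: (@g_sigma_sub_dynkin _ C D CI); last first.
  by move=> E CE; split; [exact: Cm|exact: CA'].
split.
- by split => //; rewrite setTI probability_setT mul1e.
- move=> A [mA e]; split; first exact: measurableC.
  have fA : P A \is a fin_num by exact: fin_num_measure.
  have fA' : P A' \is a fin_num by exact: fin_num_measure.
  rewrite probability_setC// setIC -setDE measureD//; last by rewrite ltey_eq fA'.
  transitivity (P A' - P A * P A')%E; last by rewrite muleBl ?mul1e// fin_num_adde_defr.
  by congr (_ - _)%E; rewrite setIC; exact: e.
- move=> F tF DF; split; first by apply: bigcupT_measurable => n; have [] := DF n.
  have fA' : P A' \is a fin_num by exact: fin_num_measure.
  have mF n : measurable (F n) by have [] := DF n.
  rewrite setI_bigcupl measure_bigcup//; last first.
  - by move=> i j _ _ [w [[wi _] [wj _]]]; apply: tF => //; exists w.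
  - by move=> n _; exact: measurableI.
  rewrite measure_bigcup// muleC -[P A']fineK// -nneseriesZl//.
  by apply: eq_eseriesr => n _; rewrite fineK// muleC; have [_ e] := DF n; exact: e.
Qed.

Definition rv_cylinder (ZZ : set (Omega -> R)) (A : set Omega) : Prop :=
  exists n (Z : nat -> Omega -> R) (B : nat -> set R),
  [/\ forall i, ZZ (Z i), forall i, measurable (B i) &
      A = [set w | forall i, (i < n)%N -> B i (Z i w)]].

Lemma rv_cylinder_setI ZZ : setI_closed (rv_cylinder ZZ).
Proof.
move=> _ _ [n [Z [B [ZZi mB ->]]]] [n' [Z' [B' [ZZi' mB' ->]]]].
exists (n + n')%N, (fun i => if (i < n)%N then Z i else Z' (i - n)%N),
  (fun i => if (i < n)%N then B i else B' (i - n)%N); split.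
- by move=> i; case: ifP.
- by move=> i; case: ifP.
- apply/seteqP; split => w /=.
    move=> [h h'] i ilt; case: ifP => [|/negbT]; first exact: h.
    by rewrite -leqNgt => ni; apply: h'; rewrite ltn_subLR.
  move=> h; split => i ilt.
    by have := h i (ltn_addr _ ilt); rewrite ilt.
  by have := h (n + i)%N; rewrite ltn_add2l ilt ltnNge leq_addr/= addKn; apply.
Qed.

Lemma rv_cylinder_measurable ZZ : (forall Z, ZZ Z -> measurable_fun setT Z) ->
  rv_cylinder ZZ `<=` measurable.
Proof.
move=> mZ _ [n [Z [B [ZZi mB ->]]]].
rewrite (_ : [set w | _] = \bigcap_(i in `I_n) (Z i @^-1` B i)).
  apply: bigcap_measurableType => i _; rewrite -[X in measurable X]setTI.
  by apply: mZ.
by apply/seteqP; split => w /=.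
Qed.

Lemma prod_indic_cylinder n (Z : nat -> Omega -> R) (B : nat -> set R) w :
  \prod_(i < n) \1_(B i) (Z i w) =
  \1_[set w | forall i, (i < n)%N -> B i (Z i w)] w :> R.
Proof.
rewrite [RHS]indicE; set A := [set w | _]; have [Aw|nA] := pselect (A w).
  by rewrite mem_set// big1// => i _; rewrite indicE mem_set//; exact: Aw.
rewrite memNset//.
have /existsNP[i /not_implyP[ilt nB]] := nA.
by rewrite (bigD1 (Ordinal ilt))//= indicE memNset// mul0r.
Qed.

Context d' (T : measurableType d') (mu : {measure set T -> \bar R}).
Variable W : R -> L2 mu -> {RV P >-> R}.
Hypothesis hW : cylindrical_wiener W.

Variables A A' : set (L2 mu).
Hypothesis AA' : forall f g, A f -> A' g -> dot mu f g = 0.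

(** Orthogonality factorises the joint cosine transforms. [fourier_unique_prod] then trades cosines
    for indicators, in the variables of [E] and next in those of [E'], the other factor serving as
    weight. *)
Lemma gspace_cylinder_indep E E' : rv_cylinder (gspace W A) E ->
  rv_cylinder (gspace W A') E' -> P (E `&` E') = (P E * P E')%E.
Proof.
move=> cE cE'.
have mE : measurable E by apply: rv_cylinder_measurable cE => Z [[]].
have mE' : measurable E' by apply: rv_cylinder_measurable cE' => Z [[]].
move: cE cE' => [n [Z [B [GZ mB EE]]]] [n' [Z' [B' [GZ' mB' EE']]]].
have mZ i : measurable_fun setT (Z i) by have [[]] := GZ i.
have mZ' i : measurable_fun setT (Z' i) by have [[]] := GZ' i.
pose L (c : nat -> R) w := \sum_(i < n) c i * Z i w.
pose L' (c : nat -> R) w := \sum_(i < n') c i * Z' i w.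
have GL c : gspace W A (L c) by apply: (gspace_sum hW) => i; exact: gspaceZ.
have GL' c : gspace W A' (L' c) by apply: (gspace_sum hW) => i; exact: gspaceZ.
have bc (Y : Omega -> R) (th : R) : measurable_fun setT Y -> bmeas (fun w => cos (Y w + th)).
  by move=> mY; apply: bmeas_cos; exact: measurable_funD.
have mL c : measurable_fun setT (L c) by have [[]] := GL c.
have mL' c : measurable_fun setT (L' c) by have [[]] := GL' c.
have charE Y th : gspace W (A `|` A') Y ->
    \int[P]_w cos (Y w + th) = expR (- (dot P Y Y / 2)) * cos th.
  move=> /(gspace_gaussian hW)/(_ 1 th).
  by rewrite expr1n mul1r => <-; apply: eq_Rintegral => w _; rewrite mul1r.
have GA Y : gspace W A Y -> gspace W (A `|` A') Y by apply: gspaceS => f; left.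
have GA' Y : gspace W A' Y -> gspace W (A `|` A') Y by apply: gspaceS => f; right.
(* The product of cosines is half a sum of cosines of Gaussian variables. By orthogonality the sum
   and the difference of [L' c'] and [L c] have the same variance, and the cosines of the phases
   recombine into a product. *)
have base c c' th th' :
    \int[P]_w (cos (L' c' w + th') * cos (L c w + th)) =
    \int[P]_w cos (L' c' w + th') * \int[P]_w cos (L c w + th).
  have gN : gspace W A (fun w => - 1 * L c w) by exact: gspaceZ.
  have e w : cos (L' c' w + th') * cos (L c w + th) =
      2^-1 * (cos ((L' c' w + L c w) + (th' + th)) +
              cos ((L' c' w + -1 * L c w) + (th' - th))).
    rewrite (_ : L' c' w + L c w + _ = (L' c' w + th') + (L c w + th)); last by ring.
    rewrite (_ : L' c' w + -1 * L c w + _ = (L' c' w + th') - (L c w + th)); last by ring.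
    set a := L' c' w + th'; set b := L c w + th.
    by move: a b => a b; have := cosD a b; have := cosB a b => -> ->; field.
  rewrite (eq_Rintegral _ (fun w _ => e w)).
  have g1 : gspace W (A `|` A') (fun w => L' c' w + L c w).
    by apply: (gspaceD hW); [exact: GA'|exact: GA].
  have g2 : gspace W (A `|` A') (fun w => L' c' w + -1 * L c w).
    by apply: (gspaceD hW); [exact: GA'|exact: GA].
  have [[m1 _] _] := g1; have [[m2 _] _] := g2.
  have b1 := bmeas_integrable P (bc _ (th' + th) m1).
  have b2 := bmeas_integrable P (bc _ (th' - th) m2).
  rewrite RintegralZl//; last first.
    by have := integrableD measurableT b1 b2; apply: eq_integrable.
  rewrite RintegralD// !charE//; try by [exact: GA|exact: GA'].
  have [sL _] := GL c; have [sL' _] := GL' c'; have [sN _] := gN.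
  have o : dot P (L' c') (L c) = 0.
    by rewrite dotC; apply: (gspace_orth hW AA' (GL c) (GL' c')).
  have -> : dot P (fun w => L' c' w + L c w) (fun w => L' c' w + L c w) =
      dot P (L' c') (L' c') + dot P (L c) (L c).
    have sD := sqintD sL' sL.
    rewrite (dotDl sL' sL sD) (dotDr sL' sL sL') (dotDr sL' sL sL) (dotC P (L c)) o.
    by rewrite addr0 add0r.
  have -> : dot P (fun w => L' c' w + -1 * L c w) (fun w => L' c' w + -1 * L c w) =
      dot P (L' c') (L' c') + dot P (L c) (L c).
    have sD := sqintD sL' sN.
    rewrite (dotDl sL' sN sD) (dotDr sL' sN sL') (dotDr sL' sN sN).
    rewrite (dotZr _ sL sL') (dotZl _ sL sL') (dotZl _ sL sN) (dotZr _ sL sL).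
    rewrite (dotC P (L c) (L' c')) o; ring.
  by rewrite mulrDl opprD expRD cosD cosB; field.
(* The cosine of the primed variables is a weight that may be replaced by its mean. *)
have s1 c' th' : \int[P]_w (cos (L' c' w + th') * \prod_(i < n) \1_(B i) (Z i w)) =
    \int[P]_w (cst (\int[P]_w cos (L' c' w + th')) w * \prod_(i < n) \1_(B i) (Z i w)).
  apply: fourier_unique_prod => //; first exact: bc.
    exact: bmeas_cst.
  move=> c th; rewrite [LHS]base RintegralZl//.
  exact: (bmeas_integrable P (bc _ th (mL c))).
have bprod k (Y : nat -> Omega -> R) (D : nat -> set R) : (forall i, measurable_fun setT (Y i)) ->
    (forall i, measurable (D i)) -> bmeas (fun w => \prod_(i < k) \1_(D i) (Y i w) : R).
  move=> mY mD; elim: k => [|k IH].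
    by under eq_fun do rewrite big_ord0; exact: bmeas_cst.
  under eq_fun do rewrite big_ord_recr/=; apply: bmeasM => //.
  exact: bmeas_indic.
(* The same exchange, with the indicator of [E] as weight. *)
have s2 : \int[P]_w (\prod_(i < n) \1_(B i) (Z i w) * \prod_(i < n') \1_(B' i) (Z' i w)) =
    \int[P]_w (cst (\int[P]_w \prod_(i < n) \1_(B i) (Z i w)) w *
       \prod_(i < n') \1_(B' i) (Z' i w)) :> R.
  apply: fourier_unique_prod => //; first exact: bprod.
    exact: bmeas_cst.
  move=> c' th'; rewrite [RHS]RintegralZl//; last first.
    exact: (bmeas_integrable P (bc _ th' (mL' c'))).
  rewrite (@eq_Rintegral _ _ _ P setT (fun w => cos (L' c' w + th') * \prod_(i < n) \1_(B i) (Z i w))).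
    rewrite s1 RintegralZl; [|by []|exact: (bmeas_integrable P (bprod _ _ _ mZ mB))].
    by rewrite mulrC.
  by move=> w _; rewrite mulrC.
have PE (F : set Omega) : measurable F -> P F = (\int[P]_w (\1_F w : R))%:E.
  by move=> mF; rewrite /Rintegral integral_indic// setIT fineK// fin_num_measure.
rewrite !PE//; last exact: measurableI.
rewrite -EFinM; congr EFin.
transitivity (\int[P]_w (\prod_(i < n) \1_(B i) (Z i w) * \prod_(i < n') \1_(B' i) (Z' i w)) : R).
  apply: eq_Rintegral => w _; rewrite !prod_indic_cylinder -EE -EE' !indicE in_setI.
  by case: (w \in E); case: (w \in E'); rewrite /= ?mul1r ?mul0r.
rewrite s2 RintegralZl; [|by []|exact: (bmeas_integrable P (bprod _ _ _ mZ' mB'))].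
congr (_ * _); apply: eq_Rintegral => w _.
  by rewrite prod_indic_cylinder -EE.
by rewrite prod_indic_cylinder -EE'.
Qed.

(** One factor at a time is extended from cylinders to the generated sigma-algebra. *)
Lemma gspace_indep E E' : <<s rv_cylinder (gspace W A) >> E ->
  <<s rv_cylinder (gspace W A') >> E' -> P (E `&` E') = (P E * P E')%E.
Proof.
have mG AA : rv_cylinder (gspace W AA) `<=` measurable.
  by apply: rv_cylinder_measurable => Z [[]].
move=> sE sE'.
have mE' : measurable E'.
  by apply: sE'; split; [exact: sigma_algebra_measurable|exact: mG].
apply: (indep_g_sigma (@rv_cylinder_setI _) (@mG A) mE' _ sE) => F cF.
rewrite setIC muleC.
apply: (indep_g_sigma (@rv_cylinder_setI _) (@mG A') (mG _ _ cF) _ sE') => F' cF'.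
by rewrite setIC muleC; exact: gspace_cylinder_indep.
Qed.

End GaussianIndependence.

(** * Gaussian series in L2 *)

Section DominatedSeries.
Context d (T : measurableType d) (R : realType) (mu : {measure set T -> \bar R}).
Variable phi : nat -> L2 mu.
Hypothesis orth : forall i j, dot mu (phi i) (phi j) = (i == j)%:R.
Hypothesis complete : forall f : L2 mu,
  \sum_(k < n) dot mu f (phi k) *: phi k @[n --> \oo] --> f.

(** By Parseval the squared distance is a finite head, which tends to 0 termwise, and a tail bounded
    by the tail of the series of [m], uniformly in [n]. *)
Lemma L2_dominated_cvg (U : nat -> L2 mu) (V : L2 mu) (m : nat -> R) (K : R) :
  (forall n, \sum_(k < n) m k <= K) ->
  (forall n k, (dot mu (U n) (phi k) - dot mu V (phi k)) ^+ 2 <= m k) ->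
  (forall k, dot mu (U n) (phi k) @[n --> \oo] --> dot mu V (phi k)) ->
  U n @[n --> \oo] --> V.
Proof.
move=> mK dm dU.
have m0 k : 0 <= m k by apply: le_trans (dm 0%N k); exact: sqr_ge0.
pose S n := \sum_(k < n) m k.
have Snd : nondecreasing_seq S.
  by apply/nondecreasing_seqP => n; rewrite /S big_ord_recr/= lerDl.
have Sc : cvgn S.
  by apply: nondecreasing_is_cvgn => //; exists K => _ [n _ <-]; exact: mK.
apply/cvgrPdist_lt => e e0.
have e20 : 0 < e ^+ 2 / 2 by rewrite divr_gt0// exprn_gt0.
have /cvgrPdist_lt/(_ _ e20) [N _ HN] := Sc.
have SN : limn S - S N < e ^+ 2 / 2.
  by apply: le_lt_trans (HN N (leqnn N)); exact: ler_norm.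
have DN n : `|U n - V| ^+ 2 <= \sum_(k < N) (dot mu (U n) (phi k) - dot mu V (phi k)) ^+ 2
    + (limn S - S N).
  have pv : \sum_(k < j) dot mu (U n - V) (phi k) ^+ 2 @[j --> \oo] --> `|U n - V| ^+ 2.
    by apply: parseval.
  apply: (cvgr_to_le pv); near=> k.
  under eq_bigr do rewrite dotL2B.
  have Nk : (N <= k)%N by near: k; exact: nbhs_infty_ge.
  rewrite -(subnKC Nk) big_split_ord/= lerD2l.
  rewrite lerBrDl; apply: le_trans (nondecreasing_cvgn_le Snd Sc (N + (k - N))).
  by rewrite /S big_split_ord/= lerD2l; apply: ler_sum => i _; exact: dm.
have c1 k : (dot mu (U n) (phi k) - dot mu V (phi k)) ^+ 2 @[n --> \oo] --> (0 : R).
  rewrite [X in _ --> X](_ : 0 = (dot mu V (phi k) - dot mu V (phi k)) ^+ 2); last first.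
    by rewrite subrr expr0n.
  have cB : dot mu (U n) (phi k) - dot mu V (phi k) @[n --> \oo] -->
      dot mu V (phi k) - dot mu V (phi k).
    by apply: cvgB; [exact: dU|exact: cvg_cst].
  by rewrite expr2; under eq_fun do rewrite expr2; exact: cvgM.
have c0 : \sum_(k < N) (dot mu (U n) (phi k) - dot mu V (phi k)) ^+ 2 @[n --> \oo] --> (0 : R).
  elim: {HN SN DN} N => [|N IH].
    by under eq_fun do rewrite big_ord0; exact: cvg_cst.
  under eq_fun do rewrite big_ord_recr/=.
  have h := cvgD IH (c1 N); rewrite addr0 in h; exact: h.
move/cvgrPdist_lt : c0 => /(_ _ e20); apply: filterS => n /=.
rewrite sub0r normrN ger0_norm ?sumr_ge0//; last by move=> i _; exact: sqr_ge0.
move=> h; rewrite distrC -(ltr_pXn2r (n := 2))// ?nnegrE ?(ltW e0)//.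
by apply: le_lt_trans (DN n) _; rewrite [ltRHS]splitr ltrD.
Unshelve. all: by end_near. Qed.

End DominatedSeries.

Lemma measurable_dotL2 d (T : measurableType d) (R : realType)
    (mu : {measure set T -> \bar R}) d' (Omega : measurableType d')
    (X : Omega -> L2 mu) (h : L2 mu) :
  measurable_fun setT (X : Omega -> Borel (L2 mu)) ->
  measurable_fun setT (fun w => dot mu (X w) h).
Proof.
exact: measurableT_comp (measurable_continuous_L2 (@continuous_dotL2 _ _ _ mu h)).
Qed.

Lemma continuous_cos_dotL2 d (T : measurableType d) (R : realType)
    (mu : {measure set T -> \bar R}) (h : L2 mu) (c th : R) :
  continuous (fun y : L2 mu => cos (c * dot mu y h + th)).
Proof.
have cF : continuous (fun x : R => cos (c * x + th)).
  move=> x; have cc : c @[_ --> x] --> c by exact: cvg_cst.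
  have ct : th @[_ --> x] --> th by exact: cvg_cst.
  exact: (cvg_comp _ _ (cvgD (cvgM cc (@cvg_id _ (nbhs x))) ct) (@continuous_cos R _)).
by move=> y; exact: (cvg_comp _ _ (@continuous_dotL2 _ _ _ mu h y) (cF _)).
Qed.

Section SummableVariances.
Context d (Omega : measurableType d) (R : realType) (P : probability Omega R).

Lemma sum_dot_Rintegral (Z : nat -> Omega -> R) n : (forall k, sqint P (Z k)) ->
  P.-integrable setT (EFin \o (fun w => \sum_(k < n) Z k w ^+ 2)) /\
  \int[P]_w (\sum_(k < n) Z k w ^+ 2) = \sum_(k < n) dot P (Z k) (Z k).
Proof.
move=> sZ; elim: n => [|n [iS IH]].
  rewrite big_ord0 (_ : (fun w => _) = cst 0); last first.
    by apply/funext => w; rewrite big_ord0.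
  split; last exact: Rintegral_prob_cst.
  exact: finite_measure_integrable_cst.
rewrite (_ : (fun w => _) = (fun w => \sum_(k < n) Z k w ^+ 2 + Z n w ^+ 2)); last first.
  by apply/funext => w; rewrite big_ord_recr.
have [_ iZ] := sZ n; split.
  by have := integrableD measurableT iS iZ; apply: eq_integrable.
by rewrite RintegralD// IH big_ord_recr/= dot_sqE.
Qed.

(** By monotone convergence the sum of squares has expectation at most [K], so it is finite almost
    everywhere. *)
Lemma ae_summable (Z : nat -> Omega -> R) (K : R) : (forall k, sqint P (Z k)) ->
  (forall n, \sum_(k < n) dot P (Z k) (Z k) <= K) ->
  {ae P, forall w, exists K', forall n, \sum_(k < n) Z k w ^+ 2 <= K'}.
Proof.
move=> sZ ZK; pose f w := (\sum_(0 <= k <oo) (Z k w ^+ 2)%:E)%E.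
have m2 k : measurable_fun setT (fun w => (Z k w ^+ 2)%:E).
  by apply/measurable_EFinP; apply: measurable_funX; have [] := sZ k.
have z0 k w : (0 <= (Z k w ^+ 2)%:E)%E by rewrite lee_fin sqr_ge0.
have f0 w : (0 <= f w)%E by exact: nneseries_ge0.
have mf : measurable_fun setT f by apply: ge0_emeasurable_sum => //.
have fK : (\int[P]_w f w <= K%:E)%E.
  rewrite /f integral_nneseries//; apply: lime_le.
    by apply: is_cvg_nneseries => n _ _; exact: integral_ge0.
  apply: nearW => n; rewrite big_mkord.
  rewrite (_ : (\sum_(k < n) _)%E = (\sum_(k < n) dot P (Z k) (Z k))%:E) ?lee_fin//.
  by rewrite -sumEFin; apply: eq_bigr => k _; exact: dot_EFin.
have fi : P.-integrable setT f.
  apply/integrableP; split => //.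
  under eq_integral do rewrite gee0_abs//.
  exact: le_lt_trans fK (ltry _).
apply: filterS (integrable_ae measurableT fi) => w /(_ Logic.I) fw.
exists (fine (f w)) => n; rewrite -lee_fin fineK// -sumEFin.
rewrite /f -(big_mkord xpredT (fun k => (Z k w ^+ 2)%:E)).
exact: nneseries_lim_ge.
Qed.

End SummableVariances.

Section GaussianSeries.
Context d (Omega : measurableType d) (R : realType) (P : probability Omega R).
Context d' (T : measurableType d') (mu : probability T R).
Variable W : R -> L2 mu -> {RV P >-> R}.
Hypothesis hW : cylindrical_wiener W.
Variable phi : nat -> L2 mu.
Hypothesis orth : forall i j, dot mu (phi i) (phi j) = (i == j)%:R.
Hypothesis complete : forall f : L2 mu,
  \sum_(k < n) dot mu f (phi k) *: phi k @[n --> \oo] --> f.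

Local Notation Gphi k := (gspace W [set phi k]).
Local Notation coord X k := (fun w => dot mu (X w) (phi k)).

(** Variables attached to distinct [phi k] are orthogonal, so that variances add up. *)
Lemma gspace_lincomb (C : nat -> Omega -> R) (c : nat -> R) n :
  (forall k, Gphi k (C k)) ->
  gspace W setT (fun w => \sum_(i < n) c i * C i w) /\
  dot P (fun w => \sum_(i < n) c i * C i w) (fun w => \sum_(i < n) c i * C i w) =
  \sum_(i < n) c i ^+ 2 * dot P (C i) (C i).
Proof.
move=> GC; have sC i : sqint P (C i) by have [] := GC i.
have sc i : sqint P (fun w => c i * C i w) by exact: sqintZ.
split.
  apply: (gspace_sum hW) => i; apply: (gspaceZ hW).
  exact: gspaceS (@subsetT _ _) (GC i).
have sS : sqint P (fun w => \sum_(i < n) c i * C i w).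
  by apply: sqint_sum => i; exact: sc.
rewrite dot_suml//; apply: eq_bigr => i _.
rewrite dot_sumr// (bigD1 i)//= big1 ?addr0; last first.
  move=> j ji; rewrite (dotZl _ (sC i) (sc j)) (dotZr _ (sC j) (sC i)).
  rewrite (gspace_orth hW _ (GC i) (GC j)) ?mulr0//.
  move=> _ _ -> ->; rewrite orth.
  by rewrite (_ : (i == j :> nat) = false)//; apply/negbTE; rewrite eq_sym.
by rewrite (dotZl _ (sC i) (sc i)) (dotZr _ (sC i) (sC i)); ring.
Qed.

(** Every linear combination of coordinates is a centred Gaussian whose variance is determined by
    those of the coordinates. The variances thus fix all cosine transforms, hence the law. *)
Lemma gspace_law_unique (X1 X2 : Omega -> L2 mu) (g : L2 mu -> R) :
  (forall k, Gphi k (coord X1 k)) -> (forall k, Gphi k (coord X2 k)) ->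
  (forall k, dot P (coord X1 k) (coord X1 k) = dot P (coord X2 k) (coord X2 k)) ->
  continuous g -> (exists K, forall x, `|g x| <= K) ->
  \int[P]_w g (X1 w) = \int[P]_w g (X2 w).
Proof.
move=> G1 G2 var12; apply: (L2_law_unique orth complete).
- by move=> k; have [[]] := G1 k.
- by move=> k; have [[]] := G2 k.
move=> n B mB.
have one (X : Omega -> L2 mu) : \int[P]_w \prod_(i < n) \1_(B i) (dot mu (X w) (phi i)) =
    \int[P]_w (cst 1 w * \prod_(i < n) \1_(B i) (dot mu (X w) (phi i))) :> R.
  by apply: eq_Rintegral => w _; rewrite mul1r.
rewrite !one.
have m1 k : measurable_fun setT (coord X1 k) by have [[]] := G1 k.
have m2 k : measurable_fun setT (coord X2 k) by have [[]] := G2 k.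
have := @fourier_unique_prod _ _ _ P n (cst 1) (cst 1) (fun k => coord X1 k)
  (fun k => coord X2 k) B (bmeas_cst _ 1) (bmeas_cst _ 1) m1 m2 mB.
apply.
move=> c th.
have charE (X : Omega -> L2 mu) (v : nat -> R) : (forall k, Gphi k (coord X k)) ->
    (forall k, dot P (coord X k) (coord X k) = v k) ->
    \int[P]_w (cst 1 w * cos (\sum_(i < n) c i * dot mu (X w) (phi i) + th)) =
    expR (- ((\sum_(i < n) c i ^+ 2 * v i) / 2)) * cos th.
  move=> GX vX; have [gS vS] := @gspace_lincomb (fun i => coord X i) c n GX.
  have <- : dot P (fun w => \sum_(i < n) c i * dot mu (X w) (phi i))
     (fun w => \sum_(i < n) c i * dot mu (X w) (phi i)) = \sum_(i < n) c i ^+ 2 * v i.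
    by rewrite vS; apply: eq_bigr => i _; rewrite vX.
  have := gspace_gaussian hW gS 1 th.
  by rewrite expr1n mul1r => <-; apply: eq_Rintegral => w _; rewrite !mul1r.
exact: etrans (charE X1 _ G1 var12) (esym (charE X2 _ G2 (fun=> erefl))).
Qed.

(* The change on a null set makes the series of squares converge at every w, so
   that random elements of L2 can be built pointwise from their coordinates. *)
Lemma white_noise_modification (s : nat -> R) (K : R) :
  (forall n, \sum_(k < n) s k ^+ 2 <= K) ->
  exists xi : nat -> Omega -> R,
  [/\ forall k, Gphi k (xi k), forall k, dot P (xi k) (xi k) = 1 &
      forall w, exists K', forall n, \sum_(k < n) (s k * xi k w) ^+ 2 <= K'].
Proof.
(* At time 1 the noise in a unit direction is a standard Gaussian. *)
move=> sK; have GW k : Gphi k (W 1 (phi k)) by apply: (gspace_W hW).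
have sW k : sqint P (W 1 (phi k)) by have [] := GW k.
have vW k : dot P (W 1 (phi k)) (W 1 (phi k)) = 1.
  by rewrite (dot_W hW)// orth eqxx mulr1 minxx.
have sZ k : sqint P (fun w => s k * W 1 (phi k) w) by exact: sqintZ.
have [|N [mN PN QN]] := ae_summable sZ (K := K).
  move=> n; apply: le_trans (sK n); apply: ler_sum => k _.
  by rewrite (dotZl _ (sW k) (sZ k)) (dotZr _ (sW k) (sW k)) vW mulr1 expr2.
have mNC : measurable (~` N) by exact: measurableC.
pose xi k w := W 1 (phi k) w * \1_(~` N) w.
have mxi k : measurable_fun setT (xi k).
  by apply: measurable_funM => //; exact: measurable_indic.
have exi k : W 1 (phi k) = xi k %[ae P].
  exists N; split => // w /= h; apply: contrapT => Nw; apply: h => _.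
  by rewrite /xi indicE mem_set ?mulr1.
have Gxi k : Gphi k (xi k) by exact: (gspace_ae hW (mxi k) (exi k) (GW k)).
exists xi; split => //.
- move=> k; have [mW _] := sW k.
  rewrite -(ae_dot mW (mxi k) (mxi k) (exi k)) dotC.
  by rewrite -(ae_dot mW (mxi k) mW (exi k)).
- move=> w; have [Nw|Nw] := pselect (N w).
    exists 0 => n; rewrite big1// => k _.
    by rewrite /xi indicE memNset ?mulr0 ?expr0n//; apply.
  have [K' HK'] : exists K', forall n, \sum_(k < n) (s k * W 1 (phi k) w) ^+ 2 <= K'.
    by apply: contrapT => /= h; apply: Nw; exact: QN.
  exists K' => n; rewrite (eq_bigr (fun k : 'I_n => (s k * W 1 (phi k) w) ^+ 2)); first exact: HK'.
  by move=> k _; rewrite /xi indicE mem_set ?mulr1.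
Qed.


(** The domination of [tau k t ^+ 2] by [C * s k ^+ 2] gives, at each sample point, a summable
    majorant that is independent of [t]. The given process [X] enters only through the variances of
    its coordinates. *)
Lemma gaussian_series_weak_limit (s : nat -> R) (tau : nat -> R -> R)
    (X : R -> Omega -> L2 mu) (C K : R) : 1 <= C ->
  (forall n, \sum_(k < n) s k ^+ 2 <= K) -> (exists k, s k != 0) ->
  (forall k t, tau k t ^+ 2 <= C * s k ^+ 2) ->
  (forall k, tau k t @[t --> +oo] --> s k) ->
  (forall k t, Gphi k (coord (X t) k)) ->
  (forall k t, dot P (coord (X t) k) (coord (X t) k) = tau k t ^+ 2) ->
  exists2 nu : probability (Borel (L2 mu)) R, weak_limit P X nu & nontrivial nu.
Proof.
move=> C1 sK [k0 sk0] tauC tauc GX vX.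
have [xi [Gxi vxi xiK]] := white_noise_modification sK.
(* Riesz-Fischer at each sample point; summability at every [w] makes this possible. *)
have series (c : nat -> R) : (forall k, c k ^+ 2 <= C * s k ^+ 2) ->
    exists U : Omega -> L2 mu, forall w k, dot mu (U w) (phi k) = c k * xi k w.
  move=> cC.
  have /choice[U UE] : forall w, exists U : L2 mu, forall k, dot mu U (phi k) = c k * xi k w.
    move=> w; have [K' HK'] := xiK w.
    apply: (@riesz_fischer _ _ _ mu phi orth _ (C * K')) => n.
    apply: le_trans (_ : C * \sum_(k < n) (s k * xi k w) ^+ 2 <= _).
      rewrite mulr_sumr; apply: ler_sum => k _.
      by rewrite !exprMn [leRHS]mulrA ler_wpM2r// sqr_ge0.
    by rewrite ler_wpM2l// (le_trans ler01).
  by exists U.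
have /choice[U UE] : forall t, exists U : Omega -> L2 mu,
    forall w k, dot mu (U w) (phi k) = tau k t * xi k w.
  by move=> t; exact: series.
have [V VE] : exists V : Omega -> L2 mu, forall w k, dot mu (V w) (phi k) = s k * xi k w.
  by apply: series => k; rewrite -[leLHS]mul1r ler_wpM2r ?sqr_ge0.
have Gcoord (Z : Omega -> L2 mu) (c : nat -> R) :
    (forall w k, dot mu (Z w) (phi k) = c k * xi k w) ->
    (forall k, Gphi k (coord Z k)) /\
    (forall k, dot P (coord Z k) (coord Z k) = c k ^+ 2).
  move=> ZE; have e k : coord Z k = (fun w => c k * xi k w) by apply/funext => w; exact: ZE.
  have sx k : sqint P (xi k) by have [] := Gxi k.
  split=> k; rewrite e; first exact: (gspaceZ hW).
  rewrite (dotZl _ (sx k) (sqintZ _ (sx k))) (dotZr _ (sx k) (sx k)) vxi; ring.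
have mL2 (Z : Omega -> L2 mu) : (forall k, Gphi k (coord Z k)) ->
    measurable_fun setT (Z : Omega -> Borel (L2 mu)).
  by move=> GZ; apply: (measurable_L2 orth complete) => k; have [[]] := GZ k.
have [GV vV] := Gcoord V s VE.
have mV := mL2 V GV.
pose nu := distribution P (mfun_Sub (mem_set mV)).
have nuE (g : L2 mu -> R) : continuous g -> (exists K, forall x, `|g x| <= K) ->
    (\int[nu]_x (g x)%:E = (\int[P]_w g (V w))%:E)%E.
  move=> cg [Kg gK].
  have mg : measurable_fun setT (fun w => g (V w)).
    exact: measurableT_comp (measurable_continuous_L2 cg) mV.
  have ig : P.-integrable setT (EFin \o (g \o V)).
    by apply: (@bounded_integrable _ _ _ P _ Kg mg) => w; exact: gK.
  rewrite [LHS]integral_pushforward//; last first.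
    by apply/measurable_EFinP; exact: (measurable_continuous_L2 cg).
  by rewrite /Rintegral fineK//; exact: integrable_fin_num.
exists nu; last first.
  (* For a point mass at [x] the cosine of the coordinate centred at [x] has mean 1; for a Gaussian
     coordinate of positive variance the mean is smaller. *)
  move=> [x nux]; pose th := - dot mu x (phi k0).
  pose g (y : L2 mu) := cos (1 * dot mu y (phi k0) + th).
  have cg : continuous g by exact: continuous_cos_dotL2.
  have gb : exists K : R, forall y, `|g y| <= K by exists 1 => y; exact: norm_cos_le1.
  have := nuE g cg gb.
  have mg : measurable_fun setT (g : Borel (L2 mu) -> R).
    exact: (measurable_continuous_L2 cg).
  rewrite (eq_measure_integral (\d_x)); last by move=> A mA _; exact: nux.
  rewrite integral_dirac//; last exact/measurable_EFinP.
  rewrite diracT mul1e => -[]; rewrite (gspace_gaussian hW (GV k0) 1 th) vV.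
  rewrite /g mul1r subrr cos0 expr1n mul1r => e1.
  have : expR (- (s k0 ^+ 2 / 2)) * cos th < 1.
    have e0 : expR (- (s k0 ^+ 2 / 2)) < 1.
      by rewrite -expR0 ltr_expR oppr_lt0 divr_gt0// exprn_even_gt0.
    apply: le_lt_trans e0; rewrite -[leRHS]mulr1 ler_wpM2l ?expR_ge0//.
  by rewrite -e1 ltxx.
move=> g cg bg; have [Kg gK] := bg.
rewrite nuE//.
have mg (Z : Omega -> L2 mu) : (forall k, Gphi k (coord Z k)) -> measurable_fun setT (fun w => g (Z w)).
  move=> GZ.
  exact: measurableT_comp (measurable_continuous_L2 cg) (mL2 Z GZ).
have EE t : 'E_P[fun w => g (X t w)]%E = (\int[P]_w g (U t w))%:E.
  have [GU vU] := Gcoord (U t) (tau^~ t) (UE t).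
  rewrite -(gspace_law_unique (GX^~ t) GU)//; last by move=> k; rewrite vX vU.
  rewrite unlock /Rintegral fineK//; apply: integrable_fin_num => //.
  by apply: (@bounded_integrable _ _ _ P _ Kg (mg _ (GX^~ t))) => w; exact: gK.
under eq_fun do rewrite EE.
apply: cvg_EFin; first by apply: nearW.
(* The limit at infinity is tested along sequences, where dominated convergence applies. *)
apply/cvg_pinftyP => tn tnoo /=.
apply: (bmeas_dominated_cvg (K := Kg)) => //.
  by move=> n; apply: mg; have [] := Gcoord (U (tn n)) (tau^~ (tn n)) (UE (tn n)).
move=> w; suff cU : U (tn n) w @[n --> \oo] --> V w.
  exact: (cvg_comp _ _ cU (cg (V w))).
have [K' HK'] := xiK w.
(* The factor [4 * C] comes from (a - b)^2 <= 2 a^2 + 2 b^2 with a^2 <= C b^2 and 1 <= C. *)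
apply: (L2_dominated_cvg orth complete (m := fun k => 4 * C * (s k * xi k w) ^+ 2) (K := 4 * C * K')).
- move=> n; rewrite -mulr_sumr ler_wpM2l//.
  by rewrite mulr_ge0// (le_trans ler01).
- move=> n k; rewrite UE VE -mulrBl !exprMn [leRHS]mulrA ler_wpM2r ?sqr_ge0//.
  have := tauC k (tn n); have := sqr_ge0 (tau k (tn n) + s k); have := sqr_ge0 (s k).
  set a := tau k (tn n); set b := s k => b0 ab0 aC.
  have bC : b ^+ 2 <= C * b ^+ 2 by rewrite -[leLHS]mul1r ler_wpM2r.
  nra.
- move=> k; rewrite VE; under eq_fun do rewrite UE.
  apply: cvgMl; exact: (cvg_comp _ _ tnoo (tauc k)).
Qed.


(** * Coordinates and variances of the solution *)

Section SeriesProcess.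
Variables (Y : nat -> R -> {RV P >-> R}) (u : R -> Omega -> L2 mu).
Hypothesis hu : series_process P Y phi u.
Hypothesis YG : forall k t, 0 <= t -> Gphi k (Y k t).

Let S n t w := \sum_(k < n) Y k t w *: phi k.

Lemma series_remainder_measurable n t : 0 <= t ->
  measurable_fun setT ((fun w => u t w - S n t w) : Omega -> Borel (L2 mu)).
Proof.
move=> t0; apply: (measurable_L2 orth complete) => k.
under eq_fun do rewrite dotL2B (dotL2_span orth (fun k => Y k t _)).
apply: measurable_funB.
  exact: measurable_dotL2 (hu t0).1.
by case: (k < n)%N; [exact: measurable_funPT|exact: measurable_cst].
Qed.

Lemma series_remainder_norm n t : 0 <= t ->
  measurable_fun setT (fun w => `|u t w - S n t w|).
Proof.
move=> t0; exact: measurableT_comp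
  (measurable_continuous_L2 (@norm_continuous _ (L2 mu)))
  (series_remainder_measurable n t0).
Qed.

(** For [n > k] the difference of the two sides is the k-th coordinate of the remainder of the
    series, so its mean square is at most that of the remainder, which tends to 0. *)
Lemma series_coord t k : 0 <= t ->
  (Y k t : Omega -> R) = coord (u t) k %[ae P].
Proof.
move=> t0; have [mu_t c] := hu t0; rewrite unlock in c.
have mc : measurable_fun setT (coord (u t) k).
  exact: measurable_dotL2 mu_t.
pose D w := dot mu (u t w) (phi k) - Y k t w.
have mD : measurable_fun setT D by apply: measurable_funB.
have D0 : (\int[P]_w (D w ^+ 2)%:E <= 0)%E.
  apply: (cvge_to_ge c); exists k.+1 => // n /= kn.
  apply: ge0_le_integral => //.
  - by move=> w _; rewrite lee_fin sqr_ge0.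
  - by apply/measurable_EFinP; exact: measurable_funX.
  - by apply/measurable_EFinP; apply: measurable_funX; exact: series_remainder_norm.
  move=> w _; rewrite lee_fin.
  have -> : D w = dot mu (u t w - S n t w) (phi k).
    by rewrite dotL2B (dotL2_span orth (fun k => Y k t w)) kn.
  have := norm_dotL2_le (u t w - S n t w) (phi k).
  rewrite (norm_phi orth) mulr1 => h.
  by rewrite -[leLHS]real_normK ?num_real// lerXn2r// nnegrE.
have D00 : (\int[P]_w (D w ^+ 2)%:E = 0)%E.
  by apply/eqP; rewrite eq_le D0 integral_ge0// => w _; rewrite lee_fin sqr_ge0.
have sD : sqint P D by apply: sqint_lty => //; rewrite D00 ltry.
have : dot P D D = 0 by apply: EFin_inj; rewrite -dot_EFin.
move=> /(dot_eq0_ae sD); apply: filterS => w /= h _.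
by have /eqP := h Logic.I; rewrite /D subr_eq0 => /eqP.
Qed.

Lemma series_coord_gspace t k : 0 <= t ->
  Gphi k (coord (u t) k) /\ dot P (coord (u t) k) (coord (u t) k) = dot P (Y k t) (Y k t).
Proof.
move=> t0; have mc : measurable_fun setT (coord (u t) k).
  exact: measurable_dotL2 (hu t0).1.
split; first exact: (gspace_ae hW mc (series_coord k t0) (YG k t0)).
have mY : measurable_fun setT (Y k t) by exact: measurable_funPT.
have e := series_coord k t0.
by rewrite -(ae_dot mY mc mc e) dotC -(ae_dot mY mc mY e).
Qed.

(** Bessel's inequality bounds the sum of the variances by the mean of [|u t|^2]. This mean is
    finite because some remainder has finite mean square and the partial sum before it is a finite
    sum. *)
Lemma series_var_bounded t : 0 <= t ->
  exists K, forall n, \sum_(k < n) dot P (Y k t) (Y k t) <= K.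
Proof.
move=> t0; have [mu_t c] := hu t0; rewrite unlock in c.
have [n0 fin0] : exists n0, (\int[P]_w (`|u t w - S n0 t w| ^+ 2)%:E < +oo)%E.
  have [[n0 _ h] _] := (fine_cvgP _ _).1 c; exists n0.
  by have := h n0 (leqnn _); rewrite fin_numElt => /andP[].
pose N w := `|u t w - S n0 t w|.
have sN : sqint P N by apply: sqint_lty => //; exact: series_remainder_norm.
have sY k : sqint P (Y k t) by have [] := YG k t0.
(* From (a + b)^2 <= 2 a^2 + 2 b^2 applied to the remainder and the partial sum. *)
pose G w := 2 * N w ^+ 2 + 2 * \sum_(k < n0) Y k t w ^+ 2.
have iG : P.-integrable setT (EFin \o G).
  have [_ iN] := sN; have [iY _] := sum_dot_Rintegral n0 sY.
  have := integrableD measurableT (integrableZl measurableT 2 iN)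
    (integrableZl measurableT 2 iY).
  by apply: eq_integrable.
exists (\int[P]_w G w) => n.
have sC k : sqint P (coord (u t) k) by have [[]] := series_coord_gspace k t0.
have [iS eS] := sum_dot_Rintegral n sC.
rewrite (eq_bigr (fun k : 'I_n => dot P (coord (u t) k) (coord (u t) k))); last first.
  by move=> k _; have [_ ->] := series_coord_gspace k t0.
rewrite -eS; apply: le_Rintegral => // w _.
apply: le_trans (bessel orth (u t w) n) _.
rewrite /G /N -(norm_span_sq orth (fun k => Y k t w)) -/(S n0 t w).
have := ler_normD (u t w - S n0 t w) (S n0 t w); rewrite subrK => h.
have h2 : `|u t w| ^+ 2 <= (`|u t w - S n0 t w| + `|S n0 t w|) ^+ 2.
  by rewrite lerXn2r// nnegrE// addr_ge0.
apply: le_trans h2 _.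
have := sqr_ge0 (`|u t w - S n0 t w| - `|S n0 t w|).
by move: `|u t w - S n0 t w| `|S n0 t w| => a b; nra.
Qed.

End SeriesProcess.

End GaussianSeries.

(** * The rescaled solution *)

Section OscillatorAsymptotics.
Context (R : realType).

(** The main term is twice 1/(4l), and the error is at most 1/(4l). *)
Lemma osc_var_bounds (l t : R) : 0 < l -> 0 < t -> 1 <= Num.sqrt l * t ->
  (4 * l)^-1 <= osc_var l t / t <= 3 * (4 * l)^-1.
Proof.
move=> l0 t0 lt1; have := osc_var_dist l0 t0.
have i0 : 0 <= (4 * l)^-1 by rewrite invr_ge0 mulr_ge0// ltW.
have -> : (2 * l)^-1 = 2 * (4 * l)^-1 by field; rewrite gt_eqF.
have : (Num.sqrt l * t)^-1 <= 1 by rewrite invf_le1// (lt_le_trans ltr01).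
move=> h h'; have {h h'} : `|osc_var l t / t - 2 * (4 * l)^-1| <= (4 * l)^-1.
  by apply: le_trans h' _; rewrite -[leRHS]mulr1 ler_wpM2l.
by rewrite ler_distl => /andP[h1 h2]; apply/andP; split; lra.
Qed.

Lemma osc_var_cvg (l : R) : 0 < l -> osc_var l t / t @[t --> +oo] --> (2 * l)^-1.
Proof.
move=> l0; apply/cvgrPdist_le => e e0; near=> t.
have t0 : 0 < t by near: t; exact: nbhs_pinfty_gt.
rewrite distrC; apply: le_trans (osc_var_dist l0 t0) _.
have sl : 0 < Num.sqrt l by rewrite sqrtr_gt0.
have i0 : 0 < (4 * l)^-1 by rewrite invr_gt0 mulr_gt0.
have e1 : 0 < (4 * l)^-1^-1 * e by rewrite mulr_gt0// invr_gt0.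
rewrite -ler_pdivlMl// -[leRHS]invrK lef_pV2 ?posrE ?mulr_gt0 ?invr_gt0//.
by rewrite -ler_pdivrMl//; near: t; exact: nbhs_pinfty_ge (num_real _).
Unshelve. all: by end_near. Qed.

End OscillatorAsymptotics.

Section RescaledSolution.
Context d (Omega : measurableType d) (R : realType) (P : probability Omega R).
Context d' (T : measurableType d') (mu : probability T R).
Variable W : R -> L2 mu -> {RV P >-> R}.
Hypothesis hW : cylindrical_wiener W.
Variable phi : nat -> L2 mu.
Hypothesis orth : forall i j, dot mu (phi i) (phi j) = (i == j)%:R.
Hypothesis complete : forall f : L2 mu,
  \sum_(k < n) dot mu f (phi k) *: phi k @[n --> \oo] --> f.
Variables (Y : nat -> R -> {RV P >-> R}) (u : R -> Omega -> L2 mu).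
Hypothesis hu : series_process P Y phi u.
Hypothesis YG : forall k t, 0 <= t -> gspace W [set phi k] (Y k t).
Variable lambda : nat -> R.
Hypothesis Yv : forall k t, 0 < t -> dot P (Y k t) (Y k t) = osc_var (lambda k) t.

Local Notation Gphi k := (gspace W [set phi k]).
Local Notation coord X k := (fun w => dot mu (X w) (phi k)).

Let X k0 t w := u t w - \sum_(k < k0) Y k t w *: phi k.

(** Along a removed mode the coordinate vanishes only almost everywhere; it belongs to the Gaussian
    space as a null modification of 0. *)
Lemma remainder_coord k0 k t : 0 <= t -> Gphi k (coord (X k0 t) k) /\
  dot P (coord (X k0 t) k) (coord (X k0 t) k) =
  if (k < k0)%N then 0 else dot P (Y k t) (Y k t).
Proof.
move=> t0; have XE w : dot mu (X k0 t w) (phi k) =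
    dot mu (u t w) (phi k) - (if (k < k0)%N then Y k t w else 0).
  by rewrite dotL2B (dotL2_span orth (fun k => Y k t w)).
have [Gu vu] := series_coord_gspace hW orth complete hu YG k t0.
case: (k < k0)%N XE => XE; last first.
  rewrite (_ : (fun w => dot mu (X k0 t w) _) = coord (u t) k); first by split.
  by apply/funext => w; rewrite XE subr0.
have mX : measurable_fun setT (coord (X k0 t) k).
  apply: measurable_dotL2; exact: (series_remainder_measurable orth complete hu).
have X0 : (fun=> 0) = coord (X k0 t) k %[ae P].
  have := series_coord orth complete hu k t0.
  by apply: filterS => w /= h _; rewrite XE h// subrr.
split; first exact: (gspace_ae (X := fun=> 0) hW mX X0 (gspace0 W _)).
by rewrite -(ae_dot (f := fun=> 0) _ mX mX X0) ?dot0l//; exact: measurable_cst.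
Qed.

Hypothesis lambda_nd : nondecreasing_seq lambda.

(** [k0] counts the removed modes. As the eigenvalues are nondecreasing, positivity of [lambda k0]
    bounds all the remaining ones away from 0. *)
Lemma rescaled_weak_limit k0 : 0 < lambda k0 ->
  exists2 nu : probability (Borel (L2 mu)) R,
    weak_limit P (fun t w => (Num.sqrt t)^-1 *: X k0 t w) nu & nontrivial nu.
Proof.
(* From time [t1] on, sqrt (lambda k) t >= 1 holds for all remaining modes at once. *)
move=> l0; pose t1 := (Num.sqrt (lambda k0))^-1.
have t10 : 0 < t1 by rewrite invr_gt0 sqrtr_gt0.
(* Times below [t1] are replaced by [t1], so that the bounds hold for every [t]; the limit at
   infinity is unaffected. *)
pose m t := Num.max t t1.
have m0 t : 0 < m t by rewrite lt_max t10 orbT.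
have mt1 t : t1 <= m t by rewrite le_max lexx orbT.
have lk k : (k0 <= k)%N -> 0 < lambda k by move=> kk; exact: lt_le_trans l0 (lambda_nd kk).
have big k t : (k0 <= k)%N -> t1 <= t -> 1 <= Num.sqrt (lambda k) * t.
  move=> kk t1t.
  have := ler_pM (sqrtr_ge0 (lambda k0)) (ltW t10) (ler_wsqrtr (lambda_nd kk)) t1t.
  by rewrite /t1 divff// gt_eqF// sqrtr_gt0.
pose s k := if (k < k0)%N then 0 else Num.sqrt (2 * lambda k)^-1.
pose tau k t := if (k < k0)%N then 0 else Num.sqrt (osc_var (lambda k) (m t) / m t).
have s2 k : (k0 <= k)%N -> s k ^+ 2 = (2 * lambda k)^-1.
  move=> kk; rewrite /s ltnNge kk/= sqr_sqrtr// invr_ge0 mulr_ge0// ltW//; exact: lk.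
have bnd k t : (k0 <= k)%N -> t1 <= t ->
    (4 * lambda k)^-1 <= osc_var (lambda k) t / t <= 3 * (4 * lambda k)^-1.
  move=> kk tt; apply: osc_var_bounds; [exact: lk|exact: lt_le_trans tt|exact: big].
have i4 k : (k0 <= k)%N -> 0 < (4 * lambda k)^-1.
  by move=> kk; rewrite invr_gt0 mulr_gt0//; exact: lk.
have i24 k : (k0 <= k)%N -> (2 * lambda k)^-1 = 2 * (4 * lambda k)^-1.
  by move=> kk; field; rewrite gt_eqF//; exact: lk.
have tau2 k t : (k0 <= k)%N -> tau k t ^+ 2 = osc_var (lambda k) (m t) / m t.
  move=> kk; rewrite /tau ltnNge kk/= sqr_sqrtr//.
  have /andP[h _] := bnd k (m t) kk (mt1 t).
  by apply: le_trans h; exact: ltW (i4 _ kk).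
have [nu wl nt] : exists2 nu : probability (Borel (L2 mu)) R,
    weak_limit P (fun t w => (Num.sqrt (m t))^-1 *: X k0 (m t) w) nu & nontrivial nu.
  have [K0 HK0] := series_var_bounded hW orth complete hu YG (ltW t10).
  (* [C] is 2 because 3/(4l) <= 2/(2l). For [K]: 1/(2l) is at most 2/t1 times the variance at time
     [t1], and these variances have sums at most [K0]. *)
  apply: (gaussian_series_weak_limit hW orth complete (s := s) (tau := tau)
    (C := 2) (K := 2 / t1 * K0)).
  - by rewrite ler1n.
  - move=> n; apply: le_trans (_ : 2 / t1 * \sum_(k < n) dot P (Y k t1) (Y k t1) <= _).
      rewrite mulr_sumr; apply: ler_sum => k _.
      have [kk|kk] := ltnP k k0.
        rewrite /s kk expr0n/= mulr_ge0 ?divr_ge0 ?(ltW t10)//; exact: dot_ge0.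
      rewrite s2// i24// Yv// -mulrA ler_wpM2l// [leRHS]mulrC.
      by have /andP[] := bnd k t1 kk (lexx _).
    by rewrite ler_wpM2l// divr_ge0// ltW.
  - exists k0; rewrite /s ltnn gt_eqF// sqrtr_gt0 invr_gt0 mulr_gt0//.
  - move=> k t; have [kk|kk] := ltnP k k0.
      by rewrite /tau kk expr0n/= mulr_ge0// sqr_ge0.
    rewrite tau2// s2// i24//.
    have /andP[_ h] := bnd k (m t) kk (mt1 t).
    have := i4 k kk; lra.
  - move=> k; rewrite /tau /s; case: ltnP => kk; first exact: cvg_cst.
    apply: (@continuous_cvg _ _ _ _ _ (fun t => osc_var (lambda k) (m t) / m t)).
      exact: sqrt_continuous.
    have := osc_var_cvg (lk k kk); apply: cvg_trans; apply: near_eq_cvg.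
    by near=> t; rewrite /m max_l//; near: t; exact: nbhs_pinfty_ge (num_real _).
  - move=> k t; have [G _] := remainder_coord k0 k (ltW (m0 t)).
    rewrite (_ : (fun w => _) = fun w => (Num.sqrt (m t))^-1 * dot mu (X k0 (m t) w) (phi k)).
      exact: gspaceZ.
    by apply/funext => w; rewrite dotL2Z.
  - move=> k t; have [G v] := remainder_coord k0 k (ltW (m0 t)).
    have [sX _] := G.
    rewrite (_ : (fun w => _) = fun w => (Num.sqrt (m t))^-1 * dot mu (X k0 (m t) w) (phi k)).
      rewrite (dotZl _ sX (sqintZ _ sX)) (dotZr _ sX sX) v mulrA -expr2 exprVn.
      rewrite sqr_sqrtr ?(ltW (m0 t))//.
      have [kk|kk] := ltnP k k0; first by rewrite /tau kk expr0n mulr0.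
      by rewrite tau2// Yv// mulrC.
    by apply/funext => w; rewrite dotL2Z.
exists nu => // g cg bg; apply: cvg_trans (wl g cg bg); apply: near_eq_cvg.
by near=> t; rewrite /m max_l//; near: t; exact: nbhs_pinfty_ge (num_real _).
Unshelve. all: by end_near. Qed.

(** The bound 1/2 on the characteristic function along [phi 0] at every nonzero frequency is enough:
    at frequencies 1/(n+1), bounded convergence forces the limit 1. *)
Lemma no_weak_limit : lambda 0%N = 0 ->
  ~ exists nu : probability (Borel (L2 mu)) R,
      weak_limit P (fun t w => (Num.sqrt t)^-1 *: u t w) nu.
Proof.
move=> l0 [nu wl].
pose g c (y : L2 mu) := cos (c * dot mu y (phi 0%N) + 0).
have gb c : exists K : R, forall y, `|g c y| <= K by exists 1 => y; exact: norm_cos_le1.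
have mg c : measurable_fun setT (g c : Borel (L2 mu) -> R).
  by apply: measurable_continuous_L2; exact: continuous_cos_dotL2.
have half c : c != 0 -> \int[nu]_y g c y <= 2^-1.
  move=> c0; rewrite -lee_fin {1}/Rintegral fineK; last first.
    apply: integrable_fin_num => //.
    by apply: (@bounded_integrable _ _ _ nu _ 1 (mg c)) => y; exact: norm_cos_le1.
  have /cvge_to_le := wl (g c) (@continuous_cos_dotL2 _ _ _ mu (phi 0%N) c 0) (gb c); apply.
  near=> t.
  have t0 : 0 < t by near: t; exact: nbhs_pinfty_gt.
  have [G v] := series_coord_gspace hW orth complete hu YG 0 (ltW t0).
  have := gspace_gaussian hW G (c / Num.sqrt t) 0; rewrite v Yv// l0 cos0 mulr1 => e.
  rewrite unlock (_ : (\int[P]_w _)%E = (expR (- (c ^+ 2 * t ^+ 2 / 6)))%:E).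
    rewrite lee_fin expRN; apply: le_trans (_ : (1 + c ^+ 2 * t ^+ 2 / 6)^-1 <= _).
      rewrite lef_pV2 ?posrE ?expR_gt0//; first exact: expR_ge1Dx.
      by rewrite ltr_pwDl// mulr_ge0// mulr_ge0// sqr_ge0.
    have c20 : 0 < c ^+ 2 by rewrite exprn_even_gt0.
    have t1 : 1 <= t by near: t; exact: nbhs_pinfty_ge (num_real _).
    (* Together with [1 <= t] this gives 6 <= c^2 t^2, so that exp (- c^2 t^2 / 6) <= 1 / (1 + c^2
       t^2 / 6) <= 1/2. *)
    have tc : 6 / c ^+ 2 <= t by near: t; exact: nbhs_pinfty_ge (num_real _).
    rewrite lef_pV2 ?posrE//; last by rewrite ltr_pwDl// mulr_ge0// mulr_ge0// sqr_ge0.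
    have h : 6 <= c ^+ 2 * t ^+ 2.
      rewrite -ler_pdivrMl// mulrC; apply: le_trans tc _.
      by rewrite expr2 -[leLHS]mulr1 ler_wpM2l// ltW.
    lra.
  have mu0 : measurable_fun setT (fun w => dot mu (u t w) (phi 0%N)) by have [[]] := G.
  have iu : P.-integrable setT (EFin \o (fun w => g c ((Num.sqrt t)^-1 *: u t w))).
    apply: (@bounded_integrable _ _ _ P _ 1); last by move=> y; exact: norm_cos_le1.
    rewrite (_ : (fun w => _) = fun w => cos (c / Num.sqrt t * dot mu (u t w) (phi 0%N) + 0)).
      by apply: (bmeas_cos _).1; apply: measurable_funD => //; exact: measurable_funM.
    by apply/funext => w; rewrite /g dotL2Z mulrA.
  rewrite -[LHS]fineK; last exact: integrable_fin_num.
  congr EFin; transitivity (expR (- ((c / Num.sqrt t) ^+ 2 * osc_var 0 t / 2))); last first.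
    congr (expR (- _)); rewrite /osc_var eqxx expr_div_n sqr_sqrtr ?(ltW t0)//; field.
    by rewrite gt_eqF.
  rewrite -e; apply: eq_Rintegral => w _; rewrite /g dotL2Z mulrA//.
have c1 : \int[nu]_y g n.+1%:R^-1 y @[n --> \oo] --> \int[nu]_y (1 : R).
  apply: (bmeas_dominated_cvg (K := 1)) => //.
    by move=> n y; exact: norm_cos_le1.
  move=> y; rewrite /g.
  have h : n.+1%:R^-1 * dot mu y (phi 0%N) + 0 @[n --> \oo] --> (0 : R).
    rewrite [X in _ --> X](_ : 0 = 0 * dot mu y (phi 0%N) + 0); last by rewrite mul0r addr0.
    apply: cvgD; last exact: cvg_cst.
    by apply: cvgMl; exact: cvg_harmonic.
  have := cvg_comp _ _ h (@continuous_cos R 0); rewrite cos0; exact.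
have : 1 <= (2^-1 : R).
  rewrite -[leLHS](Rintegral_prob_cst nu).
  apply: (cvgr_to_le c1); apply: nearW => n; apply: half.
  by rewrite invr_eq0 pnatr_eq0.
lra.
Unshelve. all: by end_near. Qed.

(** The coordinates of [Z t] are measurable for the sigma-algebra of the cylinders of the Gaussian
    space, hence so is [Z t], by [measurable_L2]. This covers all times together. *)
Lemma process_sigma_gspace (A : set (L2 mu)) (Z : R -> Omega -> L2 mu) :
  (forall k t, 0 <= t -> gspace W A (coord (Z t) k)) ->
  process_sigma Z `<=` <<s rv_cylinder (gspace W A) >>.
Proof.
move=> GZ; apply: smallest_sub; first exact: smallest_sigma_algebra.
move=> _ [t t0 [B mB ->]].
have mZ : measurable_fun setT
    (Z t : g_sigma_algebraType (rv_cylinder (gspace W A)) -> Borel (L2 mu)).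
  apply: (measurable_L2 orth complete) => k _ D mD; rewrite setTI.
  apply: sub_sigma_algebra; exists 1%N, (fun=> coord (Z t) k), (fun=> D); split => //.
    by move=> _; exact: GZ.
  by apply/seteqP; split => w /=; [|move=> h; exact: (h 0%N)].
by have := mZ measurableT B mB; rewrite setTI.
Qed.

Lemma process_gspace (A : set (L2 mu)) (Z : R -> Omega -> L2 mu) :
  (forall k t, 0 <= t -> gspace W A (coord (Z t) k)) -> process Z.
Proof.
by move=> GZ t t0; apply: (measurable_L2 orth complete) => k; have [[]] := GZ k t t0.
Qed.

Lemma independent_remainder :
  [/\ process (fun t w => u t w - Y 0%N t w *: phi 0%N),
      process (fun t w => Y 0%N t w *: phi 0%N) &
      independent_processes P (fun t w => u t w - Y 0%N t w *: phi 0%N)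
                              (fun t w => Y 0%N t w *: phi 0%N)].
Proof.
(* The directions of the higher modes, all orthogonal to [phi 0]. *)
pose A := [set f | exists2 k, (0 < k)%N & f = phi k].
have G1 k t : 0 <= t -> gspace W A (coord (fun w => u t w - Y 0%N t w *: phi 0%N) k).
  move=> t0; have [GX vX] := remainder_coord 1 k t0.
  have XE w : X 1 t w = u t w - Y 0%N t w *: phi 0%N by rewrite /X big_ord1.
  rewrite (_ : (fun w => dot mu _ _) = coord (X 1 t) k); last first.
    by apply/funext => w; rewrite XE.
  (* Along [phi 0] the remainder has variance 0, so its coordinate is a null modification of 0 and
     lies in the space of [A] as well. *)
  case: k GX vX => [|k] GX vX; last first.
    by apply: gspaceS GX => f ->; exists k.+1.
  have [sX _] := GX; have [mX _] := sX.
  have X0 : (fun=> 0) = coord (X 1 t) 0 %[ae P].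
    by have := dot_eq0_ae sX vX; apply: filterS => w /= h /h ->.
  exact: (gspace_ae (X := fun=> 0) hW mX X0 (gspace0 W A)).
have G2 k t : 0 <= t -> Gphi 0 (coord (fun w => Y 0%N t w *: phi 0%N) k).
  move=> t0; rewrite (_ : (fun w => _) = fun w => (0%N == k)%:R * Y 0%N t w).
    by apply: (gspaceZ hW); exact: YG.
  by apply/funext => w; rewrite dotL2Z orth mulrC.
split; [exact: process_gspace G1|exact: process_gspace G2|].
move=> E E' /(process_sigma_gspace G1) hE /(process_sigma_gspace G2) hE'.
apply: (gspace_indep hW _ hE hE') => _ _ [k k0 ->] ->.
by rewrite orth gtn_eqF.
Qed.

End RescaledSolution.

Theorem theorem5p1 (R : realType) (F : pointedMetricType R) (M : nat)
    (psi : 'I_M -> F -> F) (pi : (nat -> 'I_M) -> F)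
    (hF : pcf_self_similar psi pi)
    (a : F -> F -> R) (r : 'I_M -> R)
    (har : regular_harmonic_structure psi pi a r)
    (dH : R) (hdH : \sum_(i < M) r i `^ dH = 1)
    (mu : probability (Borel F) R) (hmu : self_similar_measure psi r dH mu)
    (b : set F) (hb : b `<=` boundary psi pi)
    (phi : nat -> L2 mu) (lambda : nat -> R)
    (hphi : eigenbasis psi pi a r b phi lambda)
    (d : measure_display) (Omega : measurableType d) (P : probability Omega R)
    (W : R -> L2 mu -> {RV P >-> R}) (hW : cylindrical_wiener W)
    (V : R -> R -> R -> R)
    (hV : forall beta l, 0 <= beta -> 0 <= l ->
      damped_oscillator beta l (V beta l))
    (Y : nat -> R -> {RV P >-> R})
    (hY : forall k t, 0 <= t ->
      wiener_integral P (fun s => W s (phi k)) t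
        (fun s => V 0 (lambda k) (t - s)) (Y k t))
    (u : R -> Omega -> L2 mu)
    (hu : series_process P Y phi u) :
  (b <> boundary psi pi ->
    exists2 nu : probability (Borel (L2 mu)) R,
      weak_limit P (fun t w => (Num.sqrt t)^-1 *: u t w) nu & nontrivial nu) /\
  (b = boundary psi pi ->
    [/\ ~ (exists nu : probability (Borel (L2 mu)) R,
            weak_limit P (fun t w => (Num.sqrt t)^-1 *: u t w) nu),
        process (fun t w => u t w - Y 0%N t w *: phi 0%N),
        process (fun t w => Y 0%N t w *: phi 0%N),
        independent_processes P (fun t w => u t w - Y 0%N t w *: phi 0%N)
                                (fun t w => Y 0%N t w *: phi 0%N) &
        exists2 nu : probability (Borel (L2 mu)) R,
          weak_limit P
            (fun t w => (Num.sqrt t)^-1 *: (u t w - Y 0%N t w *: phi 0%N)) nu &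
          nontrivial nu]).
Proof.
have orth := eb_orthonormal hphi.
have complete := eb_complete hphi.
have l0 k : 0 <= lambda k := lambda_ge0 hphi k.
have mY k t : measurable_fun setT (Y k t) by exact: measurable_funPT.
have YG k t : 0 <= t -> gspace W [set phi k] (Y k t).
  by move=> t0; exact: (wiener_integral_gspace hW (mY k t) (hY k t t0)).
(* For [s] in [[0, t]] the argument [t - s] is nonnegative, which is where the equation determines
   the solution. *)
have Vosc k t s : s \in `[0, t]%classic -> V 0 (lambda k) (t - s) = osc (lambda k) (t - s).
  rewrite inE/= in_itv/= => /andP[_ st].
  by apply: (oscillator_unique (l0 k) (hV 0 _ (lexx 0) (l0 k))); rewrite subr_ge0.
have Yv k t : 0 < t -> dot P (Y k t) (Y k t) = osc_var (lambda k) t.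
  move=> t0; transitivity (dot mu (phi k) (phi k) * osc_var (lambda k) t); last first.
    by rewrite orth eqxx mul1r.
  apply: (wiener_integral_var hW (mY k t) _ _ (hY k t (ltW t0))).
    have co : continuous (fun s => osc (lambda k) (t - s)).
      move=> s; apply: (@continuous_comp _ _ _ (fun s => t - s)); last exact: continuous_osc.
      by apply: cvgB; [exact: cvg_cst|exact: cvg_id].
    have := measurable_funTS (continuous_measurable_fun co) (D := `[0, t]%classic).
    by apply: eq_measurable_fun => s st; rewrite Vosc.
  rewrite -integral_osc_sq//; apply: eq_integral => s st.
  by rewrite Vosc.
split=> [bN|bN].
  (* No mode is removed: [k0 = 0], and the subtracted sum is empty. *)
  have [nu wl nt] := rescaled_weak_limit hW orth complete hu YG Yv
    (eb_nondecreasing hphi) (lambda_gt0_dirichlet hF har hphi 0%N hb bN).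
  exists nu => //; move: wl; under eq_fun do under eq_fun do rewrite big_ord0 subr0.
  exact.
have [l00 l1] := lambda_neumann hF har hphi bN.
have [p1 p2 ind] := independent_remainder hW orth complete hu YG.
split=> //; first exact: (no_weak_limit hW orth complete hu YG Yv l00).
(* The constant mode alone is removed: [k0 = 1], with [lambda 1] positive. *)
have [nu wl nt] := rescaled_weak_limit hW orth complete hu YG Yv
  (eb_nondecreasing hphi) l1.
exists nu => //; move: wl; under eq_fun do under eq_fun do rewrite big_ord1.
exact.
Qed.
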